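(* Let $\alpha\ge 2$, $\mu>0$ and $b\in\mathbb{R}^3$, and consider the stochastic differential equation with reflection (called (E) in the context) with drift $b$, dispersion matrix $\sigma$ and oblique reflection in the cone $\overline{\mathcal{W}}\subset\mathbb{R}^3$, where $\sigma$, $\mathcal{W}$ and the cones of directions of reflection $G(x)$ are the ones given in the context. For a solution $X$ of (E), let $\vartheta^X:=\inf\{t\ge 0: X(t)=0\}$ and $\tau^{X,\delta}:=\inf\{t\ge 0: |X(t)|=\delta\}$ for $\delta>0$. If $\mu>\sqrt{\frac{3}{\sqrt{2}-1}}$, uniqueness in distribution holds for (E). If $X$ starts at $x\in\overline{\mathcal{W}}-\{0\}$, then $\mathbb{P}(\vartheta^X<\infty)=0$. If $X$ starts at $0$, then $\lim_{\delta\to 0}\tau^{X,\delta}=0$ almost surely.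
   Context: $\mathbb{R}^3_{++}$ is the strictly positive orthant and $\mathbb{R}^3_+$ the nonnegative orthant. A bar denotes closure. The cone is $$\mathcal{W}:=\Big\{x\in\mathbb{R}^3_{++}:\ x_j=q_j^{1/\alpha}+\tfrac{1}{\mu^2}(q_1+q_2+q_3)^{1/\alpha},\ j=1,2,3,\ \text{for some } q\in\mathbb{R}^3_{++}\Big\}.$$ For $h\in\{1,2,3\}$ its face $\partial_h\mathcal{W}$ is the set of the points of $\overline{\mathcal{W}}$ given by the same parametrization with $q_h=0$ and $q_j>0$ for $j\ne h$, that is $$\partial_h\mathcal{W}=\Big\{x\in\mathbb{R}^3_{++}:\ x_h=\tfrac{1}{\mu^2}\Big(\sum_{l\ne h}q_l\Big)^{1/\alpha},\ x_j=q_j^{1/\alpha}+x_h,\ q_j>0,\ j\neq h\Big\}.$$ The direction of reflection on $\partial_h\mathcal{W}$ is the constant vector $g^h$ with components $g^h_j=\delta_{jh}$ (the $h$-th standard basis vector). The cone of directions of reflection is $$G(x):=\Big\{g=\sum_{h:\,x\in\overline{\partial_h\mathcal{W}}}u_hg^h:\ u_h\ge 0\Big\}\ \text{ for } x\in\partial\mathcal{W}-\{0\},\qquad G(0):=\mathbb{R}^3_+.$$ The dispersion matrix is $$\sigma=2\begin{pmatrix}1+\frac1{\mu^2}&\frac1{\mu^2}&\frac1{\mu^2}\\ \frac1{\mu^2}&1+\frac1{\mu^2}&\frac1{\mu^2}\\ \frac1{\mu^2}&\frac1{\mu^2}&1+\frac1{\mu^2}\end{pmatrix}.$$ Equation (E)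 is: $$X(t)=X(0)+b\,t+\sigma W(t)+\int_0^t\gamma(s)\,d\lambda(s),\quad t\ge 0,$$ $$X(t)\in\overline{\mathcal{W}},\qquad \lambda(t)=\int_0^t\mathbf{1}_{\partial\mathcal{W}}(X(s))\,d\lambda(s),\quad t\ge 0,$$ $$\gamma(t)\in G(X(t)),\quad |\gamma(t)|=1,\quad d\lambda\text{-a.e.},\ t\ge 0.$$ A continuous process $X$ is a solution of (E) if there exist a standard Brownian motion $W$, a continuous nondecreasing process $\lambda$ and a process $\gamma$ with measurable paths, all defined on the same probability space as $X$, such that $W(t+\cdot)-W(t)$ is independent of $\mathcal{F}_t^{X,W,\lambda,\gamma}:=\sigma\{X(s),W(s),\lambda(s),\gamma(s):s\le t\}$ for all $t\ge 0$ and (E) is satisfied almost surely. $X$ starts at $x$ if $X(0)=x$ almost surely. Given an initial distribution on $\overline{\mathcal{W}}$, uniqueness in distribution holds if any two solutions of (E) with that same initial distribution have the same distribution on $C_{\overline{\mathcal{W}}}[0,\infty)$, the space of continuous functions from $[0,\infty)$ to $\overline{\mathcal{W}}$.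
   Formalization: The claim that a solution started at a nonzero x almost surely never reaches 0 is stated only under μ > sqrt(3/(√2−1)), because without that bound it fails for small μ, where 0 is reached with positive probability. *)

(* Defs.v *)
From HB Require Import structures.
From mathcomp Require Export all_boot all_order all_algebra.
From mathcomp Require Export all_classical all_reals all_analysis.

Set Implicit Arguments.
Unset Strict Implicit.
Unset Printing Implicit Defensive.
Import Order.TTheory GRing.Theory Num.Theory.
Import numFieldNormedType.Exports.

Local Open Scope classical_set_scope.
Local Open Scope ring_scope.

(* The norm that MathComp puts on matrices is the sup norm, so the Euclidean
   norm is defined separately; the two induce the same topology. *)
Definition enorm (R : realType) (x : 'cV[R]_3) : R :=
  Num.sqrt (\sum_i x i 0 ^+ 2).

Definition borel3 (R : realType) :=
  g_sigma_algebraType (open : set (set 'cV[R]_3)).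

Definition boundary (R : realType) (A : set 'cV[R]_3) : set 'cV[R]_3 :=
  closure A `\` interior A.

Definition cone (R : realType) (alpha mu : R) : set 'cV[R]_3 :=
  [set x | (forall j, 0 < x j 0) /\
    exists q : 'I_3 -> R, (forall j, 0 < q j) /\
      forall j, x j 0 = q j `^ alpha^-1
                        + (mu ^+ 2)^-1 * (\sum_l q l) `^ alpha^-1].

Definition face (R : realType) (alpha mu : R) (h : 'I_3) : set 'cV[R]_3 :=
  [set x | (forall j, 0 < x j 0) /\
    exists q : 'I_3 -> R, [/\ forall j, j != h -> 0 < q j,
      x h 0 = (mu ^+ 2)^-1 * (\sum_(l | l != h) q l) `^ alpha^-1 &
      forall j, j != h -> x j 0 = q j `^ alpha^-1 + x h 0]].

Definition refl_dir (R : realType) (h : 'I_3) : 'cV[R]_3 :=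
  \col_j (j == h)%:R.

(* Only the values of [refl_cone] on the boundary of the cone are meaningful. *)
Definition refl_cone (R : realType) (alpha mu : R) (x : 'cV[R]_3) :
    set 'cV[R]_3 :=
  [set g | if x == 0 then forall j, 0 <= g j 0
           else exists u : 'I_3 -> R, (forall h, 0 <= u h) /\
             g = \sum_(h | x \in closure (face alpha mu h))
                   u h *: refl_dir R h].

Definition dispersion (R : realType) (mu : R) : 'M[R]_3 :=
  2 *: \matrix_(i, j) ((i == j)%:R + (mu ^+ 2)^-1).

(* A process is a map [X : R -> T -> 'cV[R]_3], [X t w] being its value at time
   [t] for the outcome [w]; only times [t >= 0] are ever taken into account. *)

Definition rv3 (R : realType) d (T : measurableType d) (Y : T -> 'cV[R]_3) :=
  measurable_fun setT (Y : T -> borel3 R).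

Definition sigma3 (R : realType) d (T : measurableType d) (Y : T -> 'cV[R]_3) :
    set (set T) :=
  preimage_set_system setT (Y : T -> borel3 R) measurable.

Definition continuous_process (R : realType) d (T : measurableType d)
    (X : R -> T -> 'cV[R]_3) :=
  (forall t, 0 <= t -> rv3 (X t)) /\
  (forall w, {within `[0, +oo[, continuous (fun t => X t w)}).

Definition independent_systems (R : realType) d (T : measurableType d)
    (P : probability T R) (F G : set (set T)) :=
  forall A B, F A -> G B -> P (A `&` B) = (P A * P B)%E.

Definition brownian_motion (R : realType) d (T : measurableType d)
    (P : probability T R) (W : R -> T -> 'cV[R]_3) :=
  [/\ continuous_process W,
      {ae P, forall w, W 0 w = 0},
      forall s t, 0 <= s -> s < t -> forall B : 'I_3 -> set R,
        (forall i, measurable (B i)) ->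
        P [set w | forall i, B i ((W t w - W s w) i 0)] =
        \big[*%E/1%E]_(i < 3) normal_prob 0 (Num.sqrt (t - s)) (B i) &
      forall s t, 0 <= s -> s < t ->
        independent_systems P (sigma3 (fun w => W t w - W s w))
          <<s \bigcup_(r in `[0, s]) sigma3 (W r) >>].

Definition filtration (R : realType) d (T : measurableType d)
    (X W gamma : R -> T -> 'cV[R]_3) (lam : T -> cumulative R R) (t : R) :
    set (set T) :=
  <<s \bigcup_(s in `[0, t])
        (sigma3 (X s) `|` sigma3 (W s) `|` sigma3 (gamma s) `|`
         preimage_set_system setT (fun w => lam w s : R)
           (measurable : set (set R))) >>.

Definition future_increments (R : realType) d (T : measurableType d)
    (W : R -> T -> 'cV[R]_3) (t : R) : set (set T) :=
  <<s \bigcup_(u in `[0, +oo[) sigma3 (fun w => W (t + u) w - W t w) >>.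

Definition equation_E (R : realType) (alpha mu : R) (b : 'cV[R]_3)
    (x W gamma : R -> 'cV[R]_3) (lam : cumulative R R) :=
  let dlam := lebesgue_stieltjes_measure lam in
  [/\ forall t, 0 <= t ->
        x t = x 0 + t *: b + dispersion mu *m W t
              + \col_i (\int[dlam]_(s in `[0, t]) gamma s i 0)%R,
      forall t, 0 <= t -> closure (cone alpha mu) (x t),
      forall t, 0 <= t ->
        (lam t)%:E =
        (\int[dlam]_(s in `[0%R, t])
           (\1_(boundary (cone alpha mu)) (x s))%:E)%E &
      {ae dlam, forall t, 0 <= t ->
        refl_cone alpha mu (x t) (gamma t) /\ enorm (gamma t) = 1}].

(* The paths of lambda are taken to be continuous and nondecreasing on the whole
   line because Lebesgue-Stieltjes measures are built from such functions; only
   their restrictions to [0, +oo) matter, and by continuity {0} is not charged. *)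
Definition solution (R : realType) (alpha mu : R) (b : 'cV[R]_3)
    d (T : measurableType d) (P : probability T R) (X : R -> T -> 'cV[R]_3) :=
  continuous_process X /\
  exists (W gamma : R -> T -> 'cV[R]_3) (lam : T -> cumulative R R),
    [/\ brownian_motion P W,
        (forall t, 0 <= t -> measurable_fun setT (fun w => lam w t : R)) /\
        (forall w, continuous (lam w : R -> R)),
        (forall t, 0 <= t -> rv3 (gamma t)) /\
        (forall w, measurable_fun (`[0, +oo[ : set R)
                     (fun t => gamma t w : borel3 R)),
        forall t, 0 <= t ->
          independent_systems P (future_increments W t)
            (filtration X W gamma lam t) &
        {ae P, forall w, equation_E alpha mu b
           (X ^~ w) (W ^~ w) (gamma ^~ w) (lam w)}].

(* Continuous paths from [0, +oo) to [D], represented by functions on R whose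
   values at negative times are disregarded. *)
Definition path_space (R : realType) (D : set 'cV[R]_3) :
    set (R -> 'cV[R]_3) :=
  [set f : R -> 'cV[R]_3 |
    {within `[0, +oo[, continuous f} /\ forall t, 0 <= t -> D (f t)].

(* Open sets for uniform convergence on compact time intervals. *)
Definition path_open (R : realType) (D : set 'cV[R]_3) :
    set (set (R -> 'cV[R]_3)) :=
  [set O | O `<=` path_space D /\
    forall f, O f -> exists c e : R, 0 < e /\
      forall g, path_space D g ->
        (forall t, 0 <= t <= c -> enorm (g t - f t) < e) -> O g].

Definition path_borel (R : realType) (D : set 'cV[R]_3) :
    set (set (R -> 'cV[R]_3)) :=
  <<s path_space D, path_open D >>.

Definition path_law (R : realType) d (T : measurableType d)
    (P : probability T R) (X : R -> T -> 'cV[R]_3)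
    (A : set (R -> 'cV[R]_3)) : \bar R :=
  P [set w | A (X ^~ w)].

Definition initial_distribution (R : realType) d (T : measurableType d)
    (P : probability T R) (X : R -> T -> 'cV[R]_3)
    (nu : probability (borel3 R) R) :=
  forall A : set (borel3 R), measurable A -> P (X 0 @^-1` A) = nu A.

Definition uniqueness_in_distribution (R : realType) (alpha mu : R)
    (b : 'cV[R]_3) :=
  forall nu : probability (borel3 R) R,
    nu (closure (cone alpha mu)) = 1%E ->
  forall d (T : measurableType d) (P : probability T R)
         (X : R -> T -> 'cV[R]_3)
         d' (T' : measurableType d') (P' : probability T' R)
         (X' : R -> T' -> 'cV[R]_3),
    solution alpha mu b P X -> initial_distribution P X nu ->
    solution alpha mu b P' X' -> initial_distribution P' X' nu ->
  forall A, path_borel (closure (cone alpha mu)) A ->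
    path_law P X A = path_law P' X' A.

Definition starts_at (R : realType) d (T : measurableType d)
    (P : probability T R) (X : R -> T -> 'cV[R]_3) (x : 'cV[R]_3) :=
  {ae P, forall w, X 0 w = x}.

Definition hit0 (R : realType) (T : Type) (X : R -> T -> 'cV[R]_3) (w : T) :
    \bar R :=
  ereal_inf [set t%:E | t in [set t : R | 0 <= t /\ X t w = 0]].

Definition hit_sphere (R : realType) (T : Type) (X : R -> T -> 'cV[R]_3)
    (delta : R) (w : T) : \bar R :=
  ereal_inf [set t%:E | t in [set t : R | 0 <= t /\ enorm (X t w) = delta]].

(* Main.v *)
(** Write [face_fun h x = x_h - mu^-2 * gap x h], where [gap x h] is the
    l^alpha-norm of the vector of the positive parts of [x_j - x_h].  These three
    functions are nonnegative on the closed cone and [face_fun h] vanishes on the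
    closure of the h-th face, so that for a solution [X] of (E) the regulator
    [X - psi], with [psi t = X 0 + t b + sigma W t], is coordinatewise
    nondecreasing and its h-th coordinate increases only when [face_fun h X = 0].

    Uniqueness.  The regulator is the fixed point of
    [y_h(t) |-> sup_(s <= t) max 0 (y_h - theta * face_fun h (psi + y))(s)], which
    is a contraction of the uniform norm for [theta = (1 + 3 mu^-2)^-1].  Discrete
    Picard iterations on dyadic grids thus express [X] as a measurable functional
    of [psi], whose law is determined by the initial distribution.

    Nonattainability of 0.  Let [r = |X|^2] and [V = ln ((1 + r) / (e + r))].  All
    reflection directions are nonnegative, so reflection can only increase [r] and
    decrease [V].  The matrix [A = sigma sigma^T] satisfies
    [tr A * |x|^2 > 2 * x^T A x] when [(1 + 3 mu^-2)^2 < 2], which is the condition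
    on [mu]; it makes [V], stopped when [r <= e], a supermartingale up to a drift
    bounded uniformly in [e].  This is established along time grids by a
    fourth-order expansion in the Gaussian increments, and
    [P (r <= e before T) <= (V(x) + C T) / V(e)], which tends to 0 with [e].

    Start at 0.  While [X] stays at 0 the regulator is nondecreasing and equals
    [- psi], so no increment of [W] over a cell of mesh [h] can have all its
    coordinates above [C h]; such an increment has a probability bounded below
    independently of [h], hence [X] leaves 0 immediately. *)
Require Import Defs.
From HB Require Import structures.
From mathcomp Require Import all_boot all_order all_algebra.
From mathcomp Require Import all_classical all_reals all_analysis.
From mathcomp Require Import measurable_realfun lebesgue_Rintegral.
From mathcomp Require Import ring lra.
Set Implicit Arguments.
Unset Strict Implicit.
Unset Printing Implicit Defensive.
Import Order.TTheory GRing.Theory Num.Theory.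
Import numFieldNormedType.Exports.
Local Open Scope classical_set_scope.
Local Open Scope ring_scope.

(** The parametrization gives [x_j - x_h = q_j^(1/alpha) - q_h^(1/alpha)]; when [q_h = 0], the
    [alpha]-th powers of these differences add up to the sum of the [q_l]. This is how [gap]
    eliminates the parameters. As [gap] sees only differences, its variation is controlled by
    [D - (y_h - y'_h)], where [D] bounds the distance of [y] and [y']; the value of [theta] is the
    one for which this exactly cancels the variation of [y_h] itself. Two solutions may live on
    different probability spaces and cannot be compared path by path. Hence the need for a
    functional that is defined on every path and reads countably many times only. Expansions on
    grids stand in for Ito's formula. Over a cell of length [h] they err by a multiple of [h^2] that
    depends on [e], which disappears when the mesh is refined with [e] fixed. The drift bound [C],
    on the contrary, does not shrink with the mesh and must be found before [e]; then the growth of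
    [V(e)], of order [ln (1/e)], wins. *)

(** * Borel sets of three-dimensional space *)

Lemma continuous_measurable_borel3 (R : realType) (f : 'cV[R]_3 -> R) :
  continuous f -> measurable_fun setT (f : borel3 R -> R).
Proof.
move=> cf; apply: (measurability _ (RGenOpens.measurableE R)).
move=> _ [_ [a [b ->]] <-]; rewrite setTI; apply: sub_sigma_algebra.
by apply: open_comp => //; exact: interval_open.
Qed.

Lemma measurable_coord (R : realType) (i : 'I_3) :
  measurable_fun setT ((fun x => x i 0) : borel3 R -> R).
Proof. by apply: continuous_measurable_borel3; exact: coord_continuous. Qed.

Lemma open_bigcup_rat_ball (R : realType) (U : set 'cV[R]_3) : open U ->
  U = \bigcup_(p in [set p : {ffun 'I_3 -> rat} * nat |
        ball (\col_i ratr (p.1 i) : 'cV[R]_3) p.2.+1%:R^-1 `<=` U])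
      ball (\col_i ratr (p.1 i) : 'cV[R]_3) p.2.+1%:R^-1.
Proof.
move=> oU; apply/seteqP; split=> [x Ux|x [p pU]]; last exact: pU.
have /nbhs_ballP[e /= e0 eU] := open_nbhs_nbhs (conj oU Ux).
have [n n_e] : exists n, n.+1%:R^-1 < e / 2.
  exists (Num.truncn (e / 2)^-1).
  rewrite -[ltRHS]invrK ltf_pV2 ?posrE ?invr_gt0 ?divr_gt0//.
  by rewrite truncnS_gt.
have n0 : 0 < n.+1%:R^-1 :> R by rewrite invr_gt0.
have [c xc] : exists c : {ffun 'I_3 -> rat}, forall i, `|ratr (c i) - x i 0| < n.+1%:R^-1.
  have /(_ _)/cid H i : exists q : rat, `|ratr q - x i 0| < n.+1%:R^-1.
    have /rat_in_itvoo[q] : x i 0 < x i 0 + n.+1%:R^-1 by rewrite ltrDl.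
    rewrite in_itv/= => /andP[? ?]; exists q; rewrite ltr_norml ltrBlDl.
    by apply/andP; split=> //; rewrite ltrBrDr (lt_trans _ (_ : x i 0 < _)) // gtrDr oppr_lt0.
  by exists [ffun i => sval (H i)] => i; rewrite ffunE; case: (H i).
have cx : ball (\col_i ratr (c i) : 'cV[R]_3) n.+1%:R^-1 x.
  by split=> // i j; rewrite !mxE /ball /= ord1.
exists (c, n) => //= y cy; apply: eU.
apply: (@le_ball _ _ _ (n.+1%:R^-1 + n.+1%:R^-1)); first by rewrite ltW// (splitr e) ltrD.
by apply: ball_triangle cy; exact: ball_sym.
Qed.

(** Balls of the sup norm are boxes, and countably many rational ones generate the open sets. The
    preimage of a box is a finite intersection of preimages under coordinates. *)
Lemma measurable_fun_borel3P (R : realType) d (T : measurableType d)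
    (D : set T) (Y : T -> 'cV[R]_3) :
  measurable_fun D (Y : T -> borel3 R) <->
  forall i, measurable_fun D (fun w => Y w i 0).
Proof.
split=> [mY i|mY].
  exact: (@measurableT_comp _ _ _ _ _ _ ((fun x => x i 0) : borel3 R -> R) D Y
    (measurable_coord i) mY).
move=> mD; suff : measurable_fun D (Y : T -> borel3 R) by apply.
apply: (@measurability _ _ _ _ D (Y : T -> borel3 R) open) => //.
move=> _ [U oU <-]; rewrite (open_bigcup_rat_ball oU) preimage_bigcup setI_bigcupr.
rewrite bigcup_mkcond; apply: countable_bigcupT_measurable => [|[c n]].
  exact: countableP.
case: ifPn => // _; rewrite (_ : _ `&` _ = \bigcap_(i : 'I_3) (D `&` (fun w => Y w i 0) @^-1`
    ball (ratr (c i) : R) n.+1%:R^-1)); last first.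
  apply/seteqP; split=> [w [Dw [_ +]] i _|w H].
    by move=> /(_ i 0); rewrite mxE.
  split; first by case: (H 0).
  by split=> // i j; rewrite mxE ord1; case: (H i).
apply: fin_bigcap_measurable => //= i _; apply: mY => //.
exact: measurable_ball.
Qed.

(** * Face functions of the cone and their contraction property *)

Definition pnorm (R : realType) (p : R) (u : 'I_3 -> R) : R :=
  (\sum_j u j `^ p) `^ p^-1.

Definition gap (R : realType) (p : R) (x : 'cV[R]_3) (h : 'I_3) : R :=
  pnorm p (fun j => Num.max 0 (x j 0 - x h 0)).

(* On the closed cone [face_fun p mu h] is nonnegative, and it vanishes on the
   closure of the face [h]. *)
Definition face_fun (R : realType) (p mu : R) (h : 'I_3) (x : 'cV[R]_3) : R :=
  x h 0 - (mu ^+ 2)^-1 * gap p x h.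

Lemma powR_invK (R : realType) (p x : R) :
  p != 0 -> 0 <= x -> (x `^ p) `^ p^-1 = x.
Proof. by move=> p0 x0; rewrite -powRrM divff// powRr1. Qed.

Lemma powR_Kinv (R : realType) (p x : R) :
  p != 0 -> 0 <= x -> (x `^ p^-1) `^ p = x.
Proof. by move=> p0 x0; rewrite -powRrM mulVf// powRr1. Qed.

Lemma sum_powR_ge0 (R : realType) (p : R) (u : 'I_3 -> R) : 0 <= \sum_j u j `^ p.
Proof. by rewrite sumr_ge0// => j _; exact: powR_ge0. Qed.

Lemma pnorm_ge0 (R : realType) (p : R) (u : 'I_3 -> R) : 0 <= pnorm p u.
Proof. exact: powR_ge0. Qed.

Lemma le_pnorm (R : realType) (p : R) (u v : 'I_3 -> R) : 0 <= p ->
  (forall j, 0 <= u j <= v j) -> pnorm p u <= pnorm p v.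
Proof.
move=> p0 uv; rewrite ge0_ler_powR ?invr_ge0 ?nnegrE ?sum_powR_ge0//.
apply: ler_sum => j _; have /andP[u0 le_uv] := uv j.
by apply: ge0_ler_powR; rewrite ?nnegrE// (le_trans u0).
Qed.

Lemma le_coord_pnorm (R : realType) (p : R) (u : 'I_3 -> R) (i : 'I_3) : 0 < p ->
  0 <= u i -> u i <= pnorm p u.
Proof.
move=> p0 ui; rewrite -{1}(powR_invK (lt0r_neq0 p0) ui).
rewrite ge0_ler_powR ?invr_ge0 ?nnegrE ?(ltW p0) ?powR_ge0 ?sum_powR_ge0//.
by rewrite (bigD1 i)//= lerDl sumr_ge0// => j _; exact: powR_ge0.
Qed.

Lemma convex_combination_powR (R : realType) (p t x y : R) : 1 <= p ->
  0 <= t <= 1 -> 0 <= x -> 0 <= y ->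
  (t * x + (1 - t) * y) `^ p <= t * x `^ p + (1 - t) * y `^ p.
Proof.
move=> p1 /andP[t0 t1] x0 y0.
have := convex_powR p1 (Itv01 t0 t1); move=> /(_ x y).
rewrite !inE /= !in_itv /= x0 y0 => /(_ isT isT).
by rewrite !convRE /=.
Qed.

(* The bound [3] replaces the sharper constant [3 `^ p^-1] of Minkowski's
   inequality. *)
Lemma pnorm_shift (R : realType) (p d : R) (u : 'I_3 -> R) : 1 <= p -> 0 <= d ->
  (forall j, 0 <= u j) -> pnorm p (fun j => u j + d) <= pnorm p u + 3 * d.
Proof.
move=> p1 d0 u0; set N := pnorm p u.
have p0 : 0 < p by exact: lt_le_trans p1.
have N0 : 0 <= N by exact: pnorm_ge0.
have [S0|S0] := eqVneq (N + 3 * d) 0.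
  have [N00 d00] : N = 0 /\ d = 0 by split; lra.
  by rewrite S0 -N00 d00 /N /pnorm; under eq_bigr do rewrite addr0.
have Sp : 0 < N + 3 * d by rewrite lt_neqAle eq_sym S0/= addr_ge0// mulr_ge0.
(* With this weight, [u j + d] is [N + 3 * d] times the convex combination of [u j / N] and [3^-1].
   Convexity of the [p]-th power then suffices, because both vectors have a sum of [p]-th powers at
   most 1. *)
pose t := N / (N + 3 * d).
have t01 : 0 <= t <= 1.
  by rewrite /t divr_ge0 ?(ltW Sp)//= ler_pdivrMr// mul1r lerDl mulr_ge0.
(* When [N = 0] every [u j] vanishes, in agreement with the convention that division by 0 gives
   0. *)
have uN j : u j = N * (u j / N).
  have [N00|N00] := eqVneq N 0; last by rewrite mulrCA divff// mulr1.
  by rewrite N00 mul0r; apply: le_anti; rewrite u0 andbT -N00 le_coord_pnorm.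
have sum_u : \sum_j (u j / N) `^ p <= 1.
  under eq_bigr => j _ do rewrite powRM ?invr_ge0//.
  rewrite -mulr_suml.
  have [N00|N00] := eqVneq N 0.
    by rewrite N00 invr0 powR0 ?mulr0 ?gt_eqF.
  have -> : \sum_j u j `^ p = N `^ p.
    rewrite /N /pnorm powR_Kinv ?gt_eqF//.
    exact: sum_powR_ge0.
  rewrite -powRM ?invr_ge0// divff//.
  by rewrite powR1.
have third : 3 * (3^-1 `^ p) <= 1 :> R.
  apply: (@le_trans _ _ (3 * 3^-1)); last by rewrite divff.
  by rewrite ler_pM2l// ge1r_powR// invr_gt0 ltr0n/= invf_le1// ler1n.
have E : \sum_j (u j + d) `^ p <= (N + 3 * d) `^ p.
  rewrite -[leRHS]mulr1.
  apply: (@le_trans _ _ ((N + 3 * d) `^ p *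
      \sum_j (t * (u j / N) `^ p + (1 - t) * 3^-1 `^ p))); last first.
    rewrite ler_wpM2l ?powR_ge0// big_split /= -mulr_sumr sumr_const card_ord.
    rewrite -[_ *+ 3]mulr_natl.
    have /andP[t0 t1] := t01.
    have := ler_wpM2l t0 sum_u.
    have t1' : 0 <= 1 - t by lra.
    have := ler_wpM2l t1' third.
    by move: (3^-1 `^ p) (\sum_(i < 3) _) => a c; lra.
  rewrite mulr_sumr; apply: ler_sum => j _.
  have -> : u j + d = (N + 3 * d) * (t * (u j / N) + (1 - t) * 3^-1).
    rewrite mulrDr mulrA /t [_ * (N / _)]mulrCA divff// mulr1 -uN.
    by field.
  have /andP[t0 t1] := t01.
  have uN0 : 0 <= u j / N by rewrite divr_ge0.
  rewrite powRM ?(ltW Sp)// ?addr_ge0 ?mulr_ge0 ?invr_ge0 ?subr_ge0//.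
  rewrite ler_wpM2l ?powR_ge0// convex_combination_powR//.
  exact: ltW.
rewrite -[leRHS](powR_invK (lt0r_neq0 p0)) ?(ltW Sp)//.
by rewrite ge0_ler_powR ?invr_ge0 ?nnegrE ?powR_ge0 ?sum_powR_ge0 ?(ltW p0).
Qed.

Lemma gap_ge0 (R : realType) (p : R) (x : 'cV[R]_3) h : 0 <= gap p x h.
Proof. exact: pnorm_ge0. Qed.

(** Taking positive parts turns an excess of at most [d] in each difference into a shift by at most
    [d], which [pnorm_shift] bounds. The hypothesis is one-sided and about differences, as the
    contraction estimate requires. *)
Lemma gap_le (R : realType) (p d : R) (x y : 'cV[R]_3) h : 1 <= p -> 0 <= d ->
  (forall j, x j 0 - x h 0 <= y j 0 - y h 0 + d) -> gap p x h <= gap p y h + 3 * d.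
Proof.
move=> p1 d0 xy; apply: le_trans (pnorm_shift p1 d0 _); last first.
  by move=> j; rewrite le_max lexx.
apply: le_pnorm; first exact: le_trans p1.
move=> j; rewrite le_max lexx/= ge_max; apply/andP; split.
  by rewrite addr_ge0// le_max lexx.
by apply: le_trans (xy j) _; rewrite lerD2r le_max lexx orbT.
Qed.

Lemma coord_le_norm (R : realType) (x : 'cV[R]_3) i : `|x i 0| <= `|x|.
Proof.
rewrite [leRHS]mx_normrE.
by apply: (le_trans _ (le_bigmax _ _ (i, 0))).
Qed.

Lemma gap_lipschitz (R : realType) (p : R) (x y : 'cV[R]_3) h : 1 <= p ->
  gap p x h <= gap p y h + 6 * `|x - y|.
Proof.
move=> p1; have -> : 6 * `|x - y| = 3 * (2 * `|x - y|) by ring.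
apply: gap_le => // j.
have := coord_le_norm (x - y) j; have := coord_le_norm (x - y) h.
rewrite !mxE !ler_norml => /andP[? ?] /andP[? ?]; lra.
Qed.

Section face_function.
Variables (R : realType) (p mu : R).
Hypotheses (p1 : 1 <= p) (mu0 : 0 < mu).
Let eps := (mu ^+ 2)^-1.

Let eps0 : 0 < eps. Proof. by rewrite invr_gt0 exprn_gt0. Qed.

Lemma face_fun_lipschitz h (x y : 'cV[R]_3) :
  `|face_fun p mu h x - face_fun p mu h y| <= (1 + 6 * eps) * `|x - y|.
Proof.
have := coord_le_norm (x - y) h; rewrite !mxE ler_norml => /andP[H1 H2].
have Gxy := ler_wpM2l (ltW eps0) (gap_lipschitz x y h p1).
have := ler_wpM2l (ltW eps0) (gap_lipschitz y x h p1); rewrite distrC => Gyx.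
have key : forall g g' a b n e : R, - n <= a - b -> a - b <= n ->
    e * g <= e * (g' + 6 * n) -> e * g' <= e * (g + 6 * n) ->
    - ((1 + 6 * e) * n) <= a - e * g - (b - e * g') <= (1 + 6 * e) * n.
  by clear; move=> *; apply/andP; split; lra.
rewrite ler_norml; apply key; [exact H1|exact H2|exact Gxy|exact Gyx].
Qed.

Lemma continuous_face_fun h : continuous (face_fun p mu h).
Proof.
move=> x; apply/(@cvgrPdist_lt _ _ _ (nbhs x)) => e e0.
have C0 : 0 < 1 + 6 * eps by rewrite addr_gt0// mulr_gt0.
near=> y; apply: le_lt_trans (face_fun_lipschitz _ _ _) _.
rewrite mulrC -ltr_pdivlMr//; near: y.
exact: (@cvgr_dist_lt _ _ _ (nbhs x) _ id x (@cvg_id _ _) _ (divr_gt0 e0 C0)).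
Unshelve. all: by end_near. Qed.

(** The positive part of [x_j - x_h] is at most [q_j^(1/p)], so [gap] is at most the [p]-norm of
    these roots, that is [(\sum_l q_l)^(1/p)]; the coordinate [x_h] contains [eps] times this
    quantity. *)
Lemma cone_face_fun h x : cone p mu x -> 0 <= face_fun p mu h x.
Proof.
move=> [_ [q [q0 xq]]]; rewrite /face_fun subr_ge0 -/eps.
rewrite [leRHS]xq -/eps; apply: (@le_trans _ _ (eps * (\sum_l q l) `^ p^-1)); last first.
  by rewrite lerDr powR_ge0.
have p0 : 0 < p by exact: lt_le_trans p1.
rewrite ler_wpM2l ?(ltW eps0)//.
apply: (@le_trans _ _ (pnorm p (fun j => q j `^ p^-1))).
  apply: le_pnorm; first exact: ltW.
  move=> j; rewrite le_max lexx/= ge_max powR_ge0/= !xq.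
  by have := powR_ge0 (q h) p^-1; lra.
rewrite /pnorm (eq_bigr q)// => j _.
by rewrite powR_Kinv ?gt_eqF ?(ltW (q0 j)).
Qed.

Lemma face_face_fun h x : face p mu h x -> face_fun p mu h x = 0.
Proof.
move=> [_ [q [q0 xh xq]]]; apply/eqP; rewrite subr_eq0; apply/eqP.
have p0 : 0 < p by exact: lt_le_trans p1.
rewrite {1}xh; congr (_ * _ `^ _); rewrite [RHS](bigD1 h)//=.
rewrite subrr maxxx powR0 ?gt_eqF// add0r; apply: eq_bigr => j jh.
rewrite xq// addrK (max_idPr _) ?powR_ge0//.
by rewrite powR_Kinv ?gt_eqF// ltW// q0.
Qed.

Lemma closure_cone_face_fun h x :
  closure (cone p mu) x -> 0 <= face_fun p mu h x.
Proof.
have cl : closed (face_fun p mu h @^-1` [set y | 0 <= y]).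
  by apply: closed_comp => [y _|]; [exact: continuous_face_fun|exact: closed_ge].
move=> /(closure_subset (_ : _ `<=` _)) => /(_ _ (fun y => @cone_face_fun h y)).
by rewrite -(proj1 (closure_id _) cl).
Qed.

Lemma closure_face_face_fun h x :
  closure (face p mu h) x -> face_fun p mu h x = 0.
Proof.
have cl : closed (face_fun p mu h @^-1` [set 0]).
  by apply: closed_comp => [y _|]; [exact: continuous_face_fun|exact: closed_eq].
move=> /(closure_subset (_ : _ `<=` _)) => /(_ _ (fun y => @face_face_fun h y)).
by rewrite -(proj1 (closure_id _) cl).
Qed.

Lemma face_fun0 h : face_fun p mu h 0 = 0.
Proof.
have p0 : 0 < p by exact: lt_le_trans p1.
rewrite /face_fun /gap /pnorm !mxE; under eq_bigr do rewrite !mxE subrr maxxx powR0 ?gt_eqF//.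
by rewrite big1// powR0 ?invr_eq0 ?gt_eqF// mulr0 subrr.
Qed.

Lemma closure_cone_coord_ge0 h x : closure (cone p mu) x -> 0 <= x h 0.
Proof.
move=> /(closure_cone_face_fun h); rewrite subr_ge0; apply: le_trans.
by rewrite mulr_ge0 ?gap_ge0 ?(ltW eps0).
Qed.

(** The [j]-th term of [gap] alone yields it. It makes each coordinate comparable with the norm, so
    that near the apex a relatively small displacement cannot make a coordinate negative. *)
Lemma closure_cone_coord_ge i j x : closure (cone p mu) x ->
  eps * x j 0 <= (1 + eps) * x i 0.
Proof.
move=> /(closure_cone_face_fun i); rewrite subr_ge0 -/eps => H.
have p0 : 0 < p by exact: lt_le_trans p1.
have : Num.max 0 (x j 0 - x i 0) <= gap p x i.
  by apply: (le_coord_pnorm (u := fun k => Num.max 0 (x k 0 - x i 0))); rewrite ?le_max ?lexx.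
rewrite ge_max => /andP[_ /(ler_wpM2l (ltW eps0))]; lra.
Qed.

(** With [E = y_h - y'_h], the difference is [(1 - theta) * E] plus [theta * eps] times the
    variation of [gap], which is at most [3 * (D - E)]. Since [3 * theta * eps = 1 - theta], the
    terms in [E] cancel and [(1 - theta) * D] remains. *)
Lemma face_fun_contraction h (psi y y' : 'cV[R]_3) (D : R) :
  (forall j, `|y j 0 - y' j 0| <= D) ->
  `|(y h 0 - (1 + 3 * eps)^-1 * face_fun p mu h (psi + y))
    - (y' h 0 - (1 + 3 * eps)^-1 * face_fun p mu h (psi + y'))|
  <= (1 - (1 + 3 * eps)^-1) * D.
Proof.
set theta := (1 + 3 * eps)^-1 => yD.
have t0 : 0 < theta by rewrite invr_gt0 addr_gt0// mulr_gt0.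
have t1 : theta <= 1 by rewrite invf_le1 ?addr_gt0 ?mulr_gt0// lerDl mulr_ge0 ?(ltW eps0).
have te : 3 * theta * eps = 1 - theta.
  by rewrite /theta; field; rewrite gt_eqF// addr_gt0// mulr_gt0.
have half (u v : 'cV[R]_3) : (forall j, `|u j 0 - v j 0| <= D) ->
    (u h 0 - theta * face_fun p mu h (psi + u))
    - (v h 0 - theta * face_fun p mu h (psi + v)) <= (1 - theta) * D.
  move=> uv; have D0 : 0 <= D - (u h 0 - v h 0).
    by rewrite subr_ge0 (le_trans (ler_norm _)).
  have : gap p (psi + u) h <= gap p (psi + v) h + 3 * (D - (u h 0 - v h 0)).
    apply: gap_le => // j; rewrite !mxE.
    by have := le_trans (ler_norm _) (uv j); lra.
  move=> /(ler_wpM2l (ltW (mulr_gt0 t0 eps0))).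
  rewrite /face_fun !mxE -/eps.
  have -> : theta * eps * (gap p (psi + v) h + 3 * (D - (u h 0 - v h 0))) =
    theta * eps * gap p (psi + v) h + (1 - theta) * (D - (u h 0 - v h 0)).
    by rewrite -te; ring.
  suff key : forall t e g g' E a b c : R,
      t * e * g <= t * e * g' + (1 - t) * (E - (a - b)) ->
      a - t * (c + a - e * g) - (b - t * (c + b - e * g')) <= (1 - t) * E.
    exact: key.
  by clear; move=> *; lra.
rewrite ler_norml; apply/andP; split; last exact: half.
rewrite lerNl opprB; apply: half => j; rewrite distrC; exact: yD.
Qed.

End face_function.

(** * Picard iteration on grids for the regulator *)

(** Freezing a path at its initial value for negative times makes results on functions continuous on
    the whole line applicable. *)
Lemma continuous_max0 (R : realType) (V : topologicalType) (f : R -> V) :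
  {within `[0, +oo[, continuous f} -> continuous (fun t : R => f (Num.max 0 t)).
Proof.
move=> /subspace_continuousP cf t.
have m0 : 0 <= Num.max 0 t by rewrite le_max lexx.
have {}cf := cf (Num.max 0 t); rewrite /= in_itv/= andbT in cf.
have cm : (fun s : R => Num.max 0 s) @ t --> within `[0, +oo[ (nbhs (Num.max 0 t)).
  move=> A; rewrite /within/= => HA.
  have cM : continuous (fun s : R^o => Num.max 0 s).
    by move=> s; apply: continuous_max; [exact: cst_continuous|exact: cvg_id].
  have : \forall s \near t, `[0, +oo[%classic (Num.max 0 s) -> A (Num.max 0 s).
    exact: cM t _ HA.
  apply: (filterS (F := nbhs t)) => s; apply.
  by rewrite /= in_itv/= andbT le_max lexx.
exact: (cvg_comp _ _ cm (cf m0)).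
Qed.

Lemma unif_continuous_itv (R : realType) (V : normedModType R) (f : R -> V)
    (a b e : R) :
  continuous f -> 0 < e ->
  exists2 d, 0 < d & forall u v, a <= u <= b -> `|u - v| < d -> `|f u - f v| < e.
Proof.
move=> cf e0.
have := @segment_compact R a b; move=> /compact_near_coveringP/(_ _ (0^'+)
  (fun d u => forall v, `|u - v| < d -> `|f u - f v| < e) _) H.
have {}H : \forall d \near 0^'+, `[a, b]%classic `<=`
    (fun u => forall v, `|u - v| < d -> `|f u - f v| < e).
  apply: H => x _.
  have e20 : 0 < e / 2 by rewrite divr_gt0.
  have /(@cvgrPdist_lt _ _ _ (nbhs x) _ f)/(_ _ e20) := cf x.
  move=> /nbhs_ballP[d /= d0 dP].
  have d20 : 0 < d / 2 by rewrite divr_gt0.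
  exists (ball x (d / 2), [set d' | d' < d / 2]).
    split => /=; first exact: nbhsx_ballx.
    by exact: nbhs_right_lt.
  move=> [x' d'] [/= xx' d'd] v x'v.
  have -> : f x' - f v = (f x - f v) - (f x - f x') by rewrite opprB [RHS]addrC addrA subrK.
  rewrite (le_lt_trans (ler_normB _ _))// (splitr e) ltrD//; apply: dP; rewrite /ball/=.
    have -> : x - v = (x - x') + (x' - v) by ring.
    rewrite (le_lt_trans (ler_normD _ _))// (splitr d) ltrD//.
    exact: lt_trans d'd.
  by apply: lt_le_trans xx' _; rewrite ler_pdivrMr// ler_peMr ?(ltW d0)// ler1n.
have [d [d0 dP]] : exists d, 0 < d /\ `[a, b]%classic `<=`
    (fun u => forall v, `|u - v| < d -> `|f u - f v| < e).
  near (0 : R)^'+ => d; exists d; split=> //.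
  by near: d; exact: H.
by exists d => // u v uab; apply: dP; rewrite /= in_itv.
Unshelve. all: by end_near. Qed.

Fixpoint running_max (R : realType) (f : nat -> R) (k : nat) : R :=
  if k is k'.+1 then Num.max (running_max f k') (f k) else Num.max 0 (f 0%N).

Section running_max_theory.
Variable R : realType.
Implicit Types (f g : nat -> R) (c : R).

Lemma running_max_ge0 f k : 0 <= running_max f k.
Proof. by elim: k => [|k IH] /=; rewrite le_max ?lexx ?IH. Qed.

Lemma le_running_max f k : f k <= running_max f k.
Proof. by case: k => [|k] /=; rewrite le_max lexx orbT. Qed.

Lemma running_max_le f k c : 0 <= c -> (forall j, (j <= k)%N -> f j <= c) ->
  running_max f k <= c.
Proof.
move=> c0; elim: k => [|k IH] H /=; rewrite ge_max ?c0 H//= andbT.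
by apply: IH => j jk; apply: H; exact: leqW.
Qed.

Lemma running_max_dist f g k c : 0 <= c ->
  (forall j, (j <= k)%N -> `|f j - g j| <= c) ->
  `|running_max f k - running_max g k| <= c.
Proof.
move=> c0.
have half f' g' : (forall j, (j <= k)%N -> `|f' j - g' j| <= c) ->
    running_max f' k <= running_max g' k + c.
  elim: k => [|k IH] H /=.
    rewrite ge_max addr_ge0 ?le_max ?lexx//=.
    have /ler_normlP[_] := H 0%N isT; rewrite lerBlDl => /le_trans; apply.
    by rewrite lerD2r le_max lexx orbT.
  rewrite ge_max; apply/andP; split.
    have {}IH := IH (fun j jk => H j (leqW jk)).
    by rewrite (le_trans IH)// lerD2r le_max lexx.
  have /ler_normlP[_] := H k.+1 (leqnn _); rewrite lerBlDl => /le_trans; apply.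
  by rewrite lerD2r le_max lexx orbT.
move=> H; apply/ler_normlP; split.
  by rewrite opprB lerBlDl; apply: half => j jk; rewrite distrC; exact: H.
by rewrite lerBlDl; apply: half.
Qed.

End running_max_theory.

Section picard.
Variables (R : realType) (p mu : R).
Hypotheses (p1 : 1 <= p) (mu0 : 0 < mu).

(** This is the step [theta]; the factor by which distances shrink is [1 - contraction_rate]. *)
Definition contraction_rate : R := (1 + 3 * (mu ^+ 2)^-1)^-1.
Let theta := contraction_rate.

Let theta0 : 0 < theta.
Proof. by rewrite invr_gt0 addr_gt0// mulr_gt0// invr_gt0 exprn_gt0. Qed.

Lemma contraction_rate_le1 : theta <= 1.
Proof.
rewrite invf_le1 ?lerDl ?mulr_ge0 ?invr_ge0 ?exprn_ge0 ?(ltW mu0)//.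
by rewrite addr_gt0// mulr_gt0// invr_gt0 exprn_gt0.
Qed.

(* A regulator of the unreflected path [z] is a fixed point of [picard_map z],
   which contracts the uniform norm whatever the value of [mu]. *)
Definition picard_map (z y : nat -> 'cV[R]_3) (k : nat) : 'cV[R]_3 :=
  \col_h running_max (fun j => y j h 0 - theta * face_fun p mu h (z j + y j)) k.

Lemma picard_mapE z y k h : picard_map z y k h 0 =
  running_max (fun j => y j h 0 - theta * face_fun p mu h (z j + y j)) k.
Proof. by rewrite mxE. Qed.

Lemma picard_map_dist (z y y' : nat -> 'cV[R]_3) k h (D : R) : 0 <= D ->
  (forall j i, (j <= k)%N -> `|y j i 0 - y' j i 0| <= D) ->
  `|picard_map z y k h 0 - picard_map z y' k h 0| <= (1 - theta) * D.
Proof.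
move=> D0 H.
rewrite [X in `|X - _|]picard_mapE [X in `|_ - X|]picard_mapE.
apply: running_max_dist => [|j jk].
  by rewrite mulr_ge0// subr_ge0 contraction_rate_le1.
by apply: (face_fun_contraction p1 mu0) => i; exact: H.
Qed.

Definition picard (z : nat -> 'cV[R]_3) (n : nat) : nat -> 'cV[R]_3 :=
  iter n (picard_map z) (fun=> 0).

(** The deterministic Skorokhod problem contained in (E), freed from [gamma] and [lam]. Flatness of
    the regulator is expressed on intervals rather than through a measure, so that it can be tested
    cell by cell. *)
Definition reflection_pair (psi x : R -> 'cV[R]_3) :=
  [/\ {within `[0, +oo[, continuous psi}, {within `[0, +oo[, continuous x},
      x 0 = psi 0,
      forall h s t, 0 <= s -> s <= t -> x s h 0 - psi s h 0 <= x t h 0 - psi t h 0 &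
      (forall h t, 0 <= t -> 0 <= face_fun p mu h (x t)) /\
      forall h s t, 0 <= s -> s <= t ->
        (forall u, s <= u <= t -> 0 < face_fun p mu h (x u)) ->
        x s h 0 - psi s h 0 = x t h 0 - psi t h 0].

Section grid.
Variables (psi x : R -> 'cV[R]_3) (d w : R) (N : nat).
Hypotheses (px : reflection_pair psi x) (d0 : 0 < d).
Hypothesis osc : forall h j u, (j < N)%N -> j%:R * d <= u <= j.+1%:R * d ->
  `|face_fun p mu h (x (j.+1%:R * d)) - face_fun p mu h (x u)| <= w.
Let z k := psi (k%:R * d).
Let eta k := x (k%:R * d) - z k.

Let grid0 k : 0 <= k%:R * d. Proof. by rewrite mulr_ge0// ltW. Qed.

Let eta_le h j k : (j <= k)%N -> eta j h 0 <= eta k h 0.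
Proof.
move=> jk; rewrite !mxE; case: px => _ _ _ + _; apply; first exact: grid0.
by rewrite ler_pM2r// ler_nat.
Qed.

Let eta00 h : eta 0%N h 0 = 0.
Proof. by rewrite /eta /z mul0r; case: px => _ _ -> _ _; rewrite subrr mxE. Qed.

Let eta_ge0 h k : 0 <= eta k h 0.
Proof. by rewrite -(eta00 h) eta_le. Qed.

(** The sampled regulator is almost a fixed point. It dominates the running maximum because it is
    nondecreasing and [face_fun] is nonnegative. Conversely, on a cell where [face_fun] stays
    positive it does not grow; on any other cell [face_fun] is nonpositive somewhere, hence at most
    [w] at the right end, and the newest candidate of the maximum is within [theta * w]. *)
Lemma picard_map_regulator h k : (k <= N)%N -> 0 <= w ->
  `|picard_map z eta k h 0 - eta k h 0| <= theta * w.
Proof.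
move=> kN w0; rewrite mxE.
have zeta j : z j + eta j = x (j%:R * d) by rewrite addrC subrK.
have rho0 j : 0 <= face_fun p mu h (x (j%:R * d)).
  by case: px => _ _ _ _ [+ _]; apply; exact: grid0.
have tw0 : 0 <= theta * w by rewrite mulr_ge0// ltW.
have ub : running_max (fun j => eta j h 0 - theta * face_fun p mu h (z j + eta j)) k
    <= eta k h 0.
  apply: running_max_le; first exact: eta_ge0.
  move=> j jk; rewrite zeta; apply: le_trans (eta_le h jk).
  by rewrite lerBlDr lerDl mulr_ge0// ltW.
have lb : eta k h 0 <=
    running_max (fun j => eta j h 0 - theta * face_fun p mu h (z j + eta j)) k
    + theta * w.
  elim: k kN {ub} => [_|k IH kN]; first by rewrite eta00 addr_ge0// running_max_ge0.
  have {}IH := IH (ltnW kN).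
  have [H|/existsNP[u /not_implyP[uk /negP]]] :=
    pselect (forall u, k%:R * d <= u <= k.+1%:R * d -> 0 < face_fun p mu h (x u)).
    have -> : eta k.+1 h 0 = eta k h 0.
      rewrite !mxE; case: px => _ _ _ _ [_ /(_ h (k%:R * d) (k.+1%:R * d))] ->//.
      by rewrite ler_pM2r// ler_nat.
    by rewrite (le_trans IH)// lerD2r le_max lexx.
  rewrite -leNgt => rho_le0.
  have rho_w : face_fun p mu h (x (k.+1%:R * d)) <= w.
    have := le_trans (ler_norm _) (osc h kN uk); apply: le_trans.
    by rewrite lerBrDl gerDr.
  apply: (@le_trans _ _ ((eta k.+1 h 0 -
      theta * face_fun p mu h (z k.+1 + eta k.+1)) + theta * w)).
    rewrite zeta -addrA lerDl addrC subr_ge0.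
    by rewrite ler_wpM2l// ltW.
  by rewrite lerD2r; apply: (le_running_max (fun j => eta j h 0 - _)).
rewrite ler_norml; apply/andP; split; first by rewrite lerBrDl lerBlDr.
by rewrite lerBlDr (le_trans ub)// lerDr.
Qed.

(** Each iteration multiplies the error by [1 - theta] and adds the defect [theta * w]; as
    [(1 - theta) * w + theta * w = w], the defects do not accumulate with [n]. *)
Lemma picard_dist n k h (B : R) : (k <= N)%N -> 0 <= w -> 0 <= B ->
  (forall j i, (j <= N)%N -> eta j i 0 <= B) ->
  `|picard z n k h 0 - eta k h 0| <= (1 - theta) ^+ n * B + w.
Proof.
move=> + w0 B0 etaB; have t1 : 0 <= 1 - theta by rewrite subr_ge0 contraction_rate_le1.
elim: n k h => [|n IH] k h kN.
  rewrite /picard /= mxE sub0r normrN ger0_norm ?eta_ge0// expr0 mul1r.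
  by rewrite (le_trans (etaB _ _ kN))// lerDl.
have -> : picard z n.+1 k h 0 - eta k h 0 =
    (picard_map z (picard z n) k h 0 - picard_map z eta k h 0)
    + (picard_map z eta k h 0 - eta k h 0) by rewrite addrA subrK.
apply: le_trans (ler_normD _ _) _.
have -> : (1 - theta) ^+ n.+1 * B + w =
   (1 - theta) * ((1 - theta) ^+ n * B + w) + theta * w.
  by rewrite exprS mulrDr mulrA -addrA -mulrDl subrK mul1r.
apply: lerD; last exact: picard_map_regulator.
apply: picard_map_dist => [|j i jk].
  by rewrite addr_ge0// mulr_ge0// exprn_ge0.
by apply: IH; exact: leq_trans kN.
Qed.

End grid.
End picard.

Lemma near_expr_lt (R : realType) (q e : R) : 0 <= q < 1 -> 0 < e ->
  \forall m \near \oo, q ^+ m < e.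
Proof.
move=> /andP[q0 q1] e0; have h : `|q| < 1 by rewrite ger0_norm.
have /cvgrPdist_lt/(_ _ e0) := cvg_expr h; apply: filterS => m.
by rewrite sub0r normrN ger0_norm// exprn_ge0.
Qed.

Section picard_path.
Variables (R : realType) (p mu : R).
Hypotheses (p1 : 1 <= p) (mu0 : 0 < mu).

(** The same [m] is the exponent of the mesh and the number of iterations, so that one limit takes
    care of both. *)
Definition picard_path (psi : R -> 'cV[R]_3) (m : nat) (t : R) : 'cV[R]_3 :=
  let z k := psi (k%:R * 2^-1 ^+ m) in
  let k := Num.truncn (t * 2 ^+ m) in
  z k + picard p mu z m k.

Lemma dyadic_approx (m : nat) (t : R) : 0 <= t ->
  (Num.truncn (t * 2 ^+ m))%:R * 2^-1 ^+ m <= t <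
  (Num.truncn (t * 2 ^+ m)).+1%:R * 2^-1 ^+ m.
Proof.
move=> t0; have p0 : 0 < 2 ^+ m :> R by rewrite exprn_gt0.
rewrite exprVn ler_pdivrMr// ltr_pdivlMr//.
by apply: truncn_itv; rewrite mulr_ge0// ltW.
Qed.

Lemma picard_path_cvg psi x t h : reflection_pair p mu psi x -> 0 <= t ->
  picard_path psi m t h 0 @[m --> \oo] --> x t h 0.
Proof.
move=> px t0; have [_ cx x0 inc [rho0 _]] := px.
pose eta s i := x s i 0 - psi s i 0.
pose C : R := 1 + 6 * (mu ^+ 2)^-1.
have C0 : 0 < C by rewrite addr_gt0// mulr_gt0// invr_gt0 exprn_gt0.
pose B := \sum_i eta t i.
have eta0 i s : 0 <= s -> 0 <= eta s i.
  by move=> s0; rewrite -(_ : eta 0 i = 0) ?inc// /eta x0 subrr.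
have etaB s i : 0 <= s <= t -> eta s i <= B.
  move=> /andP[s0 st]; rewrite /B (bigD1 i)//= (le_trans (inc _ _ _ s0 st))// lerDl.
  by rewrite sumr_ge0// => j _; exact: eta0.
have B0 : 0 <= B by rewrite sumr_ge0// => j _; exact: eta0.
apply/cvgrPdist_le => e e0.
(* Half of [e] is for the geometric term. The rest is shared by the oscillation of [x] between [t]
   and its grid point, at most [e'], and that of the face functions on a cell, at most [C * e']. *)
pose e' := e / 2 / (1 + C).
have e'0 : 0 < e' by rewrite !divr_gt0// addr_gt0.
have eE : e = e / 2 + (e' + C * e').
  rewrite -[X in X + C * _]mul1r -mulrDl [_ * e']mulrC divfK ?gt_eqF ?(addr_gt0 ltr01 C0)//.
  exact: splitr.
have [d d0 dP] := unif_continuous_itv 0 t (continuous_max0 cx) e'0.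
have /andP[th0 th1] : 0 <= 1 - contraction_rate mu < 1.
  rewrite subr_ge0 contraction_rate_le1//= gtrBl invr_gt0 addr_gt0// mulr_gt0//.
  by rewrite invr_gt0 exprn_gt0.
have near_d : \forall m \near \oo, (2^-1 : R) ^+ m < d.
  by apply: near_expr_lt d0; rewrite invr_ge0 ler0n invf_lt1 ?ltr1n// ltr0n.
have near_B : \forall m \near \oo, (1 - contraction_rate mu) ^+ m * B <= e / 2.
  have e2 : 0 < e / 2 / (1 + B) by rewrite !divr_gt0// ltr_wpDr.
  have th01 : 0 <= 1 - contraction_rate mu < 1 by rewrite th0.
  apply: filterS (near_expr_lt th01 e2) => m.
  rewrite ltr_pdivlMr ?ltr_wpDr// => /ltW.
  by apply: le_trans; rewrite ler_wpM2l ?exprn_ge0// lerDr.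
near=> m.
pose k := Num.truncn (t * 2 ^+ m); pose q : R := 2^-1 ^+ m.
have q0 : 0 < q by rewrite exprn_gt0.
have qd : q < d by rewrite /q; near: m.
have /andP[kt tk] := dyadic_approx m t0; rewrite -/k -/q in kt tk.
have s0 j : 0 <= j%:R * q by rewrite mulr_ge0// ltW.
have st j : (j <= k)%N -> j%:R * q <= t.
  by move=> jk; rewrite (le_trans _ kt)// ler_pM2r// ler_nat.
have osc i j u : (j < k)%N -> j%:R * q <= u <= j.+1%:R * q ->
    `|face_fun p mu i (x (j.+1%:R * q)) - face_fun p mu i (x u)| <= C * e'.
  move=> jk /andP[ju uj]; have u0 : 0 <= u by rewrite (le_trans _ ju).
  apply: le_trans (face_fun_lipschitz p1 mu0 _ _ _) _.
  rewrite ler_wpM2l ?(ltW C0)//.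
  have := dP (j.+1%:R * q) u; rewrite s0 st//= !max_r// => /(_ isT) H; apply/ltW/H.
  rewrite ger0_norm ?subr_ge0// (le_lt_trans _ qd)// lerBlDr.
  by rewrite -natr1 mulrDl mul1r addrC lerD2l.
have := picard_dist p1 mu0 px q0 osc m h (leqnn k) (mulr_ge0 (ltW C0) (ltW e'0)) B0.
have etaB' j i : (j <= k)%N -> (x (j%:R * q) - psi (j%:R * q)) i 0 <= B.
  by move=> jk; rewrite !mxE etaB// s0 st.
move=> /(_ etaB') => D1.
have D2 : `|x t h 0 - x (k%:R * q) h 0| <= e'.
  have := dP t (k%:R * q); rewrite t0 lexx !max_r// => /(_ isT) H.
  have := coord_le_norm (x t - x (k%:R * q)) h; rewrite !mxE => /le_trans; apply.
  apply/ltW/H; rewrite ger0_norm ?subr_ge0// (lt_trans _ qd)// ltrBlDr.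
  by rewrite -{1}(mul1r q) -mulrDl addrC natr1.
have -> : x t h 0 - picard_path psi m t h 0 = (x t h 0 - x (k%:R * q) h 0)
   - (picard p mu (fun k => psi (k%:R * q)) m k h 0
       - (x (k%:R * q) - psi (k%:R * q)) h 0).
  by rewrite /picard_path -/k -/q !mxE; ring.
apply: le_trans (ler_normB _ _) _; apply: (le_trans (lerD D2 D1)).
have D3 : (1 - contraction_rate mu) ^+ m * B <= e / 2 by near: m.
by rewrite eE addrCA lerD2r.
Unshelve. all: by end_near. Qed.

End picard_path.

(** * From equation (E) to the deterministic reflection problem *)

Lemma filter_ae_stieltjes (R : realType) (lam : cumulative R R) :
  Filter (almost_everywhere (lebesgue_stieltjes_measure lam)).
Proof. exact: ae_filter_ringOfSetsType. Qed.

Section stieltjes_regulator.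
Variables (R : realType) (lam : cumulative R R) (g : R -> R).
Local Notation L := (lebesgue_stieltjes_measure lam).
Hypothesis mg : measurable_fun (`[0, +oo[ : set R) g.
Hypothesis g01 : {ae L, forall u, 0 <= u -> 0 <= g u <= 1}.

(** The bounds on [g] hold only almost everywhere, whereas integration of nonnegative functions
    wants them everywhere; truncation leaves the integrals unchanged. *)
Let clamp u := Num.max 0 (Num.min 1 (g u)).

Let itv0 t : `[0, t]%classic `<=` (`[0, +oo[%classic : set R).
Proof. by move=> u; rewrite /= !in_itv/= andbT => /andP[]. Qed.

Let mclamp : measurable_fun (`[0, +oo[ : set R) clamp.
Proof. by apply: measurable_maxr => //; apply: measurable_minr. Qed.

Let clamp_ge0 u : 0 <= clamp u. Proof. by rewrite le_max lexx. Qed.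

Let Rintegral_clamp t :
  (\int[L]_(s in `[0, t]) g s)%R = fine (\int[L]_(s in `[0, t]) (clamp s)%:E).
Proof.
congr fine; apply: ae_eq_integral => //.
- by apply/measurable_EFinP; exact: measurable_funS mg.
- by apply/measurable_EFinP; exact: measurable_funS mclamp.
- have F := filter_ae_stieltjes lam; apply: (filterS _ g01) => u H /=.
  rewrite in_itv/= => /andP[u0 _].
  have /andP[gu0 gu1] := H u0.
  by rewrite /clamp (min_idPr gu1) (max_idPr gu0).
Qed.

Lemma lebesgue_stieltjes_itvcc_lty (t : R) : (L (`[0%R, t]%classic : set R) < +oo)%E.
Proof.
have [t0|t0] := ltP t 0; first by rewrite set_itv_ge ?measure0// bnd_simp -ltNge.
(* A Stieltjes measure is computed on left-open intervals; any left end below 0 would do. *)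
have E : L (`](-1)%R, t]%classic : set R) = (lam t - lam (-1))%:E.
  rewrite /lebesgue_stieltjes_measure /measure_extension measurable_mu_extE/=.
    by rewrite wlength_itv_bnd// (le_trans _ t0)// lerN10.
  exact: is_ocitv.
apply: (@le_lt_trans _ _ (L (`](-1)%R, t]%classic : set R))); last by rewrite E ltry.
apply: le_measure; rewrite ?inE//.
move=> u; rewrite /= !in_itv/= => /andP[u0 ->]; rewrite andbT.
by rewrite (lt_le_trans _ u0)// ltrN10.
Qed.

Let integral_clamp_fin t : (\int[L]_(s in `[0%R, t]) (clamp s)%:E)%E \is a fin_num.
Proof.
have i0 : (0 <= \int[L]_(s in `[0%R, t]) (clamp s)%:E)%E.
  by apply: integral_ge0 => u _; rewrite lee_fin.
rewrite ge0_fin_numE//; apply: (le_lt_trans _ (lebesgue_stieltjes_itvcc_lty t)).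
rewrite -[leRHS]mul1e -integral_cst//; apply: ge0_le_integral => //.
- by move=> u _; rewrite lee_fin.
- by apply/measurable_EFinP; exact: measurable_funS mclamp.
- by move=> u _; rewrite lee_fin ge_max ler01 ge_min lexx.
Qed.

Lemma le_Rintegral_itv s t : s <= t ->
  (\int[L]_(u in `[0%R, s]) g u <= \int[L]_(u in `[0%R, t]) g u)%R.
Proof.
move=> st; rewrite !Rintegral_clamp fine_le//; apply: ge0_subset_integral => //.
- by apply/measurable_EFinP; exact: measurable_funS mclamp.
- by move=> u _; rewrite lee_fin.
- by move=> u; rewrite /= !in_itv/= => /andP[->/= us]; rewrite (le_trans us).
Qed.

Lemma eq_Rintegral_itv s t : 0 <= s -> s <= t ->
  {ae L, forall u, s <= u <= t -> g u = 0} ->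
  (\int[L]_(u in `[0%R, s]) g u = \int[L]_(u in `[0%R, t]) g u)%R.
Proof.
move=> s0 st g0; rewrite !Rintegral_clamp; congr fine.
have -> : `[0, t]%classic = `[0, s]%classic `|` `]s, t]%classic :> set R.
  apply/seteqP; split=> u /=; rewrite !in_itv/=.
    by move=> /andP[-> ->]; rewrite andbT; case: leP; [left|right].
  by case=> /andP[? ?]; apply/andP; split=> //; lra.
have st0 : `[0, s]%classic `|` `]s, t]%classic `<=` (`[0, +oo[%classic : set R).
  by move=> u; rewrite /= !in_itv/= andbT; case=> /andP[]//; lra.
have mU : measurable (`[0, s]%classic `|` `]s, t]%classic : set R) by exact: measurableU.
rewrite ge0_integral_setU//; last 3 first.
- by apply/measurable_EFinP; exact: measurable_funS mclamp.
- by move=> u _; rewrite lee_fin.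
- apply/disj_setPS => u /=; rewrite !in_itv/= => -[/andP[_ us] /andP[su _]].
  by move: us; rewrite leNgt su.
rewrite [X in (_ = _ + X)%E](_ : _ = 0%E) ?adde0//.
rewrite -(integral0 L `]s, t]%classic); apply: ae_eq_integral => //.
- apply/measurable_EFinP; apply: measurable_funS mclamp => //.
  by apply: subset_trans st0; exact: subsetUr.
- have F := filter_ae_stieltjes lam; apply: (filterS _ g0) => u H /=.
  rewrite in_itv/= => /andP[su ut].
  by rewrite /clamp H ?(ltW su)// minC minEle ler01 maxxx.
Qed.

End stieltjes_regulator.

Lemma cvg_cV (R : realType) (T : Type) (F : set_system T) (f : T -> 'cV[R]_3)
    (l : 'cV[R]_3) : Filter F ->
  (forall i, (fun t => f t i 0) @ F --> l i 0) -> f @ F --> l.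
Proof.
move=> FF H A [P lP PA]; rewrite /= /nbhs/=.
have : \forall t \near F, forall i, P i 0 (f t i 0).
  by apply: filter_forall => i; exact: (H i _ (lP i 0)).
by apply: filterS => t Pt; apply: PA => i j; rewrite ord1.
Qed.

Lemma continuous_within_driver (R : realType) (x0 b : 'cV[R]_3) (M : 'M[R]_3)
    (W : R -> 'cV[R]_3) : {within `[0, +oo[, continuous W} ->
  {within `[0, +oo[, continuous (fun t => x0 + t *: b + M *m W t)}.
Proof.
move=> /subspace_continuousP cW; apply/subspace_continuousP => t t0.
apply: cvg_cV => i.
have -> : (fun t => (x0 + t *: b + M *m W t) i 0) =
    (fun t => x0 i 0 + t * b i 0 + \sum_j M i j * W t j 0).
  by apply/funext => s; rewrite !mxE.
rewrite [X in _ --> X](_ : _ = x0 i 0 + t * b i 0 + \sum_j M i j * W t j 0); last first.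
  by rewrite !mxE.
have cid : (fun s : R => s) @ within `[0, +oo[ (nbhs t) --> t by exact: cvg_within.
apply: cvgD; first by apply: cvgD; [exact: cvg_cst|exact: cvgMr_tmp].
apply: cvg_big => [|j _]; first exact: add_continuous.
apply: cvgMl_tmp.
exact: (cvg_comp _ _ (cW t t0) (@coord_continuous R 3 1 j 0 (W t))).
Qed.

Section equation_reflection.
Variables (R : realType) (p mu : R).
Hypotheses (p1 : 1 <= p) (mu0 : 0 < mu).

Lemma coord_le_enorm (x : 'cV[R]_3) i : `|x i 0| <= enorm x.
Proof.
rewrite -sqrtr_sqr /enorm ler_wsqrtr// (bigD1 i)//= lerDl.
by rewrite sumr_ge0// => j _; exact: sqr_ge0.
Qed.

Lemma refl_cone_coord_ge0 x g h : refl_cone p mu x g -> 0 <= g h 0.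
Proof.
rewrite /refl_cone /=; case: ifP => _; first exact.
move=> [u [u0 ->]]; rewrite summxE sumr_ge0// => j _.
by rewrite !mxE mulr_ge0.
Qed.

(** Where [face_fun h] is positive the point is off the closure of the face [h], so the generator
    [h] is absent from the sum. At the apex, where the cone of directions is the whole orthant, the
    hypothesis fails because [face_fun] vanishes. *)
Lemma refl_cone_coord_eq0 x g h :
  refl_cone p mu x g -> 0 < face_fun p mu h x -> g h 0 = 0.
Proof.
rewrite /refl_cone /=; case: ifP => [/eqP->|_]; first by rewrite face_fun0 ?ltxx.
move=> [u [u0 ->]] rho; rewrite summxE big1// => j.
rewrite inE => /(closure_face_face_fun p1 mu0) jx.
rewrite !mxE; case: eqP => [hj|_]; last by rewrite mulr0.
by rewrite hj jx ltxx in rho.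
Qed.

(** The regulator is the integral of [gamma] against [lam]. The cone of directions makes its
    coordinates nonnegative and the unit norm bounds them by 1; [W 0 = 0] makes the regulator start
    at 0. *)
Lemma equation_E_reflection_pair b x W gamma lam :
  equation_E p mu b x W gamma lam -> W 0 = 0 ->
  {within `[0, +oo[, continuous x} -> {within `[0, +oo[, continuous W} ->
  measurable_fun (`[0, +oo[ : set R) (gamma : R -> borel3 R) ->
  reflection_pair p mu (fun t => x 0 + t *: b + dispersion mu *m W t) x.
Proof.
move=> [eqx xcl _ gae] W0 cx cW mgamma.
have mg h := (measurable_fun_borel3P (`[0, +oo[ : set R) gamma).1 mgamma h.
have g01 h : {ae lebesgue_stieltjes_measure lam, forall u, 0 <= u ->
    0 <= gamma u h 0 <= 1}.
  have F := filter_ae_stieltjes lam; apply: (filterS _ gae) => u H u0; have [cg ng] := H u0.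
  rewrite (refl_cone_coord_ge0 h cg)/= -ng.
  by rewrite (le_trans (ler_norm _))// coord_le_enorm.
have eta h t : 0 <= t ->
    x t h 0 - (x 0 + t *: b + dispersion mu *m W t) h 0 =
    (\int[lebesgue_stieltjes_measure lam]_(s in `[0%R, t]) gamma s h 0)%R.
  by move=> t0; rewrite eqx// mxE addrAC subrr add0r mxE.
split=> //.
- exact: continuous_within_driver.
- by rewrite W0 mulmx0 scale0r !addr0.
- move=> h s t s0 st; rewrite !eta// ?(le_trans s0)//.
  exact: le_Rintegral_itv.
- split=> [h t t0|h s t s0 st rho]; first exact/(closure_cone_face_fun p1 mu0)/xcl.
  rewrite !eta// ?(le_trans s0)//; apply: eq_Rintegral_itv => //.
  have F := filter_ae_stieltjes lam; apply: (filterS _ gae) => u H sut.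
  have u0 : 0 <= u by case/andP: sut => + _; exact: le_trans.
  by have [cg _] := H u0; apply: refl_cone_coord_eq0 cg _; exact: rho.
Qed.

End equation_reflection.

(** * Law of the driving path on cylinder sets *)

Definition cylinder_generators (R : realType) (I : set R) :
    set (set (R -> 'cV[R]_3)) :=
  \bigcup_(t in I) preimage_set_system setT
    (fun f : R -> 'cV[R]_3 => f t : borel3 R) measurable.

Notation cylinderType I := (g_sigma_algebraType (cylinder_generators I)).

Section cylinders.
Variable R : realType.
Implicit Types (I J : set R) (A : set (R -> 'cV[R]_3)).

Lemma measurable_eval I t : I t ->
  measurable_fun setT ((fun f => f t) : cylinderType I -> borel3 R).
Proof. by move=> It _ B mB; apply: sub_sigma_algebra; exists t => //; exists B. Qed.

Lemma measurable_eval_coord I t i : I t ->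
  measurable_fun setT ((fun f => f t i 0) : cylinderType I -> R).
Proof.
move=> It; have := measurable_eval It.
by move=> /(measurable_fun_borel3P setT (fun f : cylinderType I => f t)).
Qed.

(** The sigma-algebra [S] is an arbitrary one rather than that of a measurable type, so that the
    lemma also serves for [filtration]. *)
Lemma preimage_cylinder (U : Type) (S : set (set U)) (z : U -> R -> 'cV[R]_3) I :
  sigma_algebra setT S ->
  (forall t (B : set (borel3 R)), I t -> measurable B -> S [set u | B (z u t)]) ->
  forall A, <<s cylinder_generators I >> A -> S (z @^-1` A).
Proof.
move=> [S0 SC SU] H; apply: smallest_sub => [|A [t It [B mB <-]]].
  split; first by rewrite /= preimage_set0.
  - by move=> A SA /=; rewrite setTD preimage_setC -setTD; exact: SC.
  - by move=> F SF /=; rewrite preimage_bigcup; exact: SU.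
by rewrite setTI; exact: H.
Qed.

Lemma measurable_cylinder_map d (U : measurableType d) (z : U -> R -> 'cV[R]_3) I :
  (forall t, I t -> measurable_fun setT ((fun u => z u t) : U -> borel3 R)) ->
  measurable_fun setT (z : U -> cylinderType I).
Proof.
move=> mz _ A mA; rewrite setTI.
apply: (preimage_cylinder (sigma_algebra_measurable U) _ mA) => t B It mB.
by rewrite -[X in measurable X]setTI; exact: mz.
Qed.

Lemma cylinder_generatorsS I J : I `<=` J ->
  cylinder_generators I `<=` cylinder_generators J.
Proof. by move=> IJ A [t /IJ Jt]; exists t. Qed.

End cylinders.

Section same_law.
Variables (R : realType) (d d' : measure_display).
Variables (T : measurableType d) (T' : measurableType d').
Variables (P : probability T R) (P' : probability T' R).

Definition same_law (U : Type) (z : T -> U) (z' : T' -> U) : set (set U) :=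
  [set A | [/\ measurable (z @^-1` A), measurable (z' @^-1` A) &
               P (z @^-1` A) = P' (z' @^-1` A)]].

(** Dynkin's pi-lambda theorem; keeping measurability inside [same_law] makes that class stable
    under complements and disjoint unions. *)
Lemma same_law_sigma (U : pointedType) (z : T -> U) (z' : T' -> U)
    (G : set (set U)) : setI_closed G -> G `<=` same_law z z' ->
  <<s G >> `<=` same_law z z'.
Proof.
move=> GI GP; apply: (@dynkin_induction _ (g_sigma_algebraType G) G) => //.
- by split; rewrite preimage_setT// !probability_setT.
- move=> S _ [mS mS' PS]; split; rewrite preimage_setC; [exact: measurableC|
    exact: measurableC|].
  by rewrite !probability_setC// PS.
- move=> F _ tF HF.
  have mz n : measurable (z @^-1` F n) by case: (HF n).
  have mz' n : measurable (z' @^-1` F n) by case: (HF n).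
  split; rewrite !preimage_bigcup; [exact: bigcupT_measurable|
    exact: bigcupT_measurable|].
  rewrite !measure_bigcup//.
  + by apply: eq_eseriesr => n _; case: (HF n).
  + apply/trivIsetP => i j _ _ ij; rewrite -preimage_setI.
    by move/trivIsetP : tF => ->//; rewrite preimage_set0.
  + apply/trivIsetP => i j _ _ ij; rewrite -preimage_setI.
    by move/trivIsetP : tF => ->//; rewrite preimage_set0.
Qed.

End same_law.

Definition increment_set (R : realType) (s t : R) (B : 'I_3 -> set R) :
    set (R -> 'cV[R]_3) :=
  [set f : R -> 'cV[R]_3 | forall i, B i ((f t - f s) i 0)].

(** The past is that of [z] alone and includes [z] at time 0. Together with the initial distribution
    this property determines the law of [z]; it is all that is kept of [W] and of the filtration of
    a solution. *)
Definition gaussian_driver (R : realType) d (T : measurableType d)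
    (P : probability T R) (z : T -> R -> 'cV[R]_3) :=
  (forall t, 0 <= t -> rv3 (fun w => z w t)) /\
  forall s t A (B : 'I_3 -> set R), 0 <= s -> s < t ->
    <<s cylinder_generators `[0, s] >> A -> (forall i, measurable (B i)) ->
    P (z @^-1` A `&` z @^-1` increment_set s t B) =
    (P (z @^-1` A) *
     \big[*%E/1%E]_(i < 3) normal_prob 0 (Num.sqrt (t - s)) (B i))%E.

Definition grid (R : realType) (m n : nat) : set R :=
  [set k%:R * 2^-1 ^+ m | k in [set k : nat | (k <= n)%N]].

Arguments grid : clear implicits.

Section driver_law.
Variables (R : realType) (d d' : measure_display).
Variables (T : measurableType d) (T' : measurableType d').
Variables (P : probability T R) (P' : probability T' R).
Variables (z : T -> R -> 'cV[R]_3) (z' : T' -> R -> 'cV[R]_3).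
Hypotheses (Dz : gaussian_driver P z) (Dz' : gaussian_driver P' z').
Hypothesis init : forall B : set (borel3 R), measurable B ->
  P [set w | B (z w 0)] = P' [set w | B (z' w 0)].

Lemma grid_ge0 m n : grid R m n `<=` [set t | 0 <= t].
Proof. by move=> _ [k _ <-] /=; rewrite mulr_ge0// exprn_ge0// invr_ge0. Qed.

Lemma grid_itv m n : grid R m n `<=` `[0, n%:R * 2^-1 ^+ m]%classic.
Proof.
move=> t gt; rewrite /= in_itv/= (grid_ge0 gt)/=.
by case: gt => k kn <-; rewrite ler_wpM2r ?ler_nat// exprn_ge0// invr_ge0.
Qed.

Lemma grid_refine m m' n n' : (m <= m')%N -> (n * 2 ^ (m' - m) <= n')%N ->
  grid R m n `<=` grid R m' n'.
Proof.
move=> mm' nn' _ [k kn <-]; exists (k * 2 ^ (m' - m))%N.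
  by rewrite /= (leq_trans _ nn')// leq_mul2r kn orbT.
rewrite natrM natrX -{2}(subnK mm') exprD -mulrA; congr (_ * _).
by rewrite mulrA -exprMn divff// expr1n mul1r.
Qed.

Let law := same_law P P' z z'.

Lemma gaussian_driver_grid m n :
  <<s cylinder_generators (grid R m n) >> `<=` law.
Proof.
have mz A I : (forall t, I t -> 0 <= t) -> <<s cylinder_generators I >> A ->
    measurable (z @^-1` A).
  move=> I0 mA; rewrite -[X in measurable X]setTI.
  by apply: (measurable_cylinder_map (I := I)) => // t It; apply: Dz.1; exact: I0.
have mz' A I : (forall t, I t -> 0 <= t) -> <<s cylinder_generators I >> A ->
    measurable (z' @^-1` A).
  move=> I0 mA; rewrite -[X in measurable X]setTI.
  by apply: (measurable_cylinder_map (I := I)) => // t It; apply: Dz'.1; exact: I0.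
elim: n => [|n IH].
  apply: same_law_sigma.
    move=> _ _ [t It [A mA <-]] [_ [k k0 <-] [B mB <-]].
    case: It => j; rewrite /= leqn0 => /eqP-> <-.
    move: k0; rewrite /= leqn0 => /eqP->.
    exists (0%:R * 2^-1 ^+ m); first by exists 0%N.
    by exists (A `&` B); [exact: measurableI|rewrite !setTI preimage_setI].
  move=> A GA; have sA : <<s cylinder_generators (grid R m 0) >> A by exact: sub_sigma_algebra.
  split; [exact: mz _ _ (@grid_ge0 m 0) sA|exact: mz' _ _ (@grid_ge0 m 0) sA|].
  case: GA => _ [k + <-] [B mB <-]; rewrite /= leqn0 => /eqP->.
  by rewrite setTI mul0r; exact: init.
pose s : R := n%:R * 2^-1 ^+ m; pose t : R := n.+1%:R * 2^-1 ^+ m.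
have q0 : 0 < 2^-1 ^+ m :> R by rewrite exprn_gt0.
have s0 : 0 <= s by rewrite mulr_ge0// ltW.
have st : s < t by rewrite ltr_pM2r// ltr_nat.
(* An event of the past intersected with a box for the next increment. These sets are stable under
   intersection, and the two laws agree on them by the factorization in [gaussian_driver] and the
   induction hypothesis. *)
pose G := [set A `&` increment_set s t B | A in <<s cylinder_generators (grid R m n) >>
  & B in [set B : 'I_3 -> set R | forall i, measurable (B i)]].
have GI : setI_closed G.
  move=> _ _ [A mA [B mB <-]] [A' mA' [B' mB' <-]].
  exists (A `&` A'); first exact: (@measurableI _ (cylinderType (grid R m n))).
  exists (fun i => B i `&` B' i); first by move=> i; exact: measurableI.
  apply/seteqP; split=> f /=.
    by move=> [[Af A'f] BB']; split; split=> // i; case: (BB' i).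
  by move=> [[Af Bf] [A'f B'f]]; split=> // i; split.
(* The value at [t] is recovered as the value at [s] plus the increment, so [G] also generates the
   evaluation at the new grid point. *)
have sub : <<s cylinder_generators (grid R m n.+1) >> `<=` <<s G >>.
  have mG u : grid R m n u -> measurable_fun setT
      ((fun f => f u) : g_sigma_algebraType G -> borel3 R).
    move=> gu _ B mB; apply: sub_sigma_algebra.
    exists ((fun f => f u) @^-1` B); first by apply: sub_sigma_algebra; exists u => //;
      exists B => //; rewrite setTI.
    exists (fun=> setT); first by [].
    by rewrite setTI; apply/seteqP; split=> f; [case|split].
  have minc i : measurable_fun setT
      ((fun f => f t i 0 - f s i 0) : g_sigma_algebraType G -> R).
    move=> _ B mB; apply: sub_sigma_algebra.
    exists setT; first exact: (@measurableT _ (cylinderType (grid R m n))).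
    exists (fun j => if j == i then B else setT); first by move=> j; case: ifP.
    rewrite !setTI; apply/seteqP; split=> f; rewrite /increment_set /=.
      by move=> /(_ i); rewrite eqxx !mxE.
    by move=> Bf j; case: eqP => // ->; rewrite !mxE.
  have gs : grid R m n s by exists n => /=.
  have mt : measurable_fun setT ((fun f => f t) : g_sigma_algebraType G -> borel3 R).
    apply/(measurable_fun_borel3P setT (fun f : g_sigma_algebraType G => f t)) => i.
    rewrite (_ : (fun _ => _) = (fun f : g_sigma_algebraType G =>
        f t i 0 - f s i 0 + f s i 0)); last by apply/funext => f; rewrite subrK.
    apply: measurable_funD => //.
    exact: (measurable_fun_borel3P setT (fun f : g_sigma_algebraType G => f s)).1 (mG _ gs) i.
  move=> A mA; rewrite (_ : A = id @^-1` A)//.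
  apply: (preimage_cylinder (sigma_algebra_measurable (g_sigma_algebraType G))) mA.
  move=> u B [k]; rewrite /= leq_eqVlt ltnS => /orP[/eqP->|kn] <- mB.
    by rewrite -[X in measurable X]setTI; exact: mt.
  by rewrite -[X in measurable X]setTI; apply: mG => //; exists k.
apply: (subset_trans sub); apply: same_law_sigma GI _.
move=> _ [A mA [B mB <-]].
have mAB : <<s cylinder_generators [set u : R | 0 <= u] >> (A `&` increment_set s t B).
  apply: (@measurableI _ (cylinderType [set u : R | 0 <= u])).
    by apply: sub_sigma_algebra2 mA; apply: cylinder_generatorsS; exact: grid_ge0.
  rewrite (_ : increment_set _ _ _ = \bigcap_(i : 'I_3)
      ((fun f : cylinderType [set u : R | 0 <= u] => f t i 0 - f s i 0) @^-1` B i)).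
    apply: fin_bigcap_measurable => // i _; rewrite -[X in measurable X]setTI.
    by apply: measurable_funB => //; apply: measurable_eval_coord => //=; apply: ltW;
      exact: le_lt_trans st.
  apply/seteqP; split=> f Hf i; first by move=> _; have := Hf i; rewrite !mxE.
  by rewrite !mxE; exact: Hf.
split; [exact: mz _ _ (fun _ => id) mAB|exact: mz' _ _ (fun _ => id) mAB|].
have As : <<s cylinder_generators `[0, s] >> A.
  by apply: sub_sigma_algebra2 mA; apply: cylinder_generatorsS; exact: grid_itv.
rewrite !preimage_setI Dz.2// Dz'.2//; congr (_ * _)%E.
by case: (IH _ mA).
Qed.

Definition dyadics : set R := [set t | exists m k, t = k%:R * 2^-1 ^+ m].

Lemma gaussian_driver_law : <<s cylinder_generators dyadics >> `<=` law.
Proof.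
pose G := \bigcup_(mn : nat * nat) <<s cylinder_generators (grid R mn.1 mn.2) >>.
have sub : cylinder_generators dyadics `<=` G.
  move=> A [_ [m [k ->]] H]; exists (m, k) => //=.
  by apply: sub_sigma_algebra; exists (k%:R * 2^-1 ^+ m) => //; exists k => /=.
apply: (@subset_trans _ <<s G >>); first exact: sub_sigma_algebra2.
apply: same_law_sigma => [A A' [[m n] _ mA] [[m' n'] _ mA']|A [[m n] _]]; last first.
  exact: gaussian_driver_grid.
(* Two grids lie in a common one: the finer of the two meshes, and a number of cells that covers
   both ranges. *)
exists (maxn m m', n * 2 ^ (maxn m m' - m) + n' * 2 ^ (maxn m m' - m'))%N => //=.
apply: (@measurableI _ (cylinderType (grid R _ _))).
- apply: sub_sigma_algebra2 mA; apply: cylinder_generatorsS.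
  by apply: grid_refine; [exact: leq_maxl|exact: leq_addr].
- apply: sub_sigma_algebra2 mA'; apply: cylinder_generatorsS.
  by apply: grid_refine; [exact: leq_maxr|exact: leq_addl].
Qed.

End driver_law.

(** Initial point and noise are carried by a single path. [W 0] is subtracted because it vanishes
    only almost surely, while the driver has to start at [X 0] for every outcome. *)
Definition driver (R : realType) (T : Type) (X W : R -> T -> 'cV[R]_3) (w : T)
    (t : R) : 'cV[R]_3 :=
  X 0 w + (W t w - W 0 w).

Lemma sigma3_box (R : realType) d (T : measurableType d) (Y : T -> 'cV[R]_3)
    (B : 'I_3 -> set R) : (forall i, measurable (B i)) ->
  sigma3 Y [set w | forall i, B i (Y w i 0)].
Proof.
move=> mB; exists (\bigcap_(i : 'I_3) ((fun x : borel3 R => x i 0) @^-1` B i)).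
  apply: fin_bigcap_measurable => // i _; rewrite -[X in measurable X]setTI.
  exact: measurable_coord.
by rewrite setTI; apply/seteqP; split=> w /= H i; [exact: H|move=> _; exact: H].
Qed.

Lemma increment_set_driver (R : realType) (T : Type) (X W : R -> T -> 'cV[R]_3)
    s t (B : 'I_3 -> set R) :
  driver X W @^-1` increment_set s t B =
  [set w | forall i, B i ((W t w - W s w) i 0)].
Proof.
have E w i : (driver X W w t - driver X W w s) i 0 = (W t w - W s w) i 0.
  by rewrite /driver !mxE; ring.
by apply/seteqP; split=> w /= H i; [rewrite -E|rewrite E].
Qed.

Section solution_driver.
Variables (R : realType) (d : measure_display) (T : measurableType d).
Variables (P : probability T R) (X W gamma : R -> T -> 'cV[R]_3).
Variable lam : T -> cumulative R R.
Hypotheses (cX : continuous_process X) (BW : brownian_motion P W).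
Hypothesis indep : forall t, 0 <= t ->
  independent_systems P (future_increments W t) (filtration X W gamma lam t).

Lemma sigma_algebra_filtration t : sigma_algebra setT (filtration X W gamma lam t).
Proof. exact: smallest_sigma_algebra. Qed.

Lemma filtration_X s t (B : set (borel3 R)) : 0 <= s <= t -> measurable B ->
  filtration X W gamma lam t [set w | B (X s w)].
Proof.
move=> st mB; apply: sub_sigma_algebra; exists s; first by rewrite /= in_itv.
by do 3 left; exists B => //; rewrite setTI.
Qed.

Lemma filtration_W s t (B : set (borel3 R)) : 0 <= s <= t -> measurable B ->
  filtration X W gamma lam t [set w | B (W s w)].
Proof.
move=> st mB; apply: sub_sigma_algebra; exists s; first by rewrite /= in_itv.
by left; left; right; exists B => //; rewrite setTI.
Qed.

Lemma filtration_driver s (A : set (R -> 'cV[R]_3)) : 0 <= s ->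
  <<s cylinder_generators `[0, s] >> A ->
  filtration X W gamma lam s (driver X W @^-1` A).
Proof.
move=> s0; apply: preimage_cylinder; first exact: sigma_algebra_filtration.
move=> t B; rewrite /= in_itv/= => /andP[t0 ts] mB.
(* Coding [X 0], [W t] and [W 0] as one path reduces the measurability of the
   sum to that of a function on the cylinder algebra. *)
pose v w (r : R) := if r == 0 then X 0 w else if r == 1 then W t w else W 0 w.
pose I : set R := [set 0; 1; 2].
have I0 : I 0 by left; left.
have I1 : I 1 by left; right.
have I2 : I 2 by right.
have nz2 : (2 == 0 :> R) = false by rewrite pnatr_eq0.
have n12 : (2 == 1 :> R) = false by rewrite (eqr_nat _ 2 1).
have mA : <<s cylinder_generators I >> [set f : R -> 'cV[R]_3 | B (f 0 + (f 1 - f 2))].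
  have m : measurable_fun setT
      ((fun f => f 0 + (f 1 - f 2)) : cylinderType I -> borel3 R).
    apply/measurable_fun_borel3P => i.
    rewrite (_ : (fun _ => _) = (fun f : cylinderType I =>
      f 0 i 0 + (f 1 i 0 - f 2 i 0))); last by apply/funext => f; rewrite !mxE.
    by apply: measurable_funD; [|apply: measurable_funB]; exact: measurable_eval_coord.
  by have := m measurableT B mB; rewrite setTI.
have := @preimage_cylinder R T _ v I (sigma_algebra_filtration s) _ _ mA.
have -> : v @^-1` [set f | B (f 0 + (f 1 - f 2))] = [set u | B (driver X W u t)].
  apply/seteqP; split=> w; rewrite /= /v /driver eqxx nz2 n12 oner_eq0 eqxx//.
apply=> r C Ir mC; rewrite /v.
have [r0|r0] := eqVneq r 0; first by apply: filtration_X => //; rewrite lexx.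
have [r1|r1] := eqVneq r 1; first by apply: filtration_W => //; rewrite t0.
by apply: filtration_W => //; rewrite lexx.
Qed.

Lemma gaussian_driver_solution : gaussian_driver P (driver X W).
Proof.
split=> [t t0|s t A B s0 st mA mB].
  apply/measurable_fun_borel3P => i.
  rewrite (_ : (fun _ => _) = (fun w => X 0 w i 0 + (W t w i 0 - W 0 w i 0))); last first.
    by apply/funext => w; rewrite !mxE.
  have rvX := (measurable_fun_borel3P setT (X 0)).1 (cX.1 0 (lexx 0)) i.
  have [[rW _] _ _ _] := BW.
  have rvW := (measurable_fun_borel3P setT (W t)).1 (rW t t0) i.
  have rvW0 := (measurable_fun_borel3P setT (W 0)).1 (rW 0 (lexx 0)) i.
  by apply: measurable_funD => //; exact: measurable_funB.
have t0 : 0 <= t - s by rewrite subr_ge0 ltW.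
rewrite increment_set_driver setIC (indep s0); last exact: filtration_driver.
  by rewrite muleC; case: BW => _ _ -> .
apply: sub_sigma_algebra; exists (t - s); first by rewrite /= in_itv/= andbT.
by rewrite [s + _]addrC subrK; exact: (sigma3_box (fun w => W t w - W s w) mB).
Qed.

End solution_driver.

Arguments dyadics : clear implicits.

(** * The solution as a measurable functional of the driver *)

Section skorokhod.
Variables (R : realType) (p mu : R) (b : 'cV[R]_3).
Hypotheses (p1 : 1 <= p) (mu0 : 0 < mu).

Definition driver_path (f : R -> 'cV[R]_3) (t : R) : 'cV[R]_3 :=
  f 0 + t *: b + dispersion mu *m (f t - f 0).

(** The upper limit exists on every path and is measurable, whereas convergence is known only for
    paths that admit a reflection pair; [fine] sends infinite values to 0. *)
Definition skorokhod (f : R -> 'cV[R]_3) (t : R) : 'cV[R]_3 :=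
  \col_h fine (limn_esup (fun m => (picard_path p mu (driver_path f) m t h 0)%:E)).

Lemma skorokhod_reflection_pair f x t : reflection_pair p mu (driver_path f) x ->
  0 <= t -> skorokhod f t = x t.
Proof.
move=> fx t0; apply/matrixP => h j; rewrite ord1 mxE.
have cv : (picard_path p mu (driver_path f) m t h 0)%:E @[m --> \oo] --> (x t h 0)%:E.
  by apply: cvg_EFin; [exact: nearW|exact: picard_path_cvg].
rewrite is_cvg_limn_esupE; last by apply/cvg_ex; eexists; exact: cv.
by rewrite (cvg_lim _ cv).
Qed.

Lemma measurable_running_max d (T : measurableType d) (f : T -> nat -> R) k :
  (forall j, measurable_fun setT (fun w => f w j)) ->
  measurable_fun setT (fun w => running_max (f w) k).
Proof.
move=> mf; elim: k => [|k IH] /=; apply: measurable_maxr => //.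
Qed.

Lemma measurable_picard d (T : measurableType d) (z : T -> nat -> 'cV[R]_3) n k h :
  (forall j i, measurable_fun setT (fun w => z w j i 0)) ->
  measurable_fun setT (fun w => picard p mu (z w) n k h 0).
Proof.
move=> mz; elim: n k h => [|n IH] k h.
  by rewrite (_ : (fun _ => _) = cst 0)//; apply/funext => w; rewrite mxE.
rewrite (_ : (fun _ => _) = (fun w => running_max (fun j =>
    picard p mu (z w) n j h 0 - contraction_rate mu *
      face_fun p mu h (z w j + picard p mu (z w) n j)) k)); last first.
  by apply/funext => w; rewrite -picard_mapE.
apply: measurable_running_max => j; apply: measurable_funB; first exact: IH.
apply: measurable_funM => //.
apply: (@measurableT_comp _ _ _ _ (borel3 R) _ (face_fun p mu h : borel3 R -> R) setT
    (fun w => z w j + picard p mu (z w) n j)).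
  by apply: continuous_measurable_borel3; exact: continuous_face_fun.
apply/measurable_fun_borel3P => i.
rewrite (_ : (fun _ => _) = (fun w => z w j i 0 + picard p mu (z w) n j i 0)).
  exact: measurable_funD.
by apply/funext => w; rewrite mxE.
Qed.

Lemma dyadics0 : dyadics R 0.
Proof. by exists 0%N, 0%N; rewrite mul0r. Qed.

(** Each [picard_path] reads the driver only at multiples of a power of [2^-1], hence the dyadic
    cylinder sets suffice although [t] is arbitrary. *)
Lemma measurable_skorokhod t : 0 <= t -> measurable_fun setT
  ((fun f => skorokhod f t) : cylinderType (dyadics R) -> borel3 R).
Proof.
move=> t0; apply/measurable_fun_borel3P => h.
rewrite (_ : (fun _ => _) = (fun f : cylinderType (dyadics R) =>
   fine (limn_esup (fun m => (picard_path p mu (driver_path f) m t h 0)%:E)))); last first.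
  by apply/funext => f; rewrite mxE.
apply: (@measurableT_comp _ _ _ _ _ _ fine) => //.
apply: measurable_fun_limn_esup => m; apply/measurable_EFinP.
have mdp k i : measurable_fun setT (fun f : cylinderType (dyadics R) =>
    driver_path f (k%:R * 2^-1 ^+ m) i 0).
  rewrite (_ : (fun _ => _) = (fun f : cylinderType (dyadics R) =>
    f 0 i 0 + k%:R * 2^-1 ^+ m * b i 0 + \sum_j dispersion mu i j *
      (f (k%:R * 2^-1 ^+ m) j 0 - f 0 j 0))); last first.
    apply/funext => f; rewrite /driver_path mxE [X in X + _]mxE [X in _ + X + _]mxE.
    congr (_ + _); rewrite mxE; apply: eq_bigr => j _; congr (_ * _).
    by rewrite !mxE.
  have dk : dyadics R (k%:R * 2^-1 ^+ m) by exists m, k.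
  apply: measurable_funD; first apply: measurable_funD => //.
    exact: measurable_eval_coord dyadics0.
  apply: measurable_sum => j; apply: measurable_funM => //.
  by apply: measurable_funB; apply: measurable_eval_coord => //; exact: dyadics0.
rewrite /picard_path; set k := Num.truncn _.
rewrite (_ : (fun _ => _) = (fun f : cylinderType (dyadics R) =>
  driver_path f (k%:R * 2^-1 ^+ m) h 0 +
  picard p mu (fun k => driver_path f (k%:R * 2^-1 ^+ m)) m k h 0)); last first.
  by apply/funext => f; rewrite mxE.
by apply: measurable_funD => //; apply: measurable_picard.
Qed.

Lemma preimage_skorokhod A : <<s cylinder_generators [set t : R | 0 <= t] >> A ->
  <<s cylinder_generators (dyadics R) >> (skorokhod @^-1` A).
Proof.
apply: (preimage_cylinder (sigma_algebra_measurable (cylinderType (dyadics R)))).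
move=> t B t0 mB; rewrite -[X in measurable X]setTI.
exact: measurable_skorokhod.
Qed.

End skorokhod.

(** * Borel sets of the path space as traces of cylinder sets *)

Lemma enorm_le_sum (R : realType) (x : 'cV[R]_3) : enorm x <= \sum_i `|x i 0|.
Proof.
rewrite -[leRHS]ger0_norm ?sumr_ge0// -sqrtr_sqr ler_wsqrtr//.
rewrite !big_ord_recl !big_ord0 !addr0 -![x _ 0 ^+ 2]real_normK ?num_real//.
have := normr_ge0 (x ord0 0); have := normr_ge0 (x (lift ord0 ord0) 0).
have := normr_ge0 (x (lift ord0 (lift ord0 ord0)) 0).
move: `|x ord0 0| `|x (lift ord0 ord0) 0| `|x (lift ord0 (lift ord0 ord0)) 0|.
move=> u v w w0 v0 u0; rewrite -subr_ge0.
have -> : (u + (v + w)) ^+ 2 - (u ^+ 2 + (v ^+ 2 + w ^+ 2)) =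
  2 * (u * v + u * w + v * w) by ring.
by rewrite mulr_ge0// !addr_ge0// mulr_ge0.
Qed.

Lemma le_on_rationals (R : realType) (f : R -> R) (n C : R) : continuous f ->
  (forall q : rat, 0 <= (ratr q : R) <= n -> f (ratr q) <= C) ->
  forall t, 0 <= t < n -> f t <= C.
Proof.
move=> cf H t /andP[t0 tn]; rewrite leNgt; apply/negP => Ct.
have /(@cvgrPdist_lt _ _ _ (nbhs t) _ f)/(_ (f t - C)) := cf t.
rewrite subr_gt0 => /(_ Ct) /nbhs_ballP[e /= e0 eP].
have : t < Num.min (t + e) n by rewrite lt_min tn andbT ltrDl.
move=> /rat_in_itvoo[q]; rewrite in_itv/= lt_min => /and3P[tq qe qn].
have : `|f t - f (ratr q)| < f t - C.
  by apply: eP; rewrite /ball/= distrC gtr0_norm ?subr_gt0// ltrBlDl.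
have qC : f (ratr q) <= C by apply: H; rewrite (ltW qn) (le_trans t0 (ltW tq)).
by rewrite ltNge (le_trans _ (ler_norm _))// lerD2l lerN2.
Qed.

Lemma rat_approx (R : realType) (x e : R) : 0 < e ->
  exists q : rat, `|x - ratr q| < e.
Proof.
move=> e0; have : x < x + e by rewrite ltrDl.
move=> /rat_in_itvoo[q]; rewrite in_itv/= => /andP[xq qx].
by exists q; rewrite distrC gtr0_norm ?subr_gt0// ltrBlDl.
Qed.

Lemma continuous_coord (R : realType) (k : R -> 'cV[R]_3) i :
  continuous k -> continuous (fun t => k t i 0).
Proof.
move=> ck t; exact: (cvg_comp _ _ (ck t) (@coord_continuous R 3 1 i 0 (k t))).
Qed.

Section path_borel_cylinder.
Variables (R : realType) (D : set 'cV[R]_3).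

Let code : Type := (nat * nat * nat * seq {ffun 'I_3 -> rat})%type.

(* Paths that stay within [k.+1%:R^-1] of a step function with rational values
   at the rational times of [0, n]. *)
Let tube (c : code) : set (R -> 'cV[R]_3) :=
  let: (n, m, k, s) := c in
  \bigcap_(q in [set q : rat | 0 <= (ratr q : R) <= n%:R])
    [set f : R -> 'cV[R]_3 | forall i,
      `|f (ratr q) i 0 - ratr (nth [ffun=> 0] s (Num.truncn (ratr q * m.+1%:R : R)) i)|
      <= k.+1%:R^-1].

Let measurable_tube c : <<s cylinder_generators [set t : R | 0 <= t] >> (tube c).
Proof.
case: c => [[[n m] k] s]; rewrite /tube.
pose U := cylinderType [set t : R | 0 <= t].
rewrite -[X in <<s _ >> X]setCK setC_bigcap.
apply: (@measurableC _ U); rewrite bigcup_mkcond; apply: bigcupT_measurable_rat => q.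
case: ifPn => [|_]; last exact: (@measurable0 _ U).
rewrite inE /= => /andP[q0 _]; apply: (@measurableC _ U).
rewrite (_ : [set f | _] = \bigcap_(i : 'I_3) ((fun f : U => f (ratr q) i 0) @^-1`
   [set x | `|x - ratr (nth [ffun=> 0] s (Num.truncn (ratr q * m.+1%:R : R)) i)|
      <= k.+1%:R^-1])); last first.
  by apply/seteqP; split=> f H i; [move=> _; exact: H|exact: H].
apply: fin_bigcap_measurable => // i _; rewrite -[X in measurable X]setTI.
apply: measurable_eval_coord => //.
rewrite (_ : [set x | _] = closed_ball_ (fun x => `|x|)
  (ratr (nth [ffun=> 0] s (Num.truncn (ratr q * m.+1%:R : R)) i)) k.+1%:R^-1).
  rewrite -closed_ballE// closed_ball_itv//.
by apply/seteqP; split=> x /=; rewrite distrC.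
Qed.

Let small_inv (e : R) : 0 < e -> exists k : nat, k.+1%:R^-1 < e.
Proof.
move=> e0; exists (Num.truncn e^-1).
by rewrite -[ltRHS]invrK ltf_pV2 ?posrE ?invr_gt0// truncnS_gt.
Qed.

Let path_open_tubes O : path_open D O ->
  O = path_space D `&` \bigcup_(c in [set c | path_space D `&` tube c `<=` O]) tube c.
Proof.
move=> [OD Oball]; apply/seteqP; split=> [f Of|f [Df [c cO cf]]]; last exact: cO.
split; first exact: OD.
have [c [e [e0 Oe]]] := Oball f Of.
have [cf _] := OD f Of.
(* Two paths of one tube differ by at most twice its radius in each of three coordinates, whence the
   factor 6. *)
have e60 : 0 < e / 6 by rewrite divr_gt0.
have [k ke] := small_inv e60.
(* The horizon [c] of the neighbourhood may be negative; the strict inequality [c < n] lets rational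
   times approach every time up to [c] from the right. *)
pose n := (Num.truncn `|c|).+1.
have cn : c < n%:R by rewrite (le_lt_trans (ler_norm _))// truncnS_gt.
have k0 : 0 < k.+1%:R^-1 / 2 :> R by rewrite divr_gt0// invr_gt0.
have [d d0 dP] := unif_continuous_itv 0 n%:R (continuous_max0 cf) k0.
have [m md] := small_inv d0.
have /(_ _)/cid approx j : exists v : {ffun 'I_3 -> rat},
    forall i, `|f (j%:R / m.+1%:R) i 0 - ratr (v i)| < k.+1%:R^-1 / 2.
  have H i := cid (rat_approx (f (j%:R / m.+1%:R) i 0) k0).
  by exists [ffun i => sval (H i)] => i; rewrite ffunE; case: (H i).
(* One more value than there are cells, since the rational time may be the end point [n] itself. *)
pose s := mkseq (fun j => sval (approx j)) (n * m.+1).+1.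
have m0 : 0 < m.+1%:R :> R by rewrite ltr0n.
have near_s q i : 0 <= (ratr q : R) <= n%:R ->
    `|f (ratr q) i 0 - ratr (nth [ffun=> 0] s (Num.truncn (ratr q * m.+1%:R : R)) i)|
      <= k.+1%:R^-1.
  move=> /andP[q0 qn]; set j := Num.truncn _.
  have /andP[jq qj] : ((j%:R : R) <= ratr q * m.+1%:R) && (ratr q * m.+1%:R < (j.+1%:R : R)).
    by apply: truncn_itv; rewrite mulr_ge0// ltW.
  have jn : (j < (n * m.+1).+1)%N.
    by rewrite ltnS -(ler_nat R) (le_trans jq)// natrM ler_pM2r.
  rewrite nth_mkseq//; set v := f (j%:R / m.+1%:R) i 0.
  have -> : f (ratr q) i 0 - ratr (sval (approx j) i) =
    (f (ratr q) i 0 - v) + (v - ratr (sval (approx j) i)) by rewrite addrA subrK.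
  rewrite [leRHS]splitr (le_trans (ler_normD _ _))// lerD//; last first.
    exact: ltW (svalP (approx j) i).
  have j0 : 0 <= j%:R / m.+1%:R :> R by rewrite divr_ge0// ltW.
  have := dP (ratr q) (j%:R / m.+1%:R); rewrite q0 qn !max_r// => /(_ isT) H.
  have := coord_le_norm (f (ratr q) - f (j%:R / m.+1%:R)) i.
  rewrite !mxE => /le_trans; apply; apply/ltW/H; apply: lt_trans md.
  rewrite ger0_norm ?subr_ge0 ?ler_pdivrMr// ltrBlDl.
  by rewrite -[X in _ < _ + X]mul1r -mulrDl natr1 ltr_pdivlMr.
exists (n, m, k, s); last by move=> q qn i; exact: near_s.
move=> g [Dg tg]; apply: Oe => // t /andP[t0 tc].
have tn : t < n%:R by exact: le_lt_trans cn.
have [cg _] := Dg.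
have coord i : `|g t i 0 - f t i 0| <= k.+1%:R^-1 + k.+1%:R^-1.
  have cfg : continuous (fun t : R => `|g (Num.max 0 t) i 0 - f (Num.max 0 t) i 0|).
    have cg' := continuous_coord (i := i) (continuous_max0 cg).
    have cf' := continuous_coord (i := i) (continuous_max0 cf).
    by move=> u; exact (cvg_norm (cvgB (cg' u) (cf' u))).
  have := le_on_rationals cfg _ (n := n%:R) (t := t).
  rewrite t0 tn (max_r t0) => /(_ _ _ isT); apply=> q q0n.
  have /andP[q0 _] := q0n; rewrite (max_r q0).
  set r := ratr (nth [ffun=> 0] s (Num.truncn (ratr q * m.+1%:R : R)) i) : R.
  have -> : g (ratr q) i 0 - f (ratr q) i 0 =
    (g (ratr q) i 0 - r) - (f (ratr q) i 0 - r) by ring.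
  rewrite (le_trans (ler_normB _ _))// lerD//; first exact: (tg q q0n i).
  exact: near_s.
apply: le_lt_trans (enorm_le_sum _) _.
apply: (@le_lt_trans _ _ (\sum_(i < 3) (k.+1%:R^-1 + k.+1%:R^-1))).
  by apply: ler_sum => i _; rewrite !mxE.
have key (x : R) : x < e / 6 -> (x + x) *+ 3 < e.
  by clear -e0 => H; rewrite -[_ *+ 3]mulr_natl; lra.
by rewrite sumr_const card_ord; exact: key.
Qed.

(** An open set of paths is the trace of a union of tubes, and tubes have countably many codes. Only
    traces can be expected: [path_space D] demands continuity and is in general not a cylinder
    set. *)
Lemma path_borel_cylinder A : path_borel D A ->
  exists2 A', <<s cylinder_generators [set t : R | 0 <= t] >> A' &
    A = path_space D `&` A'.
Proof.
pose U := cylinderType [set t : R | 0 <= t].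
move: A; apply: smallest_sub => [|O Oo].
  split.
  - by exists set0; [exact: (@measurable0 _ U)|rewrite setI0].
  - move=> _ [A mA ->]; exists (~` A); first exact: (@measurableC _ U).
    by rewrite setDE setCI setIUr setICr set0U.
  - move=> F HF; pose G n := sval (cid2 (HF n)).
    exists (\bigcup_n G n).
      apply: (@bigcupT_measurable _ U) => n.
      by rewrite /G; case: cid2.
    rewrite setI_bigcupr; apply: eq_bigcupr => n _.
    by rewrite /G; case: cid2.
exists (\bigcup_(c in [set c | path_space D `&` tube c `<=` O]) tube c); last first.
  exact: path_open_tubes.
rewrite bigcup_mkcond; apply: (@countable_bigcupT_measurable _ U) => [|c].
  exact: countableP.
by case: ifP => _; [exact: measurable_tube|exact: (@measurable0 _ U)].
Qed.

End path_borel_cylinder.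

(** * Uniqueness in distribution *)

Lemma le_measure_ae (R : realType) d (T : measurableType d)
    (P : {measure set T -> \bar R}) (A B : set T) :
  measurable A -> measurable B -> {ae P, forall w, A w -> B w} -> (P A <= P B)%E.
Proof.
move=> mA mB [N [mN N0 sub]].
apply: (@le_trans _ _ (P (B `|` N))).
  apply: le_measure; rewrite ?inE//; first exact: measurableU.
  move=> w Aw; have [?|nB] := pselect (B w); first by left.
  by right; apply: sub => /= /(_ Aw).
by rewrite -[leRHS]adde0 -[X in (_ <= _ + X)%E]N0; exact: measureU2.
Qed.

Lemma eq_measure_ae (R : realType) d (T : measurableType d)
    (P : {measure set T -> \bar R}) (A B : set T) :
  measurable A -> measurable B -> {ae P, forall w, A w <-> B w} -> P A = P B.
Proof.
move=> mA mB AB; apply/eqP; rewrite eq_le; apply/andP; split.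
  by apply: le_measure_ae => //; apply: filterS AB => w [].
by apply: le_measure_ae => //; apply: filterS AB => w [].
Qed.

Lemma cylinder_ext (R : realType) (I : set R) (A : set (R -> 'cV[R]_3))
    (f g : R -> 'cV[R]_3) : <<s cylinder_generators I >> A ->
  (forall t, I t -> f t = g t) -> A f <-> A g.
Proof.
move=> mA fg; move: A mA; apply: smallest_sub => [|A [t It [B _ <-]]].
  split=> // [A H|F H]; first by rewrite setTD /=; split=> + Ag; apply; apply/H.
  by split=> -[n _ Fn]; exists n => //; apply/H.
by rewrite setTI /= fg.
Qed.

Section solution_law.
Variables (R : realType) (p mu : R) (b : 'cV[R]_3).
Hypotheses (p1 : 1 <= p) (mu0 : 0 < mu).
Variables (d : measure_display) (T : measurableType d) (P : probability T R).
Variable X : R -> T -> 'cV[R]_3.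

(** Continuity holds for every outcome, so the event only says that the path is in [D]; as [D] is
    closed, rational times decide. *)
Lemma measurable_path_space (D : set 'cV[R]_3) : closed D -> continuous_process X ->
  measurable [set w | path_space D (X ^~ w)].
Proof.
move=> cD [mX cX].
rewrite (_ : [set w | _] = \bigcap_(q in [set q : rat | 0 <= (ratr q : R)])
    (X (ratr q) @^-1` D)); last first.
  apply/seteqP; split=> w; first by move=> [_ XD] q q0; exact: XD.
  move=> H; split; first exact: cX.
  move=> t t0; apply: contrapT => nD.
  have oD : open (~` D) by rewrite openC.
  have /(_ t) := continuous_max0 (cX w); rewrite /continuous_at max_r//.
  move=> /(_ (~` D)) /(_ (open_nbhs_nbhs (conj oD nD))) /nbhs_ballP[e /= e0 eP].
  have : t < t + e by rewrite ltrDl.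
  move=> /rat_in_itvoo[q]; rewrite in_itv/= => /andP[tq qe].
  have q0 : 0 <= (ratr q : R) by rewrite (le_trans t0)// ltW.
  have := eP (ratr q); rewrite /= /ball/= max_r//; apply; last exact: H.
  by rewrite distrC gtr0_norm ?subr_gt0// ltrBlDl.
rewrite -[X in measurable X]setCK setC_bigcap; apply: measurableC.
rewrite bigcup_mkcond; apply: bigcupT_measurable_rat => q; case: ifPn => // q0.
apply: measurableC; rewrite inE /= in q0; rewrite -[X in measurable X]setTI.
apply: (mX _ q0) => //; rewrite -[D]setCK; apply: measurableC.
by apply: sub_sigma_algebra; rewrite openC.
Qed.

Lemma solution_gaussian_driver : solution p mu b P X ->
  exists z : T -> R -> 'cV[R]_3, [/\ gaussian_driver P z,
    forall w, z w 0 = X 0 w &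
    {ae P, forall w, path_space (closure (cone p mu)) (X ^~ w) /\
      forall t, 0 <= t -> X t w = skorokhod p mu b (z w) t}].
Proof.
move=> [cX [W [gamma [lam [BW _ [_ mgamma] indep eqE]]]]].
exists (driver X W); split; first exact: gaussian_driver_solution indep.
  by move=> w; rewrite /driver subrr addr0.
have [[_ cW] W0 _ _] := BW.
apply: filterS2 W0 eqE => w W0 eqw.
have pair := equation_E_reflection_pair p1 mu0 eqw W0 (cX.2 w) (cW w) (mgamma w).
split; first by split; [exact: cX.2|case: eqw].
move=> t t0; apply/esym.
apply: (skorokhod_reflection_pair p1 mu0 (x := X ^~ w)) => //.
rewrite (_ : driver_path _ _ _ =
  (fun t => X 0 w + t *: b + dispersion mu *m W t w))//.
apply/funext => s; rewrite /driver_path /driver W0 subrr addr0 subr0.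
by rewrite [X 0 w + W s w]addrC addrK.
Qed.

Lemma path_law_solution z : solution p mu b P X ->
  gaussian_driver P z ->
  {ae P, forall w, path_space (closure (cone p mu)) (X ^~ w) /\
      forall t, 0 <= t -> X t w = skorokhod p mu b (z w) t} ->
  forall A A', <<s cylinder_generators [set t : R | 0 <= t] >> A' ->
    A = path_space (closure (cone p mu)) `&` A' ->
  path_law P X A = P (z @^-1` (skorokhod p mu b @^-1` A')).
Proof.
move=> [cX _] [mz _] Xz A A' mA' AE.
have mD : measurable [set w | path_space (closure (cone p mu)) (X ^~ w)].
  by apply: measurable_path_space => //; exact: closed_closure.
have mXA : measurable [set w | A' (X ^~ w)].
  rewrite -[X in measurable X]setTI.
  exact: (@measurable_cylinder_map _ _ _ (fun w t => X t w) _ cX.1 measurableT A' mA').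
have mzA : measurable (z @^-1` (skorokhod p mu b @^-1` A')).
  rewrite -[X in measurable X]setTI.
  apply: (@measurable_cylinder_map _ _ _ z (dyadics R)) => //.
    by move=> t [m [k ->]]; apply: mz; rewrite mulr_ge0// exprn_ge0// invr_ge0.
  exact: preimage_skorokhod.
apply: eq_measure_ae => //.
  by rewrite AE (_ : [set w | _] = [set w | path_space (closure (cone p mu)) (X ^~ w)] `&`
    [set w | A' (X ^~ w)])//; exact: measurableI.
apply: filterS Xz => w [Dw Xw]; rewrite AE /=.
have := cylinder_ext mA' Xw; tauto.
Qed.

End solution_law.

(** Both solutions are images under the same [skorokhod] of drivers whose laws agree on dyadic
    cylinder sets, by [gaussian_driver_law]. *)
Lemma solution_unique_in_distribution (R : realType) (p mu : R) (b : 'cV[R]_3) :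
  1 <= p -> 0 < mu -> uniqueness_in_distribution p mu b.
Proof.
move=> p1 mu0 nu _ d T P X d' T' P' X' solX iX solX' iX' A.
move=> /path_borel_cylinder[A' mA' AE].
have [z [Dz z0 Xz]] := solution_gaussian_driver p1 mu0 solX.
have [z' [Dz' z0' Xz']] := solution_gaussian_driver p1 mu0 solX'.
rewrite (path_law_solution p1 mu0 solX Dz Xz mA' AE).
rewrite (path_law_solution p1 mu0 solX' Dz' Xz' mA' AE).
have [] // : same_law P P' z z' (skorokhod p mu b @^-1` A').
apply: (gaussian_driver_law Dz Dz'); last exact: preimage_skorokhod.
move=> B mB; rewrite (_ : [set w | B (z w 0)] = X 0 @^-1` B); last first.
  by apply/seteqP; split=> w /=; rewrite z0.
rewrite (_ : [set w | B (z' w 0)] = X' 0 @^-1` B); last first.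
  by apply/seteqP; split=> w /=; rewrite z0'.
by rewrite iX// iX'.
Qed.

(** * Gaussian moments and independence *)

Lemma tonelli_independent (R : realType) d (T : measurableType d)
    (P : probability T R) d1 (T1 : measurableType d1) d2 (T2 : measurableType d2)
    (Y : T -> T1) (Z : T -> T2) (f : T1 * T2 -> \bar R) :
  measurable_fun setT Y -> measurable_fun setT Z ->
  (forall A B, measurable A -> measurable B ->
    P (Y @^-1` A `&` Z @^-1` B) = P (Y @^-1` A) * P (Z @^-1` B))%E ->
  measurable_fun setT f -> (forall u, 0 <= f u)%E ->
  (\int[P]_w f (Y w, Z w) = \int[P]_w \int[P]_w' f (Y w, Z w'))%E.
Proof.
move=> mY mZ indep mf f0.
pose YRV : {mfun T >-> T1} := HB.pack Y (isMeasurableFun.Build _ _ _ _ _ mY).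
pose ZRV : {mfun T >-> T2} := HB.pack Z (isMeasurableFun.Build _ _ _ _ _ mZ).
have mYZ : measurable_fun setT (fun w => (Y w, Z w)) by exact: measurable_fun_pair.
pose YZ : {mfun T >-> (T1 * T2)%type} :=
  HB.pack (fun w => (Y w, Z w)) (isMeasurableFun.Build _ _ _ _ _ mYZ).
have := @ge0_integral_distribution _ _ T _ R P YZ f mf f0; rewrite /= => <-.
rewrite (eq_measure_integral (distribution P YRV \x distribution P ZRV)%E); last first.
  move=> A mA _; apply/esym; apply: product_measure_unique => //.
rewrite fubini_tonelli1//.
rewrite (ge0_integral_distribution YRV); last 2 first.
- exact: measurable_fun_fubini_tonelli_F.
- by move=> x; apply: integral_ge0.
apply: eq_integral => w _; rewrite /= /fubini_F.
rewrite (ge0_integral_distribution ZRV)//.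
exact: measurableT_comp mf (measurable_pair1 _).
Qed.

Section normal_moments.
Variable R : realType.
Local Notation leb := (@lebesgue_measure R).

(** [normal_pdf] and the Radon-Nikodym derivative have the same integral over every measurable set,
    hence agree almost everywhere. *)
Lemma ge0_integral_normal_prob (m s : R) (f : R -> \bar R) :
  measurable_fun setT f -> (forall x, 0 <= f x)%E ->
  (\int[normal_prob m s]_x f x = \int[leb]_x (f x * (normal_pdf m s x)%:E))%E.
Proof.
move=> mf f0; have dom := normal_prob_dominates m s.
rewrite -(Radon_Nikodym_SigmaFinite.change_of_variables dom)//.
have mpdf : measurable_fun setT (fun x => (normal_pdf m s x)%:E).
  by apply/measurable_EFinP; exact: measurable_normal_pdf.
apply: ae_eq_integral => //.
- apply: emeasurable_funM => //.
  exact: measurable_int (Radon_Nikodym_SigmaFinite.f_integrable dom).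
- exact: emeasurable_funM.
- apply: ae_eqe_mul2l; apply: integral_ae_eq => //.
  + exact: Radon_Nikodym_SigmaFinite.f_integrable.
  + by move=> A _ mA; rewrite -Radon_Nikodym_SigmaFinite.f_integral.
Qed.

Definition normal_moment (n : nat) (s : R) : \bar R :=
  (\int[normal_prob 0 s]_x (x ^+ n)%:E)%E.

Lemma normal_pdf_scale (s y : R) : 0 < s ->
  normal_pdf 0 s (s * y) * s = normal_pdf 0 1 y.
Proof.
move=> s0; rewrite /normal_pdf (gt_eqF s0) oner_eq0 /normal_peak /normal_fun.
rewrite !subr0 expr1n mul1r -mulrnAr sqrtrM ?sqr_ge0// sqrtr_sqr gtr0_norm//.
rewrite invfM mulrAC [_ * s]mulrAC mulVf ?gt_eqF// mul1r; congr (_ * expR _).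
have -> : - (s * y) ^+ 2 = (- y ^+ 2) * s ^+ 2 by ring.
rewrite -[1 *+ 2]/(2%:R : R) -mulr_natr invfM -mulrA; congr (_ * _).
by rewrite mulrA divff ?mul1r// expf_neq0// gt_eqF.
Qed.

Lemma measurable_expr_EFin n : measurable_fun setT (fun x : R => (x ^+ n)%:E).
Proof. by apply/measurable_EFinP; exact: exprn_measurable. Qed.

(** Substitution of [s * y] for the variable. Even exponents keep the integrand nonnegative, so no
    integrability has to be known beforehand. *)
Lemma normal_moment_scale n (s : R) : 0 < s -> ~~ odd n ->
  normal_moment n s = ((s ^+ n)%:E * normal_moment n 1)%E.
Proof.
move=> s0 even_n; have xn0 (x : R) : 0 <= x ^+ n by exact: exprn_even_ge0.
rewrite /normal_moment !ge0_integral_normal_prob; last 4 first.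
- exact: measurable_expr_EFin.
- by move=> x; rewrite lee_fin.
- exact: measurable_expr_EFin.
- by move=> x; rewrite lee_fin.
rewrite -ge0_integralZl//; last 3 first.
- apply: emeasurable_funM; first exact: measurable_expr_EFin.
  by apply/measurable_EFinP; exact: measurable_normal_pdf.
- by move=> x _; rewrite mule_ge0// lee_fin ?normal_pdf_ge0.
- by rewrite lee_fin exprn_ge0// ltW.
pose F (y : R^o) : R^o := s * y.
have F' : F^`()%classic = cst s.
  apply/funext => x; rewrite /F derive1E deriveM// derive_id derive_cst.
  by rewrite scaler0 addr0 scaler1.
have := @increasing_ge0_integration_by_substitutionT R F
  (fun x => x ^+ n * normal_pdf 0 s x).
rewrite F' => ->.
- apply: eq_integral => y _; rewrite /= -!EFinM; congr EFin.
  rewrite -[LHS]/(((s * y) ^+ n * normal_pdf 0 s (s * y)) * s).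
  by rewrite -(normal_pdf_scale y s0) exprMn; ring.
- by move=> x y xy; rewrite /F ltr_pM2l.
- by move=> x; exact: cvg_cst.
- exact: is_cvg_cst.
- exact: is_cvg_cst.
- by move=> x; exact: derivableM.
- by apply: gt0_cvgMrNy => //; exact: cvg_id.
- by apply: gt0_cvgMry => //; exact: cvg_id.
- move=> x; apply: cvgM; first exact: exprn_continuous.
  by apply: continuous_normal_pdf; rewrite gt_eqF.
- by move=> x; rewrite mulr_ge0// normal_pdf_ge0.
Qed.

End normal_moments.

Section normal_moment_bounds.
Variable R : realType.
Local Notation leb := (@lebesgue_measure R).

Lemma sqr_le_expR (u : R) : 0 <= u -> u ^+ 2 <= 4 * expR u.
Proof.
move=> u0; have h0 : 0 <= u / 2 by rewrite divr_ge0.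
have : u / 2 <= expR (u / 2).
  by apply: le_trans (expR_ge1Dx _); rewrite lerDr.
move=> h; have := ler_pM h0 h0 h h; rewrite -expRD -splitr => H.
have -> : u ^+ 2 = 4 * (u / 2 * (u / 2)) by field.
by rewrite ler_wpM2l.
Qed.

(** Domination by a multiple of the density of standard deviation 2. With [u = 3/8 * x^2] the ratio
    of the Gaussian exponentials is [expR u], and [x^4 = 64/9 * u^2] is at most [256/9 * expR u];
    the constant is [58 / 2 = 29], which exceeds [256/9]. *)
Lemma normal_moment4_lty : (normal_moment 4 (1 : R) < +oo)%E.
Proof.
rewrite /normal_moment ge0_integral_normal_prob; last 2 first.
- exact: measurable_expr_EFin.
- by move=> x; rewrite lee_fin exprn_even_ge0.
apply: (@le_lt_trans _ _ (\int[leb]_x (58%:E * (normal_pdf 0 2 x)%:E))%E); last first.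
  rewrite ge0_integralZl//.
  - by rewrite integral_normal_pdf mule1 ltry.
  - by apply/measurable_EFinP; exact: measurable_normal_pdf.
  - by move=> x _; rewrite lee_fin normal_pdf_ge0.
apply: ge0_le_integral => //.
- by move=> x _; rewrite mule_ge0// lee_fin ?exprn_even_ge0// normal_pdf_ge0.
- apply: emeasurable_funM; first exact: measurable_expr_EFin.
  by apply/measurable_EFinP; exact: measurable_normal_pdf.
- by apply: emeasurable_funM => //; apply/measurable_EFinP; exact: measurable_normal_pdf.
move=> x _; rewrite -!EFinM lee_fin.
have h2 : 0 < 2 :> R by [].
have := normal_pdf_scale (x / 2) h2; rewrite [2 * _]mulrC divfK// => E.
have -> : normal_pdf 0 2 x = normal_pdf 0 1 (x / 2) / 2 by rewrite -E mulfK.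
rewrite /normal_pdf oner_eq0 /normal_fun !subr0.
pose u := 3 / 8 * x ^+ 2; pose a := expR (- x ^+ 2 / (1 ^+ 2 *+ 2)).
have u0 : 0 <= u by rewrite mulr_ge0// sqr_ge0.
have -> : - (x / 2) ^+ 2 / (1 ^+ 2 *+ 2) = u + - x ^+ 2 / (1 ^+ 2 *+ 2).
  by rewrite /u; field.
rewrite expRD -/a; set pk := normal_peak 1.
have -> : 58 * (pk * (expR u * a) / 2) = pk * (29 * (expR u * a)) by field.
have -> : x ^+ 4 * (pk * a) = pk * (64 / 9 * (u ^+ 2 * a)) by rewrite /u; field.
rewrite ler_wpM2l ?normal_peak_ge0//.
have a0 : 0 <= a by exact: expR_ge0.
have H := ler_wpM2r a0 (sqr_le_expR u0).
have ea0 : 0 <= expR u * a by rewrite mulr_ge0// expR_ge0.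
move: H ea0; rewrite -[4 * _ * a]mulrA; move: (u ^+ 2 * a) (expR u * a) => v c; clear => H1 H2; lra.
Qed.

Lemma normal_moment2_lty : (normal_moment 2 (1 : R) < +oo)%E.
Proof.
apply: (@le_lt_trans _ _ (\int[normal_prob 0 1]_x (1 + (x ^+ 4)%:E))%E).
  apply: ge0_le_integral => //.
  - by move=> x _; rewrite lee_fin sqr_ge0.
  - exact: measurable_expr_EFin.
  - by apply: emeasurable_funD => //; exact: measurable_expr_EFin.
  - move=> x _; rewrite lee_fin.
    have -> : x ^+ 4 = (x ^+ 2) ^+ 2 by rewrite -exprM.
    by have := sqr_ge0 (x ^+ 2 - 1); have := sqr_ge0 x; lra.
rewrite ge0_integralD//; last 2 first.
- by move=> x _; rewrite lee_fin exprn_even_ge0.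
- exact: measurable_expr_EFin.
rewrite integral_cst// mul1e [X in (X + _)%E]probability_setT.
by rewrite lte_add_pinfty ?ltry//; exact: normal_moment4_lty.
Qed.

(** The standard normal density at [C + 1], which is its least value on the unit interval from [C]
    to [C + 1]. *)
Definition tail_bound (C : R) : R :=
  (Num.sqrt (pi *+ 2))^-1 * expR (- (C + 1) ^+ 2 / 2).

Lemma tail_bound_gt0 C : 0 < tail_bound C.
Proof. by rewrite mulr_gt0 ?expR_gt0// invr_gt0 sqrtr_gt0 pmulrn_lgt0// pi_gt0. Qed.

(** The bound is free of [s]: an interval of length [s] beyond [C * s] compensates the factor [s^-1]
    of the density. This scale invariance is what defeats arbitrarily fine grids. *)
Lemma normal_prob_tail (C s : R) : 0 <= C -> 0 < s ->
  ((tail_bound C)%:E <= normal_prob 0 s [set x | (C * s < x)%R])%E.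
Proof.
move=> C0 s0; pose I := `](C * s), ((C + 1) * s)]%classic : set R.
have IC : I `<=` [set x | C * s < x] by move=> x; rewrite /I /= in_itv/= => /andP[].
have mC : measurable [set x | C * s < x].
  rewrite (_ : [set x | _] = `](C * s), +oo[%classic)//.
  by apply/seteqP; split=> x /=; rewrite in_itv/= andbT.
apply: (@le_trans _ _ (normal_prob 0 s I)); last first.
  by apply: le_measure; rewrite ?inE// /I; exact: measurable_itv.
have -> : (tail_bound C)%:E = (\int[leb]_(x in I) (s^-1 * tail_bound C)%:E)%E.
  have lebI : leb I = s%:E.
    rewrite /I lebesgue_measure_itv/= lte_fin ltr_pM2r// ltrDl ltr01.
    by rewrite -EFinB; congr EFin; ring.
  rewrite integral_cst; last by rewrite /I; exact: measurable_itv.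
  by rewrite [X in (_ * X)%E]lebI -EFinM mulrAC mulVf ?mul1r// gt_eqF.
have mI : measurable I by rewrite /I; exact: measurable_itv.
apply: ge0_le_integral => //.
- by move=> x _; rewrite lee_fin mulr_ge0 ?invr_ge0 ?(ltW s0)// ltW// tail_bound_gt0.
- apply/measurable_EFinP; apply: measurable_funTS; exact: measurable_normal_pdf.
move=> x; rewrite /I /= in_itv/= => /andP[Cx xC].
have := normal_pdf_scale (x / s) s0; rewrite [s * _]mulrC divfK ?gt_eqF// => E.
rewrite lee_fin ler_pdivrMl// mulrC E /normal_pdf oner_eq0 /tail_bound /normal_peak.
rewrite expr1n mul1r ler_wpM2l ?invr_ge0// ler_expR /normal_fun subr0 expr1n.
rewrite -[1 *+ 2]/(2%:R : R) ler_pM2r ?invr_gt0// lerN2.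
rewrite ler_sqr ?nnegrE; first by rewrite ler_pdivrMr.
  by rewrite divr_ge0 ?(ltW s0)// (le_trans _ (ltW Cx))// mulr_ge0// ltW.
by rewrite addr_ge0.
Qed.

Lemma normal_moment2_gt0 : (0 < normal_moment 2 (1 : R))%E.
Proof.
have mA : measurable [set x : R | 1 * 1 < x].
  rewrite (_ : [set x | _] = `](1 * 1), +oo[%classic)//.
  by apply/seteqP; split=> x /=; rewrite in_itv/= andbT.
have t0 : (0 < (tail_bound 1)%:E :> \bar R)%E by rewrite lte_fin tail_bound_gt0.
apply: (lt_le_trans t0).
apply: (@le_trans _ _ (normal_prob 0 1 [set x : R | (1 * 1 < x)%R])).
  by apply: normal_prob_tail; rewrite ?ler01 ?ltr01.
rewrite -[leLHS]mul1e -integral_cst// integral_mkcond; apply: ge0_le_integral => //.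
- by move=> x _; rewrite patchE; case: ifP.
- by apply/measurable_restrict => //; exact: measurable_cst.
- exact: measurable_expr_EFin.
- move=> x _; rewrite patchE; case: ifPn => [|_]; last by rewrite lee_fin sqr_ge0.
  by rewrite inE /= mulr1 => x1; rewrite lee_fin expr_ge1// ltW// (lt_trans _ x1).
Qed.

End normal_moment_bounds.

Section normal_mean.
Variable R : realType.
Local Notation leb := (@lebesgue_measure R).

Lemma normal_pdfN (s x : R) : s != 0 -> normal_pdf 0 s (- x) = normal_pdf 0 s x.
Proof.
by move=> s0; rewrite /normal_pdf (negbTE s0) /normal_fun !subr0 sqrrN.
Qed.

(** The vanishing of the mean, stated without integrability; it comes from the reflection [x -> - x]
    and the evenness of the density. *)
Lemma normal_prob_pos_neg (s : R) : 0 < s ->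
  (\int[normal_prob 0 s]_x (Num.max x 0)%:E =
   \int[normal_prob 0 s]_x (Num.max (- x) 0)%:E)%E.
Proof.
move=> s0; have sn0 : s != 0 by rewrite gt_eqF.
rewrite !ge0_integral_normal_prob; last 4 first.
- by apply/measurable_EFinP; apply: measurable_maxr => //; exact: measurableT_comp.
- by move=> x; rewrite lee_fin le_max lexx orbT.
- by apply/measurable_EFinP; apply: measurable_maxr.
- by move=> x; rewrite lee_fin le_max lexx orbT.
transitivity (\int[leb]_(x in `[0%R, +oo[) (x * normal_pdf 0 s x)%:E)%E.
  rewrite [RHS]integral_mkcond; apply: eq_integral => x _; rewrite patchE.
  rewrite mem_setE in_itv/= andbT; case: leP => x0; first by rewrite -EFinM.
  by rewrite mul0e.
have := @ge0_integration_by_substitutionNy R (fun x => - x * normal_pdf 0 s x) 0.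
rewrite oppr0 => E.
transitivity (\int[leb]_(x in `]-oo, 0%R]) (- x * normal_pdf 0 s x)%:E)%E.
  rewrite E.
  - by apply: eq_integral => x _; rewrite /= opprK normal_pdfN.
  - apply: continuous_subspaceT => x; apply: cvgM; first exact: cvgN.
    by apply: continuous_normal_pdf.
  - move=> x; rewrite in_itv/= => x0.
    by rewrite mulr_ge0 ?normal_pdf_ge0// oppr_ge0 ltW.
rewrite [LHS]integral_mkcond; apply: eq_integral => x _; rewrite patchE.
rewrite mem_setE in_itv/= -oppr_ge0; case: leP => x0; first by rewrite -EFinM.
by rewrite mul0e.
Qed.

End normal_mean.

Section mean.
Variables (R : realType) (d : measure_display) (T : measurableType d).
Variable P : probability T R.
Local Notation integrable F := (P.-integrable setT (EFin \o F)).
Implicit Types F G : T -> R.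

Lemma integrable_bounded F (M : R) : measurable_fun setT F ->
  (forall w, `|F w| <= M) -> integrable F.
Proof.
move=> mF FM; apply/integrableP; split; first exact/measurable_EFinP.
apply: (@le_lt_trans _ _ (\int[P]_w (cst M%:E w))%E).
  apply: ge0_le_integral => //; last by move=> w _; rewrite lee_fin.
  by apply/measurable_EFinP; exact: measurableT_comp.
rewrite integral_cst// [X in (_ * X)%E]probability_setT.
by rewrite mule1 ltry.
Qed.

(** Tonelli applied to the absolute value gives integrability of the product first; Fubini on the
    product law then gives its mean. *)
Lemma mean_independent F G : integrable F -> integrable G ->
  (forall A B, measurable A -> measurable B ->
    P (F @^-1` A `&` G @^-1` B) = (P (F @^-1` A) * P (G @^-1` B))%E) ->
  integrable (fun w => F w * G w) /\
  (\int[P]_w (F w * G w) = \int[P]_w F w * \int[P]_w G w)%R.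
Proof.
move=> iF iG indep.
have mF : measurable_fun setT F by move: (measurable_int _ iF) => /measurable_EFinP.
have mG : measurable_fun setT G by move: (measurable_int _ iG) => /measurable_EFinP.
pose f (u : R * R) : \bar R := (u.1 * u.2)%:E.
have mf : measurable_fun setT f.
  apply/measurable_EFinP; apply: measurable_funM; [exact: measurable_fst|exact: measurable_snd].
have iFG : integrable (fun w => F w * G w).
  apply/integrableP; split; first by apply/measurable_EFinP; exact: measurable_funM.
  have mnf : measurable_fun setT (fun u : R * R => `|f u|%E) by exact: measurableT_comp.
  rewrite [ltLHS](tonelli_independent mF mG indep mnf)//=.
  have -> : (\int[P]_w \int[P]_w' (`|F w * G w'|)%:E =
     \int[P]_w ((`|F w|)%:E * \int[P]_w' (`|G w'|)%:E))%E.
    apply: eq_integral => w _; rewrite -ge0_integralZl//.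
      by apply: eq_integral => w' _; rewrite normrM EFinM.
    by apply/measurable_EFinP; exact: measurableT_comp.
  case/integrableP : iF => _ iF; case/integrableP : iG => _ iG.
  rewrite ge0_integralZr//; last 2 first.
  - by apply/measurable_EFinP; exact: measurableT_comp.
  - by apply: integral_ge0 => w _; rewrite lee_fin.
  have iF0 : (0 <= \int[P]_w (`|F w|)%:E)%E by apply: integral_ge0 => w _; rewrite lee_fin.
  by rewrite lte_mul_pinfty// ge0_fin_numE.
split=> //.
pose FRV : {mfun T >-> R} := HB.pack F (isMeasurableFun.Build _ _ _ _ _ mF).
pose GRV : {mfun T >-> R} := HB.pack G (isMeasurableFun.Build _ _ _ _ _ mG).
have mFG : measurable_fun setT (fun w => (F w, G w)) by exact: measurable_fun_pair.
pose FG : {mfun T >-> (R * R)%type} :=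
  HB.pack (fun w => (F w, G w)) (isMeasurableFun.Build _ _ _ _ _ mFG).
have prodE A : measurable A ->
    (distribution P FRV \x distribution P GRV)%E A = distribution P FG A.
  by move=> mA; apply: product_measure_unique.
have if_ : (distribution P FRV \x distribution P GRV)%E.-integrable setT f.
  apply/integrableP; split=> //.
  rewrite (eq_measure_integral (distribution P FG)); last by move=> A mA _; exact: prodE.
  have -> := @ge0_integral_distribution _ _ T _ R P FG (fun u => `|f u|%E).
  - by case/integrableP : iFG.
  - exact: measurableT_comp.
  - by [].
have E : (\int[P]_w (F w * G w)%:E = \int[P]_w ((F w)%:E * \int[P]_w' (G w')%:E))%E.
  have := @integral_distribution _ _ T _ R P FG f mf iFG; rewrite /= => <-.
  rewrite (eq_measure_integral (distribution P FRV \x distribution P GRV)%E); last first.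
    by move=> A mA _; exact/esym/prodE.
  rewrite -integral12_prod_meas1//.
  have EG x : fubini_F (distribution P GRV) f x = (x%:E * \int[P]_w' (G w')%:E)%E.
    rewrite /fubini_F -integralZl//.
    rewrite (@integral_distribution _ _ T _ R P GRV)//=; last first.
      have := integrableZl measurableT x iG; apply: eq_integrable => //.
    exact: measurableT_comp mf (measurable_pair1 _).
  under eq_integral do rewrite EG.
  have iFc : integrable (fun w => F w * fine (\int[P]_w' (G w')%:E)).
    have := integrableZr measurableT (fine (\int[P]_w' (G w')%:E)) iF.
    by apply: eq_integrable => // w _; rewrite /= EFinM.
  rewrite (@integral_distribution _ _ T _ R P FRV)//=.
    by apply: emeasurable_funM => //; exact/measurable_EFinP.
  apply: eq_integrable iFc => // w _; rewrite /= EFinM fineK//.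
  exact: integrable_fin_num.
rewrite /Rintegral E -fineM; last 2 first.
- exact: integrable_fin_num.
- exact: integrable_fin_num.
congr fine; have fG : (\int[P]_w' (G w')%:E)%E \is a fin_num.
  exact: integrable_fin_num.
by rewrite -(fineK fG) integralZr.
Qed.

End mean.

Section gaussian_vector.
Variables (R : realType) (d : measure_display) (T : measurableType d).
Variables (P : probability T R) (xi : T -> 'cV[R]_3) (s : R).
Hypotheses (mxi : rv3 xi) (s0 : 0 < s).
Hypothesis law : forall B : 'I_3 -> set R, (forall i, measurable (B i)) ->
  P [set w | forall i, B i (xi w i 0)] =
  \big[*%E/1%E]_(i < 3) normal_prob 0 s (B i).
Local Notation integrable F := (P.-integrable setT (EFin \o F)).

Let mcoord i : measurable_fun setT (fun w => xi w i 0).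
Proof. exact: (measurable_fun_borel3P setT xi).1. Qed.

Lemma gaussian_coord_law i (A : set R) : measurable A ->
  P ((fun w => xi w i 0) @^-1` A) = normal_prob 0 s A.
Proof.
move=> mA; have := law (B := fun j => if j == i then A else setT).
rewrite (bigD1 i)//= eqxx big1; last first.
  by move=> j /negbTE ->; rewrite probability_setT.
rewrite mule1 => <-; last by move=> j; case: ifP.
congr (P _); apply/seteqP; split=> w /=; last by move=> /(_ i); rewrite eqxx.
by move=> Aw j; case: eqP => // ->.
Qed.

Lemma gaussian_coord_indep i j (A B : set R) : i != j -> measurable A -> measurable B ->
  P ((fun w => xi w i 0) @^-1` A `&` (fun w => xi w j 0) @^-1` B) =
  (P ((fun w => xi w i 0%R) @^-1` A) * P ((fun w => xi w j 0%R) @^-1` B))%E.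
Proof.
move=> ij mA mB; rewrite !gaussian_coord_law//.
have := law (B := fun k => if k == i then A else if k == j then B else setT).
rewrite (bigD1 i)//= eqxx (bigD1 j)//=; last by rewrite eq_sym.
rewrite eqxx [j == i]eq_sym (negbTE ij) big1; last first.
  by move=> k /andP[/negbTE -> /negbTE ->]; rewrite probability_setT.
rewrite mule1 => <-; last by move=> k; case: ifP => // _; case: ifP.
congr (P _); apply/seteqP; split=> w /=.
  by move=> [Aw Bw] k; case: eqP => [->//|_]; case: eqP => [->|].
move=> H; split; first by have := H i; rewrite eqxx.
by have := H j; rewrite eq_sym (negbTE ij) eqxx.
Qed.

Lemma ge0_integral_gaussian_coord i (f : R -> \bar R) : measurable_fun setT f ->
  (forall x, 0 <= f x)%E ->
  (\int[P]_w f (xi w i 0%R) = \int[normal_prob 0 s]_x f x)%E.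
Proof.
move=> mf f0.
have mX : measurable_fun setT ((fun w => xi w i 0) : T -> measurableTypeR R).
  exact: mcoord.
pose X : {mfun T >-> measurableTypeR R} :=
  HB.pack (fun w => xi w i 0) (isMeasurableFun.Build _ _ _ _ _ mX).
have := @ge0_integral_distribution _ _ T _ R P X f mf f0; rewrite /= => <-.
have H A : measurable A -> A `<=` setT -> distribution P X A = normal_prob 0 s A.
  by move=> mA _; exact: gaussian_coord_law.
exact (@eq_measure_integral _ _ R setT (normal_prob 0 s) (distribution P X) f H).
Qed.

(** The moments are left unevaluated: for the estimates the second has to be positive and finite,
    the fourth finite. *)
Definition gauss_moment (n : nat) : R := fine (normal_moment n (1 : R)).

Lemma normal_momentE n : n \in [:: 2; 4]%N ->
  normal_moment n s = (s ^+ n * gauss_moment n)%:E.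
Proof.
rewrite !inE => n24; rewrite normal_moment_scale//; last by case/orP: n24 => /eqP->.
rewrite EFinM fineK// ge0_fin_numE.
  by case/orP: n24 => /eqP->; [exact: normal_moment2_lty|exact: normal_moment4_lty].
apply: integral_ge0 => x _; rewrite lee_fin.
by case/orP: n24 => /eqP->; rewrite exprn_even_ge0.
Qed.

Lemma gaussian_coord_moment i n : n \in [:: 2; 4]%N ->
  integrable (fun w => xi w i 0 ^+ n) /\
  (\int[P]_w (xi w i 0 ^+ n) = s ^+ n * gauss_moment n)%R.
Proof.
move=> n24; have n0 (x : R) : 0 <= x ^+ n.
  by move: n24; rewrite !inE => /orP[] /eqP->; rewrite exprn_even_ge0.
have E : (\int[P]_w (xi w i 0%R ^+ n)%:E = (s ^+ n * gauss_moment n)%:E)%E.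
  rewrite -normal_momentE//.
  exact: (ge0_integral_gaussian_coord i (@measurable_expr_EFin R n)).
split; last by rewrite /Rintegral E.
apply/integrableP; split; first by apply/measurable_EFinP; exact: measurable_funX.
by under eq_integral do rewrite /= ger0_norm//; rewrite E ltry.
Qed.

Lemma integrable_gaussian_coord i : integrable (fun w => xi w i 0).
Proof.
have [i2 _] := gaussian_coord_moment i (n := 2%N) isT.
have i1 : integrable (fun w => 1 + xi w i 0 ^+ 2).
  have ic : integrable (cst 1).
    by apply: (@integrable_bounded _ _ _ _ _ 1) => // w; rewrite normr1.
  exact: (integrableD measurableT ic i2).
apply: le_integrable i1 => //; first exact/measurable_EFinP.
move=> w _ /=; rewrite lee_fin; apply: le_trans (ler_norm _).
have := sqr_ge0 (`|xi w i 0| - 1); rewrite -[xi w i 0 ^+ 2]real_normK ?num_real//.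
have := normr_ge0 (xi w i 0); have := sqr_ge0 (`|xi w i 0|).
by move: `|_| => x *; lra.
Qed.

Lemma mean_gaussian_coord i : (\int[P]_w (xi w i 0) = 0)%R.
Proof.
have mpos : measurable_fun setT (fun x : R => (Num.max x 0)%:E).
  by apply/measurable_EFinP; exact: measurable_maxr.
have mneg : measurable_fun setT (fun x : R => (Num.max (- x) 0)%:E).
  by apply/measurable_EFinP; apply: measurable_maxr => //; exact: measurableT_comp.
rewrite /Rintegral integralE.
have -> : (\int[P]_w (fun w => (xi w i 0%R)%:E)^\+ w = \int[P]_w (Num.max (xi w i 0%R) 0)%:E)%E.
  by apply: eq_integral => w _; rewrite funeposE EFin_max.
have -> : (\int[P]_w (fun w => (xi w i 0%R)%:E)^\- w = \int[P]_w (Num.max (- xi w i 0%R) 0)%:E)%E.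
  by apply: eq_integral => w _; rewrite funenegE EFin_max.
rewrite (ge0_integral_gaussian_coord i mpos); last first.
  by move=> x; rewrite lee_fin le_max lexx orbT.
rewrite (ge0_integral_gaussian_coord i mneg); last first.
  by move=> x; rewrite lee_fin le_max lexx orbT.
rewrite normal_prob_pos_neg// subee//.
rewrite -(ge0_integral_gaussian_coord i mneg); last first.
  by move=> x; rewrite lee_fin le_max lexx orbT.
have := integrable_funeneg measurableT (integrable_gaussian_coord i).
move=> /(integrable_fin_num measurableT); congr (_ \is a _).
by apply: eq_integral => w _; rewrite funenegE EFin_max.
Qed.

Lemma mean_gaussian_coordM i j :
  integrable (fun w => xi w i 0 * xi w j 0) /\
  (\int[P]_w (xi w i 0 * xi w j 0) = if i == j then s ^+ 2 * gauss_moment 2 else 0)%R.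
Proof.
have [<-|ij] := eqVneq i j.
  have [i2 m2] := gaussian_coord_moment i (n := 2%N) isT.
  split; last exact: m2.
  by apply: eq_integrable i2.
have [iM ->] := mean_independent (integrable_gaussian_coord i)
  (integrable_gaussian_coord j) (fun A B => gaussian_coord_indep ij).
by split=> //; rewrite mean_gaussian_coord mul0r.
Qed.

End gaussian_vector.

Lemma gauss_moment2_gt0 (R : realType) : 0 < gauss_moment R 2.
Proof.
by rewrite fine_gt0// normal_moment2_gt0 normal_moment2_lty.
Qed.

(** * Immediate exit from 0 *)

Lemma continuous_enorm (R : realType) (f : R -> 'cV[R]_3) :
  continuous f -> continuous (fun t => enorm (f t)).
Proof.
move=> cf t; apply: (cvg_comp (fun s => \sum_i f s i 0 ^+ 2) Num.sqrt); last first.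
  exact: sqrt_continuous.
apply: cvg_big => [|i _]; first exact: add_continuous.
have ci := continuous_coord (i := i) cf.
exact (cvg_comp (fun s => f s i 0) (fun y => y ^+ 2) (ci t) (@exprn_continuous R 2 _)).
Qed.

Lemma enorm_eq0 (R : realType) (x : 'cV[R]_3) : enorm x = 0 -> x = 0.
Proof.
move=> x0; apply/matrixP => i j; rewrite ord1 mxE; apply/eqP.
by rewrite -normr_le0 -x0 coord_le_enorm.
Qed.

Lemma enorm0 (R : realType) : enorm (0 : 'cV[R]_3) = 0.
Proof. by rewrite /enorm big1 ?sqrtr0// => i _; rewrite mxE expr0n. Qed.

Lemma dispersionE (R : realType) (mu : R) (u : 'cV[R]_3) h :
  (dispersion mu *m u) h 0 = 2 * (u h 0 + (mu ^+ 2)^-1 * \sum_j u j 0).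
Proof.
rewrite mxE mulrDr !mulr_sumr (bigD1 h)//= [in RHS](bigD1 h)//= !mxE eqxx.
rewrite [RHS]addrA; congr (_ + _); first by rewrite mulr1n; ring.
by apply: eq_bigr => j jh; rewrite !mxE eq_sym (negbTE jh) add0r; ring.
Qed.

Lemma driver_increment (R : realType) (x0 b u v : 'cV[R]_3) (M : 'M[R]_3) s t h :
  (x0 + t *: b + M *m u) h 0 - (x0 + s *: b + M *m v) h 0 =
  (t - s) * b h 0 + (M *m (u - v)) h 0.
Proof.
by rewrite mulmxBr; move: (M *m u) (M *m v) => u' v'; rewrite !mxE; ring.
Qed.

Section leaving_zero.
Variables (R : realType) (p mu : R) (b : 'cV[R]_3).
Hypotheses (p1 : 1 <= p) (mu0 : 0 < mu).

(* A path that stays at 0 has a nondecreasing regulator, so that the driving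
   noise cannot push all coordinates upwards faster than the drift. *)
Lemma stays_at_zero_increment (x W : R -> 'cV[R]_3) (x0 : 'cV[R]_3) C s t :
  reflection_pair p mu (fun t => x0 + t *: b + dispersion mu *m W t) x ->
  0 <= s -> s < t -> x s = 0 -> x t = 0 -> (forall i, `|b i 0| <= C) ->
  ~ forall i, C * (t - s) < (W t - W s) i 0.
Proof.
move=> [_ _ _ inc _] s0 st xs xt bC H.
have C0 : 0 <= C by exact: le_trans (bC 0).
have := inc ord0 s t s0 (ltW st); rewrite xs xt lerD2l lerN2 -subr_le0.
rewrite driver_increment dispersionE => H1.
have ts : 0 < t - s by rewrite subr_gt0.
have Cts : 0 <= C * (t - s) by rewrite mulr_ge0// ltW.
have sum0 : 0 <= (mu ^+ 2)^-1 * \sum_j (W t - W s) j 0.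
  rewrite mulr_ge0 ?invr_ge0 ?sqr_ge0// sumr_ge0// => j _.
  by rewrite ltW// (le_lt_trans Cts).
have bt : - (C * (t - s)) <= (t - s) * b ord0 0.
  rewrite -mulNr mulrC ler_wpM2l ?(ltW ts)//.
  by have := bC ord0; rewrite ler_norml => /andP[].
have key (a B c e : R) : a + 2 * (e + c) <= 0 -> 0 <= c -> - B <= a ->
  0 <= B -> B < e -> False by move=> *; lra.
exact: key H1 sum0 bt Cts (H ord0).
Qed.

End leaving_zero.

Section stay.
Variables (R : realType) (d : measure_display) (T : measurableType d).
Variables (P : probability T R) (z : T -> R -> 'cV[R]_3).
Hypothesis Dz : gaussian_driver P z.

Definition no_jump (C h : R) (n : nat) : set (R -> 'cV[R]_3) :=
  \bigcap_(k < n) ~` increment_set (k%:R * h) (k.+1%:R * h) (fun=> [set x | C * h < x]).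

Lemma measurable_increment_set (s t u : R) (B : 'I_3 -> set R) :
  (forall i, measurable (B i)) -> 0 <= s <= u -> 0 <= t <= u ->
  <<s cylinder_generators `[0, u] >> (increment_set s t B).
Proof.
move=> mB su tu; rewrite (_ : increment_set _ _ _ = \bigcap_(i : 'I_3)
      ((fun f : cylinderType `[0, u] => f t i 0 - f s i 0) @^-1` B i)).
  apply: (@fin_bigcap_measurable _ (cylinderType `[0, u])) => // i _.
  rewrite -[X in measurable X]setTI.
  by apply: measurable_funB => //; apply: measurable_eval_coord; rewrite /= in_itv.
apply/seteqP; split=> f Hf i; first by move=> _; have := Hf i; rewrite !mxE.
by rewrite !mxE; exact: Hf.
Qed.

Lemma measurable_no_jump (C h : R) n : 0 <= h -> measurable (z @^-1` no_jump C h n).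
Proof.
move=> h0; have mB : measurable [set x : R | C * h < x].
  rewrite (_ : [set x | _] = `](C * h), +oo[%classic)//.
  by apply/seteqP; split=> x /=; rewrite in_itv/= andbT.
rewrite /no_jump -setC_bigcup -preimage_setC preimage_bigcup; apply: measurableC.
apply: bigcup_measurable => k kn; rewrite -[X in measurable X]setTI.
apply: (measurable_cylinder_map (I := `[0, k.+1%:R * h]%classic)) => //.
  by move=> t; rewrite /= in_itv/= => /andP[t0 _]; apply: Dz.1.
by apply: measurable_increment_set => //; rewrite mulr_ge0//= ler_wpM2r// ler_nat.
Qed.

(** Cells are independent, and each has its jump with probability [q ^+ 3], one factor per
    coordinate. As [h <= 1], the threshold [C * h] is below [C] times the standard deviation
    [Num.sqrt h], so [tail_bound C] bounds [q] from below whatever [h]. *)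
Lemma no_jump_prob (C h : R) n : 0 <= C -> 0 < h <= 1 ->
  (P (z @^-1` no_jump C h n) <= ((1 - tail_bound C ^+ 3) ^+ n)%:E)%E.
Proof.
move=> C0 /andP[h0 h1].
have mB : measurable [set x : R | C * h < x].
  rewrite (_ : [set x | _] = `](C * h), +oo[%classic)//.
  by apply/seteqP; split=> x /=; rewrite in_itv/= andbT.
pose q := fine (normal_prob 0 (Num.sqrt h) [set x : R | C * h < x]).
have qE : normal_prob 0 (Num.sqrt h) [set x : R | C * h < x] = q%:E.
  by rewrite fineK// fin_num_measure.
have q1 : q <= 1 by rewrite -lee_fin -qE; exact: probability_le1.
have tq : tail_bound C <= q.
  rewrite -lee_fin -qE; have sh0 : 0 < Num.sqrt h by rewrite sqrtr_gt0.
  apply: (le_trans (normal_prob_tail C0 sh0)); apply: le_measure; rewrite ?inE//.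
    rewrite (_ : [set x | _] = `](C * Num.sqrt h), +oo[%classic)//.
    by apply/seteqP; split=> x /=; rewrite in_itv/= andbT.
  move=> x /=; apply: le_lt_trans; rewrite ler_wpM2l//.
  rewrite -{1}(sqr_sqrtr (ltW h0)) expr2 ler_piMr ?sqrtr_ge0//.
  by rewrite -sqrtr1 ler_wsqrtr.
have t0 := tail_bound_gt0 C.
have q30 : 0 <= q ^+ 3 <= 1.
  have q0 : 0 <= q by rewrite (le_trans (ltW t0)).
  by rewrite exprn_ge0//= exprn_ile1.
have tq3 : tail_bound C ^+ 3 <= q ^+ 3.
  by rewrite lerXn2r ?nnegrE ?(ltW t0)// (le_trans (ltW t0)).
elim: n => [|n IH]; first by rewrite /no_jump bigcap_mkord big_ord0 preimage_setT probability_setT.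
pose A := no_jump C h n.
pose I := increment_set (n%:R * h) (n.+1%:R * h) (fun=> [set x : R | C * h < x]).
have AI : no_jump C h n.+1 = A `&` ~` I.
  by rewrite /A /no_jump !bigcap_mkord big_ord_recr.
have mA : <<s cylinder_generators `[0, n%:R * h] >> A.
  have -> : A = ~` \bigcup_(k < n) increment_set (k%:R * h) (k.+1%:R * h)
      (fun=> [set x : R | C * h < x]) by rewrite /A /no_jump setC_bigcup.
  apply: (@measurableC _ (cylinderType `[0, n%:R * h])).
  apply: (@bigcup_measurable _ (cylinderType `[0, n%:R * h])) => k kn.
  by apply: measurable_increment_set => //; rewrite mulr_ge0 ?(ltW h0)//= ler_pM2r// ler_nat// ltnW.
have pre I' A' : (forall t, I' t -> 0 <= t) -> <<s cylinder_generators I' >> A' ->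
    measurable (z @^-1` A').
  move=> I0 mA'; rewrite -[X in measurable X]setTI.
  by apply: (measurable_cylinder_map (I := I')) => // t It; apply: Dz.1; exact: I0.
have mzA : measurable (z @^-1` A).
  by apply: pre mA => t; rewrite /= in_itv/= => /andP[].
have mzI : measurable (z @^-1` I).
  apply: (pre `[0, n.+1%:R * h]%classic) => [t|]; first by rewrite /= in_itv/= => /andP[].
  by apply: measurable_increment_set => //; rewrite mulr_ge0 ?(ltW h0)//= ler_pM2r// ler_nat.
rewrite AI preimage_setI -preimage_setC -setDE measureD//; last first.
  by rewrite (le_lt_trans (probability_le1 _ mzA)) ?ltry.
have hE : n.+1%:R * h - n%:R * h = h by rewrite -mulrBl -natrB// subSnn mul1r.
have nh0 : 0 <= n%:R * h by rewrite mulr_ge0// ltW.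
have nh1 : n%:R * h < n.+1%:R * h by rewrite ltr_pM2r// ltr_nat.
have AIE := Dz.2 _ _ A _ nh0 nh1 mA (fun=> mB).
rewrite [X in (_ - X <= _)%E]AIE hE big_const card_ord/= qE mule1 -!EFinM.
have Afin : P (z @^-1` A) \is a fin_num by exact: fin_num_measure.
have : fine (P (z @^-1` A)) <= (1 - tail_bound C ^+ 3) ^+ n.
  by rewrite -lee_fin fineK.
have PA0 : 0 <= fine (P (z @^-1` A)) by rewrite fine_ge0.
rewrite -(fineK Afin) -EFinM -EFinB lee_fin [_ ^+ n.+1]exprSr /= => H.
have -> : fine (P (z @^-1` A)) - fine (P (z @^-1` A)) * (q * (q * q)) =
  fine (P (z @^-1` A)) * (1 - q ^+ 3) by ring.
case/andP: q30 => q30 q31.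
by apply: ler_pM => //; rewrite ?subr_ge0// lerD2l lerN2.
Qed.

End stay.

Section start_at_zero.
Variables (R : realType) (p mu : R) (b : 'cV[R]_3).
Hypotheses (p1 : 1 <= p) (mu0 : 0 < mu).
Variables (d : measure_display) (T : measurableType d).
Variables (P : probability T R) (X : R -> T -> 'cV[R]_3).

Lemma solution_leaves_zero (e : R) : solution p mu b P X -> 0 < e <= 1 ->
  {ae P, forall w, exists2 t, 0 <= t <= e & X t w <> 0}.
Proof.
move=> [cX [W [gamma [lam [BW _ [_ mgamma] indep eqE]]]]] /andP[e0 e1].
have Dz := gaussian_driver_solution cX BW indep.
pose C : R := \sum_i `|b i 0|.
have C0 : 0 <= C by rewrite sumr_ge0.
have bC i : `|b i 0| <= C by rewrite /C (bigD1 i)//= lerDl sumr_ge0.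
pose q := 1 - tail_bound C ^+ 3.
(* The interval from 0 to [e] consists of [n.+1] cells of this mesh, and the bound per cell does not
   depend on [n], so the probability of no jump is at most [q ^+ n.+1]. *)
pose h n : R := e / n.+1%:R.
have h01 n : 0 < h n <= 1.
  rewrite /h divr_gt0//= ler_pdivrMr// mul1r (le_trans e1)// -[leLHS]/(1%:R).
  by rewrite ler_nat.
pose B := \bigcap_n driver X W @^-1` no_jump C (h n) n.+1.
have mBn n : measurable (driver X W @^-1` no_jump C (h n) n.+1).
  by apply: (measurable_no_jump Dz); case/andP: (h01 n) => /ltW.
have mB : measurable B by exact: bigcapT_measurable.
(* Nonnegativity of [q] is read off from a single cell, where [q] bounds a probability. *)
have q01 : 0 <= q < 1.
  have := no_jump_prob Dz 1%N C0 (h01 0%N); rewrite expr1 -/q => H.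
  rewrite -lee_fin (le_trans (measure_ge0 _ _) H)/= /q gtrBl.
  by rewrite exprn_gt0// tail_bound_gt0.
have B0 : P B = 0%E.
  apply/eqP; rewrite eq_le measure_ge0 andbT; apply/lee_addgt0Pr => r r0.
  rewrite add0e; have [N _ NP] := near_expr_lt q01 r0.
  apply: (@le_trans _ _ (P (driver X W @^-1` no_jump C (h N) N.+1))).
    by apply: le_measure; rewrite ?inE// => w; apply.
  apply: (le_trans (no_jump_prob Dz N.+1 C0 (h01 N))); rewrite lee_fin -/q.
  by apply/ltW/NP; rewrite /=.
have aeB : {ae P, forall w, ~ B w}.
  by exists B; split=> // w /= nB; apply: contrapT.
have [[_ cW] W0 _ _] := BW.
apply: filterS3 aeB W0 eqE => w nBw W0w eqw.
have pair := equation_E_reflection_pair p1 mu0 eqw W0w (cX.2 w) (cW w) (mgamma w).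
apply: contrapT => H; apply: nBw => n _ /= k kn.
have stay t : 0 <= t <= e -> X t w = 0.
  by move=> te; apply: contrapT => Xt; apply: H; exists t.
have /andP[hn0 _] := h01 n.
have kh0 : 0 <= k%:R * h n by rewrite mulr_ge0// ltW.
have khe : k.+1%:R * h n <= e.
  rewrite /h mulrA ler_pdivrMr// [leLHS]mulrC ler_pM2l// ler_nat.
  exact: kn.
have khk : k%:R * h n < k.+1%:R * h n by rewrite ltr_pM2r// ltr_nat.
have hE : k.+1%:R * h n - k%:R * h n = h n by rewrite -mulrBl -natrB// subSnn mul1r.
have X1 : X (k%:R * h n) w = 0 by apply: stay; rewrite kh0 (le_trans (ltW khk)).
have X2 : X (k.+1%:R * h n) w = 0 by apply: stay; rewrite khe andbT (le_trans kh0)// ltW.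
have nI := stays_at_zero_increment pair kh0 khk X1 X2 bC.
have := increment_set_driver X W (k%:R * h n) (k.+1%:R * h n) (fun=> [set x | C * h n < x]).
move=> /seteqP[/(_ w) sub _] /sub /= inc; apply: nI => i; rewrite hE.
exact: inc.
Qed.

Lemma hit_sphere_cvg0 w : {within `[0, +oo[, continuous (fun t => X t w)} ->
  X 0 w = 0 ->
  (forall n : nat, exists2 t, 0 <= t <= n.+1%:R^-1 & X t w <> 0) ->
  hit_sphere X delta w @[delta --> 0^'+] --> 0%E.
Proof.
move=> cX X0 leave A A0.
have /nbhs_ballP[e /= e0 eA] : nbhs (0 : R) (fun x => A x%:E) by exact: A0.
have [n ne] : exists n : nat, n.+1%:R^-1 < e.
  exists (Num.truncn e^-1).
  by rewrite -[ltRHS]invrK ltf_pV2 ?posrE ?invr_gt0// truncnS_gt.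
have [t /andP[t0 tn] Xt] := leave n.
have r0 : 0 < enorm (X t w).
  rewrite lt_neqAle sqrtr_ge0 andbT eq_sym; apply/eqP => /enorm_eq0 XT.
  exact: Xt.
have cN := continuous_enorm (continuous_max0 cX).
have : \forall delta \near 0^'+, A (hit_sphere X delta w); last by [].
near=> delta.
have d0 : 0 < delta by [].
have dr : delta <= enorm (X t w) by near: delta; exact: nbhs_right_le.
have [||s] := @IVT R (fun t => enorm (X (Num.max 0 t) w)) 0 t delta t0.
- exact: continuous_subspaceT.
- rewrite max_r ?lexx// X0 enorm0 max_r// min_l ?(ltW r0)// max_r ?(ltW r0)//.
  by rewrite (ltW d0).
rewrite in_itv/= => /andP[s0 st]; rewrite max_r// => Xs.
have le_s : (hit_sphere X delta w <= s%:E)%E.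
  by apply: ereal_inf_lbound; exists s.
have ge0 : (0 <= hit_sphere X delta w)%E.
  by apply: le_ereal_inf_tmp => _ [u [u0 _] <-]; rewrite lee_fin.
have fin : hit_sphere X delta w \is a fin_num.
  by rewrite ge0_fin_numE// (le_lt_trans le_s)// ltry.
rewrite -(fineK fin); apply: eA; rewrite /ball/= sub0r normrN ger0_norm ?fine_ge0//.
rewrite (le_lt_trans _ ne)// (le_trans _ tn)// (le_trans _ st)//.
by rewrite -lee_fin fineK.
Unshelve. all: by end_near. Qed.

Lemma solution_hit_sphere : solution p mu b P X -> starts_at P X 0 ->
  {ae P, forall w, hit_sphere X delta w @[delta --> 0^'+] --> 0%E}.
Proof.
move=> sol X0.
have leave n : {ae P, forall w, exists2 t, 0 <= t <= n.+1%:R^-1 & X t w <> 0}.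
  apply: solution_leaves_zero => //; rewrite invr_gt0 ltr0n/=.
  by rewrite invf_le1// ler1n.
have {}leave : {ae P, forall w n, exists2 t, 0 <= t <= n.+1%:R^-1 & X t w <> 0}.
  exact/ae_foralln.
apply: filterS2 X0 leave => w X0w; apply: hit_sphere_cvg0 => //.
by case: sol => -[_ cX] _; exact: cX.
Qed.

End start_at_zero.

(** * The logarithmic barrier and its expansion *)

Section log_barrier.
Variable R : realType.
Implicit Types e r s k : R.

(** The difference of the two sides has its minimum at [u = 0]: the sign of its derivative reduces
    to [1 <= (1 - k) * (1 + 2 * k)], true for [k <= 2^-1]. The quadratic coefficient can be taken as
    close to one half as desired, which the strict threshold on [mu] will require. *)
Lemma ln1D_ge (k u : R) : k <= 2^-1 -> `|u| <= k ->
  u - (2^-1 + k) * u ^+ 2 <= ln (1 + u).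
Proof.
move=> k2 uk; have k0 : 0 <= k by exact: le_trans uk.
pose f (x : R) : R := ln x - (x - 1) + (2^-1 + k) * (x - 1) ^+ 2.
pose df (x : R) : R := x^-1 - 1 + (2^-1 + k) * (2 * (x - 1)).
have pos x : 1 - k <= x -> 0 < x by move: k2; clear => *; lra.
have fD x : 1 - k <= x -> is_derive x 1 f (df x).
  move=> kx; have Dl := is_derive1_ln (pos _ kx).
  apply: is_derive_eq; rewrite subr0; congr (_ + _).
  by rewrite /GRing.scale/=; ring.
have fC a c : 1 - k <= a -> {within `[a, c], continuous f}.
  move=> ka; apply: derivable_within_continuous => x; rewrite in_itv/= => /andP[ax _].
  by have [] := fD x (le_trans ka ax).
have f1 : f 1 = 0 by rewrite /f subrr ln1 expr0n/= mulr0 subr0 addr0.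
have sgn x : 1 - k <= x -> 0 <= (x - 1) * df x.
  move=> kx; have x0 := pos _ kx.
  have -> : (x - 1) * df x = (x - 1) ^+ 2 * ((1 + 2 * k) - x^-1).
    by rewrite /df; field; rewrite gt_eqF.
  rewrite mulr_ge0 ?sqr_ge0// subr_ge0 -div1r ler_pdivrMr//.
  have h0 : 0 <= 2^-1 - k by rewrite subr_ge0.
  have h1 : 0 <= 1 + 2 * k by move: k0; clear => *; lra.
  have := mulr_ge0 k0 h0; have h2 : 0 <= x - (1 - k) by rewrite subr_ge0.
  by have := mulr_ge0 h1 h2; clear; nra.
suff : 0 <= f (1 + u) by rewrite /f [1 + u - 1]addrC addKr; move: (ln _) (_ * _); clear => a c; lra.
have /andP[ku uk'] : - k <= u <= k by rewrite -ler_norml.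
have [u0|u0] := leP 0 u.
  have le1 : 1 <= 1 + u by rewrite lerDl.
  have k1 : 1 - k <= 1 by rewrite gerBl.
  have [x|x] := @MVT_segment _ f df _ _ le1 _ (fC _ _ k1).
    by rewrite in_itv/= => /andP[x1 _]; apply: fD; rewrite (le_trans k1)// ltW.
  rewrite in_itv/= => /andP[x1 _]; rewrite f1 subr0 => ->.
  have [->|xn] := eqVneq x 1; first by rewrite /df subrr invr1 subrr !mulr0 addr0 mul0r.
  rewrite mulr_ge0//; last by rewrite subr_ge0.
  have x10 : 0 < x - 1 by rewrite subr_gt0 lt_neqAle eq_sym xn.
  by rewrite -(pmulr_rge0 _ x10) sgn// (le_trans k1).
have le1 : 1 + u <= 1 by rewrite gerDl ltW.
have k1 : 1 - k <= 1 + u by rewrite lerD2l.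
have [x|x] := @MVT_segment _ f df _ _ le1 _ (fC _ _ k1).
  by rewrite in_itv/= => /andP[x1 _]; apply: fD; rewrite (le_trans k1)// ltW.
rewrite in_itv/= => /andP[ux x1]; rewrite f1 sub0r => /(congr1 (@GRing.opp R)).
rewrite opprK => ->; rewrite oppr_ge0 mulr_le0_ge0// ?subr_ge0//.
have [->|xn] := eqVneq x 1; first by rewrite /df subrr invr1 subrr !mulr0 addr0.
have x10 : x - 1 < 0 by rewrite subr_lt0 lt_neqAle xn.
by rewrite -(nmulr_rge0 _ x10) sgn// (le_trans k1).
Qed.

(** A regularization of [- ln r]: the first logarithm makes it nonnegative, [e] makes it bounded,
    and its value at [r = e] tends to infinity as [e] tends to 0. *)
Definition log_barrier e r := ln (1 + r) - ln (e + r).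

Lemma log_barrier_anti e r s : 0 < e < 1 -> 0 <= r -> r <= s ->
  log_barrier e s <= log_barrier e r.
Proof.
move=> /andP[e0 e1] r0 rs; have s0 := le_trans r0 rs.
have pos (a c : R) : 0 < a -> 0 <= c -> a + c \is Num.pos by move=> *; rewrite posrE ltr_wpDr.
rewrite /log_barrier lerBlDr addrAC lerBrDr -!lnM ?pos//.
rewrite ler_ln ?posrE ?mulr_gt0 -?posrE ?pos//.
have : 0 <= (1 - e) * (s - r) by rewrite mulr_ge0// subr_ge0// ltW.
by clear; nra.
Qed.

Lemma log_barrier_ge0 e r : 0 < e < 1 -> 0 <= r -> 0 <= log_barrier e r.
Proof.
move=> /andP[e0 e1] r0; rewrite subr_ge0 ler_ln ?posrE ?ltr_wpDr//.
by rewrite lerD2r ltW.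
Qed.

Lemma log_barrier_le e r : 0 < e < 1 -> 0 <= r -> log_barrier e r <= e^-1.
Proof.
move=> /[dup] e01 /andP[e0 e1] r0; apply: (le_trans (log_barrier_anti e01 (lexx 0) r0)).
rewrite /log_barrier !addr0 ln1 sub0r -lnV ?posrE//.
by rewrite ltW// ln_sublinear// invr_gt0.
Qed.

(** The logarithms are treated differently: concavity bounds the one in [1 + r] by its tangent,
    while the one in [e + r] enters negatively and needs the second-order bound [ln1D_ge]. *)
Lemma log_barrier_step e r s k : 0 < e < 1 -> 0 <= r -> k <= 2^-1 ->
  `|s| <= k * (e + r) ->
  log_barrier e (r + s) <= log_barrier e r + ((1 + r)^-1 - (e + r)^-1) * s +
    (2^-1 + k) * (s / (e + r)) ^+ 2.
Proof.
move=> /andP[e0 e1] r0 k2 sk.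
have er0 : 0 < e + r by rewrite ltr_wpDr.
have r10 : 0 < 1 + r by rewrite ltr_wpDr.
have ser : `|s / (e + r)| <= k by rewrite normrM normfV (gtr0_norm er0) ler_pdivrMr.
have s1 a : e + r <= a -> 0 < 1 + s / a.
  move=> ea; have a0 := lt_le_trans er0 ea.
  suff : `|s / a| <= 2^-1 by rewrite ler_norml => /andP[+ _]; move: (s / a); clear => *; lra.
  rewrite normrM normfV (gtr0_norm a0) ler_pdivrMr// (le_trans sk)//.
  rewrite (le_trans (_ : _ <= 2^-1 * (e + r)))//.
    by rewrite ler_wpM2r// ltW.
  by rewrite ler_wpM2l.
have split a : 0 < a -> 0 < 1 + s / a -> ln (a + s) = ln a + ln (1 + s / a).
  by move=> a0 sa; rewrite -lnM ?posrE// mulrDr mulr1 mulrC divfK ?gt_eqF.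
have er1 : e + r <= 1 + r by rewrite lerD2r ltW.
rewrite /log_barrier !addrA !split ?s1//.
have := ln1D_ge k2 ser.
have : ln (1 + s / (1 + r)) <= s / (1 + r).
  by apply: le_ln1Dx; rewrite -subr_gt0 opprK addrC s1.
rewrite mulrBl ![_^-1 * s]mulrC.
move: (ln (1 + r)) (ln (e + r)) (ln (1 + s / (1 + r))) (ln (1 + s / (e + r))).
by move: (s / (1 + r)) (s / (e + r)) (_ * _) => *; lra.
Qed.

End log_barrier.

Definition dot (R : realType) (x y : 'cV[R]_3) : R := \sum_i x i 0 * y i 0.

Definition sqn (R : realType) (x : 'cV[R]_3) : R := \sum_i x i 0 ^+ 2.

Section square_norm.
Variable R : realType.
Implicit Types x y d : 'cV[R]_3.

Lemma sqn_ge0 x : 0 <= sqn x.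
Proof. by apply: sumr_ge0 => i _; exact: sqr_ge0. Qed.

Lemma sqnD x y : sqn (x + y) = sqn x + 2 * dot x y + sqn y.
Proof.
rewrite /sqn /dot mulr_sumr -!big_split/=; apply: eq_bigr => i _.
by rewrite mxE; ring.
Qed.

Lemma dot_young (t : R) x y : 0 < t -> `|2 * dot x y| <= t * sqn x + t^-1 * sqn y.
Proof.
move=> t0; have t00 : t != 0 by rewrite gt_eqF.
have sgn (c : R) : c ^+ 2 = 1 -> 2 * (c * dot x y) <= t * sqn x + t^-1 * sqn y.
  move=> c1; have : 0 <= t^-1 * \sum_i (t * x i 0 - c * y i 0) ^+ 2.
    by rewrite mulr_ge0 ?invr_ge0 ?(ltW t0)// sumr_ge0// => i _; exact: sqr_ge0.
  have -> : \sum_i (t * x i 0 - c * y i 0) ^+ 2 =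
      t ^+ 2 * sqn x - 2 * (t * (c * dot x y)) + sqn y.
    rewrite /sqn /dot !mulr_sumr -sumrB -big_split/=; apply: eq_bigr => i _.
    by rewrite sqrrB [(c * _) ^+ 2]exprMn c1; ring.
  have -> : t^-1 * (t ^+ 2 * sqn x - 2 * (t * (c * dot x y)) + sqn y) =
    (t * sqn x + t^-1 * sqn y) - 2 * (c * dot x y) by field.
  by rewrite subr_ge0.
rewrite ler_norml lerNl; have := sgn 1; have := sgn (- 1).
rewrite sqrrN expr1n mul1r mulN1r mulrN => /(_ erefl) h1 /(_ erefl) h2.
by rewrite h1.
Qed.

Lemma dot_sqr_le x y : dot x y ^+ 2 <= sqn x * sqn y.
Proof.
rewrite /dot /sqn !big_ord_recl !big_ord0 !addr0.
move: (x _ _) (x _ _) (x _ _) (y _ _) (y _ _) (y _ _) => a1 a2 a3 b1 b2 b3.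
rewrite -subr_ge0.
rewrite (_ : _ - _ = (a1 * b2 - a2 * b1) ^+ 2 + (a1 * b3 - a3 * b1) ^+ 2 +
  (a2 * b3 - a3 * b2) ^+ 2); last by ring.
by rewrite !addr_ge0// sqr_ge0.
Qed.

Lemma coord_sqr_le_sqn x i : x i 0 ^+ 2 <= sqn x.
Proof. by rewrite /sqn (bigD1 i)//= lerDl sumr_ge0// => j _; exact: sqr_ge0. Qed.

Lemma sqn_le x y : (forall i, 0 <= x i 0) -> (forall i, x i 0 <= y i 0) ->
  sqn x <= sqn y.
Proof.
move=> x0 xy; apply: ler_sum => i _; rewrite lerXn2r ?nnegrE//.
exact: le_trans (x0 i) (xy i).
Qed.

(* A displacement [d] that is small relative to [y] keeps [y + d] nonnegative, so
   that [y + d <= y'] increases the norm; a large one is paid by the last term. *)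
Lemma log_barrier_push (a e k : R) : 0 < a -> 0 < e < 1 -> 0 < k <= 2^-1 ->
  exists2 K, 0 <= K & forall y d y', (forall i, 0 <= y i 0) ->
    (forall i, a * sqn y <= y i 0 ^+ 2) -> e <= sqn y ->
    (forall i, 0 <= y' i 0) -> (forall i, (y + d) i 0 <= y' i 0) ->
  log_barrier e (sqn y') <= log_barrier e (sqn y) +
    ((1 + sqn y)^-1 - (e + sqn y)^-1) * (2 * dot y d + sqn d) +
    (2 + 8 * k) / (e + sqn y) ^+ 2 * dot y d ^+ 2 + K * sqn d ^+ 2.
Proof.
move=> a0 /[dup] e01 /andP[e0 e1] /andP[k0 k2].
(* Below [a * sqn y] a displacement cannot exceed any coordinate of [y]; below [k ^+ 2 / 6 * sqn y]
   it changes the square norm by at most the fraction [k] that [log_barrier_step] tolerates. *)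
pose c := Num.min a (k ^+ 2 / 6).
have c0 : 0 < c by rewrite lt_min a0 divr_gt0// exprn_gt0.
have ce0 : 0 < c * e by rewrite mulr_gt0.
(* [K1] pays for large displacements, where [sqn d] exceeds [c * e] and the barrier is at most
   [e^-1]; [K2] pays for the remainder of Young's inequality in the small case. *)
pose K1 := (e^-1 + 1) / (c * e) ^+ 2 + 2 * e^-1 / (c * e).
pose K2 := (2^-1 + k) * (1 + k^-1) / e ^+ 2.
have ie0 : 0 < e^-1 by rewrite invr_gt0.
have ik0 : 0 < k^-1 by rewrite invr_gt0.
have K10 : 0 <= K1.
  by rewrite addr_ge0// divr_ge0 ?exprn_ge0 ?(ltW ce0)// ?addr_ge0 ?mulr_ge0// ltW.
have K20 : 0 <= K2.
  by rewrite divr_ge0 ?exprn_ge0 ?(ltW e0)// mulr_ge0 ?addr_ge0// ltW.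
exists (K1 + K2); first by rewrite addr_ge0.
move=> y d y' y0 ya ey y'0 dy'.
set r := sqn y in ya ey *; set D := sqn d; set z := dot y d.
have r0 : 0 <= r by exact: sqn_ge0.
have D0 : 0 <= D by exact: sqn_ge0.
have er0 : 0 < e + r by rewrite ltr_wpDr.
have zY t : 0 < t -> `|2 * z| <= t * r + t^-1 * D by exact: dot_young.
have HE : (2 + 8 * k) / (e + r) ^+ 2 * z ^+ 2 = (2 + 8 * k) * (z / (e + r)) ^+ 2.
  by field; rewrite gt_eqF.
pose g := (e + r)^-1; pose f := (1 + r)^-1.
have g0 : 0 < g by rewrite invr_gt0.
have f0 : 0 < f by rewrite invr_gt0 ltr_wpDr.
have fg : f <= g by rewrite lef_pV2 ?posrE ?ltr_wpDr// lerD2r ltW.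
have ge' : g <= e^-1 by rewrite lef_pV2 ?posrE// lerDl.
have gr : g * r <= 1 by rewrite mulrC ler_pdivrMr// mul1r lerDr ltW.
have V0 := log_barrier_ge0 e01 r0.
rewrite HE -/g -/f; have [Dc|Dc] := leP D (c * r); last first.
  have ceD : c * e <= D by rewrite (le_trans _ (ltW Dc))// ler_pM2l.
  have s1 : - (1 + 2 * (e^-1 * D)) <= (f - g) * (2 * z + D).
    have : `|(f - g) * (2 * z + D)| <= g * (r + 2 * D).
      rewrite normrM ler_pM//.
        by rewrite ler_norml; move: f0 fg g0; clear; move: f g => u v *; apply/andP; split; lra.
      rewrite (le_trans (ler_normD _ _))// (ger0_norm D0).
      have := zY 1 ltr01; rewrite invr1 !mul1r; move: `|_|; clear => *; lra.
    rewrite ler_norml => /andP[+ _]; apply: le_trans.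
    have : g * D <= e^-1 * D by rewrite ler_wpM2r.
    move: gr; rewrite mulrDr [g * (2 * D)]mulrCA.
    by move: (g * r) (g * D) (e^-1 * D); clear => *; lra.
  have KD : e^-1 + 1 + 2 * (e^-1 * D) <= K1 * D ^+ 2.
    rewrite /K1 [leRHS]mulrDl; apply: lerD.
      rewrite mulrAC ler_pdivlMr ?exprn_gt0// ler_wpM2l ?addr_ge0 ?(ltW ie0)//.
      by rewrite lerXn2r ?nnegrE// ltW.
    rewrite mulrAC ler_pdivlMr// -!mulrA ler_wpM2l// ler_wpM2l ?(ltW ie0)//.
    by rewrite expr2 ler_wpM2l.
  have K2D : 0 <= K2 * D ^+ 2 by rewrite mulr_ge0 ?sqr_ge0.
  have Hz : 0 <= (2 + 8 * k) * (z / (e + r)) ^+ 2.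
    by rewrite mulr_ge0 ?sqr_ge0// addr_ge0// mulr_ge0// ltW.
  have V1 := log_barrier_le e01 (sqn_ge0 y').
  rewrite [(K1 + K2) * _]mulrDl; move: V0 V1 s1 KD K2D Hz.
  move: (log_barrier _ _) (log_barrier _ _) (e^-1 * D) ((f - g) * _).
  by move: (K1 * _) (K2 * _) ((2 + 8 * k) * _) e^-1; clear => *; lra.
have [Da Dk] : D <= a * r /\ D <= k ^+ 2 / 6 * r.
  by split; rewrite (le_trans Dc)// ler_wpM2r// /c ge_min lexx ?orbT.
have yd i : 0 <= (y + d) i 0.
  rewrite mxE -lerBlDl sub0r lerNl; have : `|d i 0| <= y i 0.
    rewrite -ler_sqr ?nnegrE// real_normK ?num_real//.
    by rewrite (le_trans (coord_sqr_le_sqn d i))// (le_trans Da).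
  by rewrite ler_norml lerNl => /andP[].
have := sqn_le yd dy'; rewrite sqnD -addrA -/r -/D -/z => rs.
have rs0 : 0 <= r + (2 * z + D) by rewrite addrA -sqnD sqn_ge0.
have sk : `|2 * z + D| <= k * (e + r).
  have h20 : 0 < k / 2 by rewrite divr_gt0.
  have := zY _ h20; have E : (k / 2)^-1 * (k ^+ 2 / 6 * r) = k * r / 3 by field; rewrite gt_eqF.
  have h1 : (k / 2)^-1 * D <= k * r / 3 by rewrite -E ler_wpM2l// ltW// invr_gt0.
  have h2 : D <= k * r / 12.
    rewrite (le_trans Dk)//.
    have : 0 <= k * r * (2^-1 - k) by rewrite !mulr_ge0 ?(ltW k0)// subr_ge0.
    by clear; nra.
  have ke : 0 <= k * e by rewrite mulr_ge0// ltW.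
  have kr : 0 <= k * r by rewrite mulr_ge0 // ltW.
  have := ler_normD (2 * z) D; rewrite (ger0_norm D0) mulrDr.
  rewrite [k / 2 * r]mulrAC.
  by move: kr ke h1 h2; move: `|_| `|_| (_ * D) (k * e) (k * r); clear => *; lra.
have := log_barrier_step e01 r0 k2 sk => step.
apply: (le_trans (log_barrier_anti e01 rs0 rs)); apply: (le_trans step).
rewrite -/f -/g -[leRHS]addrA lerD2l [(K1 + K2) * _]mulrDl.
suff : (2^-1 + k) * ((2 * z + D) * g) ^+ 2 <= (2 + 8 * k) * (z * g) ^+ 2 + K2 * D ^+ 2.
  have K1D : 0 <= K1 * D ^+ 2 by rewrite mulr_ge0 ?sqr_ge0.
  by move=> /le_trans; apply; rewrite lerD2l lerDr.
have k3 : 0 <= 2^-1 + k by rewrite addr_ge0// ltW.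
have gD : (D * g) ^+ 2 <= (D / e) ^+ 2.
  by rewrite lerXn2r ?nnegrE ?mulr_ge0 ?(ltW g0) ?(ltW ie0)// ler_wpM2l.
(* Young's inequality with weight [k]. The resulting coefficient [4 * (1 + k) * (2^-1 + k)] is at
   most [2 + 8 * k] because [k <= 2^-1]. *)
have young : ((2 * z + D) * g) ^+ 2 <=
    4 * (1 + k) * (z * g) ^+ 2 + (1 + k^-1) * (D * g) ^+ 2.
  rewrite mulrDl -mulrA; move: (z * g) (D * g) => u v.
  have : 0 <= k^-1 * (2 * k * u - v) ^+ 2 by rewrite mulr_ge0 ?sqr_ge0// ltW.
  have -> : k^-1 * (2 * k * u - v) ^+ 2 = 4 * k * u ^+ 2 - 4 * (u * v) + k^-1 * v ^+ 2.
    by field; rewrite gt_eqF.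
  by rewrite sqrrD; clear; nra.
apply: (le_trans (ler_wpM2l k3 young)); rewrite mulrDr; apply: lerD.
  rewrite mulrA ler_wpM2r ?sqr_ge0//.
  have : 0 <= k * (2^-1 - k) by rewrite mulr_ge0 ?(ltW k0)// subr_ge0.
  by clear; nra.
have -> : K2 * D ^+ 2 = (2^-1 + k) * ((1 + k^-1) * (D / e) ^+ 2).
  by rewrite /K2; field; rewrite !gt_eqF.
by rewrite ler_wpM2l// ler_wpM2l// addr_ge0// ltW.
Qed.

End square_norm.

Section barrier_increment.
Variables (R : realType) (mu : R) (b : 'cV[R]_3).
Let eps := (mu ^+ 2)^-1.
Let S := dispersion mu.
(** The diffusion matrix has the entries [4 * ((i == j)%:R + beta)]. As [k2 = 1 + 3 * beta], its
    largest eigenvalue is [4 * k2], on vectors with equal coordinates, and its trace is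
    [4 * (2 + k2)]. *)
Let beta := 2 * eps + 3 * eps ^+ 2.
Let k2 := (1 + 3 * eps) ^+ 2.
Implicit Types x y d xi : 'cV[R]_3.

Lemma dotDr x y d : dot x (y + d) = dot x y + dot x d.
Proof. by rewrite /dot -big_split/=; apply: eq_bigr => i _; rewrite mxE mulrDr. Qed.

Lemma dotZr (a : R) x y : dot x (a *: y) = a * dot x y.
Proof. by rewrite /dot mulr_sumr; apply: eq_bigr => i _; rewrite mxE mulrCA. Qed.

Lemma dotZl (a : R) x y : dot (a *: x) y = a * dot x y.
Proof. by rewrite /dot mulr_sumr; apply: eq_bigr => i _; rewrite mxE mulrA. Qed.

Lemma sqnZ (a : R) x : sqn (a *: x) = a ^+ 2 * sqn x.
Proof. by rewrite /sqn mulr_sumr; apply: eq_bigr => i _; rewrite mxE exprMn. Qed.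

Lemma dot_dispersion x y : dot x (S *m y) = dot (S *m x) y.
Proof.
rewrite /dot; under eq_bigr do rewrite dispersionE.
under [RHS]eq_bigr do rewrite dispersionE.
by rewrite !big_ord_recl !big_ord0; ring.
Qed.

Lemma sqn_dispersion x :
  sqn (S *m x) = \sum_i \sum_j 4 * ((i == j)%:R + beta) * (x i 0 * x j 0).
Proof.
rewrite /sqn; under eq_bigr do rewrite dispersionE -/eps.
by rewrite !big_ord_recl !big_ord0 /beta/=; ring.
Qed.

Lemma sqn_dispersion_le x : sqn (S *m x) <= 4 * k2 * sqn x.
Proof.
have eps0 : 0 <= eps by rewrite invr_ge0 sqr_ge0.
have beta0 : 0 <= beta by rewrite addr_ge0// mulr_ge0// exprn_ge0.
rewrite sqn_dispersion /sqn /k2 (_ : (1 + 3 * eps) ^+ 2 = 1 + 3 * beta); last first.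
  by rewrite /beta; ring.
rewrite !big_ord_recl !big_ord0/= !addr0 !add0r.
move: (x _ _) (x _ _) (x _ _) => u v w.
have : 0 <= beta * ((u - v) ^+ 2 + (v - w) ^+ 2 + (u - w) ^+ 2).
  by rewrite mulr_ge0// !addr_ge0// sqr_ge0.
move=> H; rewrite -subr_ge0 (_ : _ - _ =
  4 * (beta * ((u - v) ^+ 2 + (v - w) ^+ 2 + (u - w) ^+ 2))); last by ring.
by rewrite mulr_ge0.
Qed.

Lemma sqnD_le x y : sqn (x + y) <= 2 * sqn x + 2 * sqn y.
Proof.
have := dot_young x y ltr01; rewrite sqnD invr1 !mul1r ler_norml => /andP[_].
by move: (2 * dot x y) => *; lra.
Qed.

Section expansion.
Variables (e k : R).
Let g y := (e + sqn y)^-1.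
Let f y := (1 + sqn y)^-1.

(* [- (1 - e) * (f y * g y)] is the derivative of [log_barrier e] at [sqn y]. *)
Definition barrier_drift y := - (2 * (1 - e)) * (f y * (dot y b * g y)).

(** The terms in [h] are the products of drift and noise. Everything is grouped into ratios with
    [g y], each of which is bounded in [y]. *)
Definition barrier_lin h y i :=
  - (2 * (1 - e)) * (f y * ((S *m y) i 0 * g y + h * (S *m b) i 0 * g y)) +
  2 * h * (2 + 8 * k) * ((dot y b * g y) * ((S *m y) i 0 * g y)).

Definition barrier_quad y i j :=
  - (1 - e) * (4 * ((i == j)%:R + beta)) * (f y * g y) +
  (2 + 8 * k) * (((S *m y) i 0 * g y) * ((S *m y) j 0 * g y)).

Lemma barrier_lin_sum h y xi : \sum_i barrier_lin h y i * xi i 0 =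
  - (2 * (1 - e)) * (f y * g y * (dot (S *m y) xi + h * dot (S *m b) xi)) +
  2 * h * (2 + 8 * k) * (dot y b * dot (S *m y) xi * g y ^+ 2).
Proof. by rewrite /barrier_lin /dot !big_ord_recl !big_ord0; ring. Qed.

Lemma barrier_quad_sum y xi : \sum_i \sum_j barrier_quad y i j * (xi i 0 * xi j 0) =
  - (1 - e) * (f y * g y) * sqn (S *m xi) + (2 + 8 * k) * (dot (S *m y) xi * g y) ^+ 2.
Proof.
by rewrite sqn_dispersion /barrier_quad /dot !big_ord_recl !big_ord0/=; ring.
Qed.

Hypotheses (e01 : 0 < e < 1) (k0 : 0 < k <= 2^-1).

Lemma barrier_expansion (a : R) : 0 < a -> exists2 K : R, 0 <= K & forall (h : R) y xi y',
    0 < h <= 1 -> (forall i, 0 <= y i 0) -> (forall i, a * sqn y <= y i 0 ^+ 2) ->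
    e <= sqn y -> (forall i, 0 <= y' i 0) ->
    (forall i, (y + (h *: b + S *m xi)) i 0 <= y' i 0) ->
  log_barrier e (sqn y') <= log_barrier e (sqn y) + h * barrier_drift y +
    \sum_i barrier_lin h y i * xi i 0 +
    \sum_i \sum_j barrier_quad y i j * (xi i 0 * xi j 0) +
    K * h ^+ 2 + K * \sum_i xi i 0 ^+ 4.
Proof.
move=> a0; have [K0 K00 push] := log_barrier_push a0 e01 k0.
have /andP[e0 e1] := e01; have /andP[kp kh] := k0.
pose B := sqn b; have B0 : 0 <= B by exact: sqn_ge0.
(* [K1] collects the square of the drift term and the drift part of [sqn d ^+ 2]; [K2] its noise
   part. Squaring a sum costs [8], and [sqn (S *m xi) ^+ 2] is at most [16 * 3 * k2 ^+ 2] times the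
   sum of fourth powers, whence [384]. *)
pose K1 := (2 + 8 * k) * (B * e^-1) + 8 * K0 * B ^+ 2.
pose K2 := 384 * K0 * k2 ^+ 2.
have K10 : 0 <= K1.
  by rewrite addr_ge0// ?mulr_ge0 ?addr_ge0 ?sqr_ge0 ?mulr_ge0 ?invr_ge0 ?(ltW e0) ?(ltW kp).
have K20 : 0 <= K2 by rewrite mulr_ge0 ?sqr_ge0// mulr_ge0.
exists (K1 + K2); first by rewrite addr_ge0.
move=> h y xi y' /andP[h0 h1] y0 ya ey y'0 dy'.
apply: (le_trans (push _ _ _ y0 ya ey y'0 dy')).
rewrite barrier_lin_sum barrier_quad_sum /barrier_drift -/(f y) -/(g y).
set d := h *: b + S *m xi; set r := sqn y in ey *.
have r0 : 0 <= r by exact: sqn_ge0.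
have er0 : 0 < e + r by rewrite ltr_wpDr.
have zE : dot y d = h * dot y b + dot (S *m y) xi by rewrite dotDr dotZr dot_dispersion.
have DE : sqn d = h ^+ 2 * B + 2 * (h * dot (S *m b) xi) + sqn (S *m xi).
  by rewrite sqnD sqnZ dotZl dot_dispersion.
have ybB : dot y b ^+ 2 <= r * B by exact: dot_sqr_le.
pose X4 := \sum_i xi i 0 ^+ 4.
have D4 : K0 * sqn d ^+ 2 <= 8 * K0 * B ^+ 2 * h ^+ 2 + K2 * X4.
  have X40 : 0 <= X4 by apply: sumr_ge0 => i _; rewrite exprn_even_ge0.
  pose s := sqn (S *m xi); have s0 : 0 <= s by exact: sqn_ge0.
  have sX : s ^+ 2 <= 48 * k2 ^+ 2 * X4.
    have : s ^+ 2 <= (4 * k2 * sqn xi) ^+ 2.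
      by rewrite lerXn2r ?nnegrE ?(le_trans s0)// sqn_dispersion_le.
    move=> /le_trans; apply; rewrite exprMn.
    have -> : 48 * k2 ^+ 2 = (4 * k2) ^+ 2 * 3 by ring.
    rewrite -mulrA ler_wpM2l ?sqr_ge0// /sqn /X4 !big_ord_recl !big_ord0 !addr0.
    move: (xi _ _) (xi _ _) (xi _ _) => u v w.
    have : 0 <= (u ^+ 2 - v ^+ 2) ^+ 2 + (v ^+ 2 - w ^+ 2) ^+ 2 + (u ^+ 2 - w ^+ 2) ^+ 2.
      by rewrite !addr_ge0// sqr_ge0.
    move=> H; rewrite -subr_ge0; apply: le_trans H _.
    by rewrite le_eqVlt; apply/orP; left; apply/eqP; ring.
  have hB : 0 <= h ^+ 2 * B by rewrite mulr_ge0 ?sqr_ge0.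
  have Dle : sqn d <= 2 * (h ^+ 2 * B) + 2 * s by rewrite -sqnZ; exact: sqnD_le.
  have D2 : sqn d ^+ 2 <= 8 * (h ^+ 2 * B) ^+ 2 + 8 * s ^+ 2.
    apply: (@le_trans _ _ ((2 * (h ^+ 2 * B) + 2 * s) ^+ 2)).
      by rewrite lerXn2r ?nnegrE ?sqn_ge0// (le_trans (sqn_ge0 d)).
    have := sqr_ge0 (h ^+ 2 * B - s); move: (h ^+ 2 * B) => q.
    by rewrite sqrrB sqrrD !exprMn; move: (q ^+ 2) (s ^+ 2) => *; nra.
  have hB2 : (h ^+ 2 * B) ^+ 2 <= B ^+ 2 * h ^+ 2.
    rewrite exprMn mulrC ler_wpM2l ?sqr_ge0// -exprM.
    by rewrite ler_wiXn2l ?(ltW h0).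
  apply: (le_trans (ler_wpM2l K00 D2)); rewrite mulrDr; apply: lerD.
    rewrite (_ : 8 * K0 * B ^+ 2 * h ^+ 2 = K0 * (8 * (B ^+ 2 * h ^+ 2))); last by ring.
    by rewrite ler_wpM2l// ler_wpM2l.
  rewrite /K2 [leLHS]mulrCA.
  rewrite (_ : 384 * K0 * k2 ^+ 2 * X4 = 8 * (K0 * (48 * k2 ^+ 2 * X4))); last by ring.
  by rewrite ler_wpM2l// ler_wpM2l.
have ybe : (2 + 8 * k) * (dot y b * g y) ^+ 2 <= (2 + 8 * k) * (B * e^-1).
  rewrite ler_wpM2l ?addr_ge0 ?mulr_ge0 ?(ltW kp)// exprMn.
  apply: (@le_trans _ _ (r * B * g y ^+ 2)); first by rewrite ler_wpM2r ?sqr_ge0.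
  have gr : r * g y <= 1 by rewrite ler_pdivrMr// mul1r lerDr ltW.
  rewrite (_ : r * B * _ = B * (r * g y * g y)); last by ring.
  rewrite ler_wpM2l// (@le_trans _ _ (g y))//.
    by rewrite ler_piMl// invr_ge0 ltW.
  by rewrite lef_pV2 ?posrE// lerDl.
have fgE : f y - g y = - (1 - e) * (f y * g y).
  by rewrite /f /g -/r; field; rewrite !gt_eqF// ltr_wpDr.
have h2e : 0 <= h ^+ 2 * ((2 + 8 * k) * (B * e^-1) - (2 + 8 * k) * (dot y b * g y) ^+ 2).
  by rewrite mulr_ge0 ?sqr_ge0// subr_ge0.
have fgB : 0 <= (1 - e) * (f y * g y) * (h ^+ 2 * B).
  by rewrite !mulr_ge0 ?sqr_ge0// ?invr_ge0 ?subr_ge0 ?addr_ge0// ltW.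
have h0X : 0 <= K1 * X4 by rewrite mulr_ge0// sumr_ge0// => i _; rewrite exprn_even_ge0.
have hK2 : 0 <= K2 * h ^+ 2 by rewrite mulr_ge0// sqr_ge0.
have D40 : 0 <= 8 * K0 * B ^+ 2 * h ^+ 2 + K2 * X4 - K0 * sqn d ^+ 2 by rewrite subr_ge0.
have HE : (2 + 8 * k) / (e + r) ^+ 2 = (2 + 8 * k) * g y ^+ 2 by rewrite exprVn.
have K1E : K1 = (2 + 8 * k) * (B * e^-1) + 8 * K0 * B ^+ 2 by [].
rewrite -/(f y) -/(g y) fgE zE HE -/X4.
move: h2e fgB h0X hK2 D40; rewrite DE K1E.
move: (log_barrier e r) (f y) (g y) (dot y b) (dot (S *m y) xi) (dot (S *m b) xi).
move: (sqn (S *m xi)) e^-1.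
move=> s ie V F G yb q p h2e fgB h0X hK2 D40.
rewrite -subr_ge0; have := addr_ge0 (addr_ge0 (addr_ge0 h2e fgB) (addr_ge0 h0X hK2)) D40.
by move=> H; apply: le_trans H _; rewrite le_eqVlt; apply/orP; left; apply/eqP; ring.
Qed.

End expansion.

(* The strict inequality [k2 < 2] says that the trace of the diffusion matrix
   exceeds twice its largest eigenvalue, which is what makes the logarithm of the
   norm have a negative drift near the origin. *)
Lemma barrier_drift_le (m : R) : 0 < m -> k2 < 2 ->
  exists2 C : R, 0 <= C & forall (e : R) y, 0 < e < 1 ->
  barrier_drift e y + m * \sum_i barrier_quad e ((2 - k2) / 32) y i i <= C.
Proof.
move=> m0 k22; set k := (2 - k2) / 32.
pose B := sqn b; have B0 : 0 <= B by exact: sqn_ge0.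
have k20 : 0 <= k2 by exact: sqr_ge0.
(* The coefficient of [- g] left over by the quadratic part. The drift is given exactly this much by
   Young's inequality; [B + 1] instead of [B] avoids a division by 0 when [b = 0]. *)
pose l := 2 * m * (2 - k2); have l0 : 0 < l by rewrite !mulr_gt0// subr_gt0.
have B1 : 0 < B + 1 by rewrite ltr_wpDl.
exists (4 * m * (2 + k2) + (B + 1) / l).
  rewrite addr_ge0 ?divr_ge0 ?(ltW B1) ?(ltW l0)//.
  by rewrite mulr_ge0 ?addr_ge0// mulr_ge0// ltW.
move=> e y /andP[e0 e1]; pose r := sqn y; have r0 : 0 <= r by exact: sqn_ge0.
pose g := (e + r)^-1; pose f := (1 + r)^-1; pose v := dot y b * g.
have er0 : 0 < e + r by rewrite ltr_wpDr.
have r1 : 0 < 1 + r by rewrite ltr_wpDr.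
have g0 : 0 < g by rewrite invr_gt0.
have f01 : 0 < f <= 1 by rewrite invr_gt0 r1 invf_le1// lerDl.
have fgE : (1 - e) * (f * g) = g - f by rewrite /f /g; field; rewrite !gt_eqF.
have gr : r * g <= 1 by rewrite ler_pdivrMr// mul1r lerDr ltW.
have v2 : v ^+ 2 <= B * g.
  rewrite exprMn (@le_trans _ _ (r * B * g ^+ 2))//.
    by rewrite ler_wpM2r ?sqr_ge0// dot_sqr_le.
  rewrite (_ : _ * _ = B * (r * g * g)); last by ring.
  by rewrite ler_wpM2l// ler_piMl// ltW.
have drift : barrier_drift e y <= l * g + (B + 1) / l.
  have c1 : `|- (2 * (1 - e)) * f| <= 2.
    rewrite mulNr normrN ger0_norm ?mulr_ge0 ?subr_ge0 ?(ltW e1)//; last by case/andP: f01 => /ltW.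
    rewrite -[leRHS]mulr1 ler_pM ?mulr_ge0 ?subr_ge0 ?(ltW e1)//; case/andP: f01 => // /ltW//.
    by rewrite ler_piMr// gerBl ltW.
  have c2 : barrier_drift e y <= 2 * `|v|.
    rewrite /barrier_drift mulrA (le_trans (ler_norm _))// normrM ler_pM//.
  apply: (le_trans c2); have t0 : 0 < l / (B + 1) by rewrite divr_gt0.
  have : 2 * `|v| <= l / (B + 1) * `|v| ^+ 2 + (B + 1) / l.
    have : 0 <= (B + 1) / l * (l / (B + 1) * `|v| - 1) ^+ 2.
      by rewrite mulr_ge0 ?sqr_ge0// divr_ge0// ltW.
    rewrite (_ : _ * _ = l / (B + 1) * `|v| ^+ 2 + (B + 1) / l - 2 * `|v|) ?subr_ge0//.
    by move: `|v| => w; field; rewrite !gt_eqF.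
  move=> /le_trans; apply; rewrite lerD2r real_normK ?num_real//.
  have : l / (B + 1) * v ^+ 2 <= l / (B + 1) * ((B + 1) * g).
    rewrite ler_wpM2l ?(ltW t0)// (le_trans v2)// ler_wpM2r ?(ltW g0)//.
    by rewrite lerDl.
  by move=> /le_trans; apply; rewrite mulrA divfK ?gt_eqF.
have quadE : \sum_i barrier_quad e k y i i =
    - 4 * (2 + k2) * (g - f) + (2 + 8 * k) * (sqn (S *m y) * g ^+ 2).
  rewrite -fgE /barrier_quad -/r -/f -/g /sqn !big_ord_recl !big_ord0/= /k2 /beta.
  by ring.
have sg : sqn (S *m y) * g ^+ 2 <= 4 * k2 * g.
  apply: (@le_trans _ _ (4 * k2 * r * g ^+ 2)).
    by rewrite ler_wpM2r ?sqr_ge0// sqn_dispersion_le.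
  rewrite (_ : _ * _ = 4 * k2 * (r * g * g)); last by ring.
  by rewrite ler_wpM2l ?(mulr_ge0 _ k20)// ler_piMl// ltW.
(* The trace leaves a margin [4 * (2 - k2)]. The choice of [k] makes the excess
   [32 * k * k2 = (2 - k2) * k2], which uses up at most half of it. *)
have kq : (2 + 8 * k) * (sqn (S *m y) * g ^+ 2) <= (8 * k2 + 2 * (2 - k2)) * g.
  have k8 : 0 <= 2 + 8 * k by rewrite addr_ge0// mulr_ge0// divr_ge0// subr_ge0 ltW.
  apply: (le_trans (ler_wpM2l k8 sg)); rewrite mulrA ler_wpM2r ?(ltW g0)//.
  have : 0 <= (2 - k2) * (2 - k2) by exact: sqr_ge0.
  by rewrite /k; move: k20 k22; move: k2 => q *; nra.
have quad : m * \sum_i barrier_quad e k y i i <= m * (- (2 * (2 - k2)) * g + 4 * (2 + k2)).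
  rewrite ler_wpM2l ?(ltW m0)// quadE.
  have : (2 + k2) * f <= 2 + k2 by case/andP: f01 => *; rewrite ler_piMr// addr_ge0.
  move: kq; move: ((2 + 8 * k) * _); rewrite !mulrDl !mulrDr.
  by move=> *; nra.
apply: (le_trans (lerD drift quad)); rewrite /l.
rewrite -subr_ge0 (_ : _ - _ = 0)//; move: ((B + 1) / _) => c; ring.
Qed.

End barrier_increment.

(** * Means of adapted quantities against Gaussian increments *)

Section has_mean.
Variables (R : realType) (d : measure_display) (T : measurableType d).
Variable P : probability T R.
Implicit Types F G : T -> R.

(** Integrability is bundled with the value, since [Rintegral] returns a number for any function. *)
Definition has_mean F (m : R) :=
  P.-integrable setT (EFin \o F) /\ (\int[P]_w F w = m)%R.

Lemma has_meanD F G m n : has_mean F m -> has_mean G n ->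
  has_mean (fun w => F w + G w) (m + n).
Proof.
move=> [iF <-] [iG <-]; split; last by rewrite RintegralD.
exact: (integrableD measurableT iF iG).
Qed.

Lemma has_meanZ F m c : has_mean F m -> has_mean (fun w => c * F w) (c * m).
Proof.
move=> [iF <-]; split; last by rewrite RintegralZl.
exact: (integrableZl measurableT c iF).
Qed.

Lemma has_mean_cst c : has_mean (fun=> c) c.
Proof.
split; first by apply: (@integrable_bounded _ _ _ P _ `|c|).
by rewrite Rintegral_cst// [X in fine X]probability_setT mulr1.
Qed.

Lemma has_mean_sum (F : 'I_3 -> T -> R) (m : 'I_3 -> R) :
  (forall i, has_mean (F i) (m i)) -> has_mean (fun w => \sum_i F i w) (\sum_i m i).
Proof.
move=> Fm; rewrite (_ : (fun _ => _) = fun w => F ord0 w + (F (lift ord0 ord0) w +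
    F (lift ord0 (lift ord0 ord0)) w)); last first.
  by apply/funext => w; rewrite !big_ord_recl big_ord0 addr0.
by rewrite !big_ord_recl big_ord0 addr0; apply: has_meanD => //; exact: has_meanD.
Qed.

Lemma has_mean_le F G m n : has_mean F m -> has_mean G n ->
  {ae P, forall w, F w <= G w} -> m <= n.
Proof.
move=> [iF <-] [iG <-] FG; rewrite -subr_ge0 -RintegralB//.
have iGF := integrableB measurableT iG iF.
rewrite (_ : Rintegral _ _ _ = \int[P]_w `|G w - F w|)%R.
  by apply: Rintegral_ge0 => w _.
congr fine; apply: ae_eq_integral => //.
- by case/integrableP: iGF.
- apply/measurable_EFinP; apply: measurableT_comp => //; apply/measurable_EFinP.
  by case/integrableP: iGF.
by apply: filterS FG => w FGw _; rewrite ger0_norm// subr_ge0.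
Qed.

Lemma has_mean_indic (A : set T) : measurable A -> has_mean (\1_A) (fine (P A)).
Proof.
move=> mA; split; last by rewrite /Rintegral integral_indic// setIT.
apply: (@integrable_bounded _ _ _ P _ 1) => // w.
by rewrite indicE; case: (w \in A); rewrite ?normr1 ?normr0.
Qed.

End has_mean.

Section bounded_measurable.
Variables (R : realType) (T : pointedType) (U : set (set T)).
Local Notation Ut := (g_sigma_algebraType U).
Implicit Types F G : T -> R.

Definition bounded_measurable F :=
  measurable_fun setT (F : Ut -> R) /\ exists M, forall w, `|F w| <= M.

Lemma bounded_measurable_cst c : bounded_measurable (fun=> c).
Proof. by split; [exact: measurable_cst|exists `|c|]. Qed.

Lemma bounded_measurableD F G : bounded_measurable F -> bounded_measurable G ->
  bounded_measurable (fun w => F w + G w).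
Proof.
move=> [mF [M FM]] [mG [N GN]]; split; first exact: measurable_funD.
by exists (M + N) => w; rewrite (le_trans (ler_normD _ _))// lerD.
Qed.

Lemma bounded_measurableM F G : bounded_measurable F -> bounded_measurable G ->
  bounded_measurable (fun w => F w * G w).
Proof.
move=> [mF [M FM]] [mG [N GN]]; split; first exact: measurable_funM.
by exists (M * N) => w; rewrite normrM ler_pM.
Qed.

Lemma bounded_measurable_indic A : <<s U >> A -> bounded_measurable (\1_A).
Proof.
move=> mA; split; first exact: (@measurable_indic _ Ut).
by exists 1 => w; rewrite indicE; case: (w \in A); rewrite ?normr1 ?normr0.
Qed.

End bounded_measurable.

Section adapted.
Variables (R : realType) (d : measure_display) (T : measurableType d).
Variables (P : probability T R) (U : set (set T)).
Hypothesis mU : <<s U >> `<=` measurable.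
Local Notation bounded_measurable := (bounded_measurable U).
Implicit Types F G : T -> R.

Lemma bounded_measurable_mean F : bounded_measurable F -> has_mean P F (\int[P]_w F w)%R.
Proof.
move=> [mF [M FM]]; split=> //; apply: integrable_bounded FM.
move=> _ B mB; apply: mU; exact: mF.
Qed.

Variable xi : T -> 'cV[R]_3.
Hypotheses (mxi : rv3 xi) (indep : independent_systems P <<s U >> (sigma3 xi)).

(** This takes the place of conditional expectation: [F] belongs to the past, [phi] is evaluated at
    the next increment. *)
Lemma mean_mul_indep F (phi : 'cV[R]_3 -> R) m : bounded_measurable F ->
  measurable_fun setT (phi : borel3 R -> R) -> has_mean P (phi \o xi) m ->
  has_mean P (fun w => F w * phi (xi w)) ((\int[P]_w F w)%R * m).
Proof.
move=> aF mphi [iphi <-]; have [iF _] := bounded_measurable_mean aF.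
apply: mean_independent => // A B mA mB; apply: indep.
  by have := aF.1 measurableT A mA; rewrite setTI.
exists ((phi : borel3 R -> R) @^-1` B); last by rewrite setTI.
by have := mphi measurableT B mB; rewrite setTI.
Qed.

Variable s : R.
Hypothesis s0 : 0 < s.
Hypothesis law : forall B : 'I_3 -> set R, (forall i, measurable (B i)) ->
  P [set w | forall i, B i (xi w i 0)] =
  \big[*%E/1%E]_(i < 3) normal_prob 0 s (B i).

(** Linear terms have mean 0 and distinct coordinates are uncorrelated, so only the trace of the
    quadratic coefficients survives. *)
Lemma mean_gaussian_quartic (F0 : T -> R) (F1 : 'I_3 -> T -> R)
    (F2 : 'I_3 -> 'I_3 -> T -> R) (K : R) : bounded_measurable F0 ->
  (forall i, bounded_measurable (F1 i)) -> (forall i j, bounded_measurable (F2 i j)) ->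
  has_mean P (fun w => F0 w + \sum_i F1 i w * xi w i 0 +
      \sum_i \sum_j F2 i j w * (xi w i 0 * xi w j 0) + K * \sum_i xi w i 0 ^+ 4)
    ((\int[P]_w F0 w)%R + \sum_i (\int[P]_w F2 i i w)%R * (s ^+ 2 * gauss_moment R 2) +
      K * (3 * (s ^+ 4 * gauss_moment R 4))).
Proof.
move=> a0 a1 a2.
have m1 i : has_mean P (fun w => F1 i w * xi w i 0) 0.
  have m : has_mean P ((fun x => x i 0) \o xi) 0.
    split; first exact: (integrable_gaussian_coord mxi s0 law).
    exact: (mean_gaussian_coord mxi s0 law).
  by have := mean_mul_indep (a1 i) (@measurable_coord R i) m; rewrite mulr0.
have m2 i j : has_mean P (fun w => F2 i j w * (xi w i 0 * xi w j 0))
    ((\int[P]_w F2 i j w)%R * (if i == j then s ^+ 2 * gauss_moment R 2 else 0)).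
  apply: (mean_mul_indep (phi := fun x => x i 0 * x j 0)) => //.
  - by apply: measurable_funM; exact: measurable_coord.
  - exact: (mean_gaussian_coordM mxi s0 law).
have m4 i : has_mean P (fun w => xi w i 0 ^+ 4) (s ^+ 4 * gauss_moment R 4).
  exact: (gaussian_coord_moment mxi s0 law).
have := has_meanD (has_meanD (has_meanD (bounded_measurable_mean a0) (has_mean_sum m1))
  (has_mean_sum (fun i => has_mean_sum (m2 i)))) (has_meanZ K (has_mean_sum m4)).
rewrite [X in _ + X + _ + _]big1// addr0.
congr (has_mean _ _ (_ + _ + K * _)).
  apply: eq_bigr => i _; rewrite (bigD1 i)//= eqxx big1 ?addr0// => j /negbTE ji.
  by rewrite eq_sym ji mulr0.
by rewrite !big_ord_recl big_ord0; ring.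
Qed.

End adapted.

Section barrier_measurable.
Variables (R : realType) (mu : R) (b : 'cV[R]_3) (e k : R).
Hypothesis e01 : 0 < e < 1.
Local Notation bm := (bounded_measurable (open : set (set 'cV[R]_3))).
Let S := dispersion mu.

Lemma measurable_sqn : measurable_fun setT (@sqn R : borel3 R -> R).
Proof.
rewrite (_ : @sqn R = fun x => \sum_i x i 0 ^+ 2)//.
by apply: measurable_sum => i; apply: measurable_funX; exact: measurable_coord.
Qed.

Let inv_shift (a : R) : 0 < a -> bm (fun x => (a + sqn x)^-1).
Proof.
move=> a0; have pos x : 0 < a + sqn x by rewrite ltr_wpDr ?sqn_ge0.
split; last first.
  exists a^-1 => x; rewrite ger0_norm ?invr_ge0 ?(ltW (pos x))//.
  by rewrite lef_pV2 ?posrE// lerDl sqn_ge0.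
rewrite (_ : (fun _ => _) = (fun x => expR (- ln (a + sqn x)))); last first.
  by apply/funext => x; rewrite expRN lnK// posrE.
apply: measurableT_comp => //; apply: measurableT_comp => //; apply: measurableT_comp => //.
by apply: measurable_funD => //; exact: measurable_sqn.
Qed.

Let e0 : 0 < e. Proof. by case/andP: e01. Qed.

(** [phi] grows at most linearly, since [2 * |phi|] is at most [1 + phi ^+ 2], while the denominator
    grows quadratically. *)
Let ratio (phi : 'cV[R]_3 -> R) c : 0 <= c ->
  measurable_fun setT (phi : borel3 R -> R) -> (forall x, phi x ^+ 2 <= c * sqn x) ->
  bm (fun x => phi x * (e + sqn x)^-1).
Proof.
move=> c0 mphi phic; split; first exact: (measurable_funM mphi (inv_shift e0).1).
exists (e^-1 + c) => x; have r0 := sqn_ge0 x.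
have er : 0 < e + sqn x by rewrite ltr_wpDr.
rewrite normrM normfV (gtr0_norm er) ler_pdivrMr//.
apply: (@le_trans _ _ (1 + c * sqn x)).
  have := sqr_ge0 (`|phi x| - 1); rewrite sqrrB real_normK ?num_real// expr1n mulr1.
  have := phic x; have := sqr_ge0 `|phi x|; rewrite real_normK ?num_real//.
  by move: (phi x ^+ 2) (_ * sqn x) `|_| => *; lra.
rewrite mulrDl !mulrDr mulVf ?gt_eqF//.
have : 0 <= e^-1 * sqn x by rewrite mulr_ge0// invr_ge0 ltW.
have : 0 <= c * e by rewrite mulr_ge0// ltW.
by move: (_ * sqn x) (_ * sqn x) (c * e) => *; lra.
Qed.

Let bm_dot : bm (fun x => dot x b * (e + sqn x)^-1).
Proof.
apply: (ratio (sqn_ge0 b)) => [|x]; last by rewrite mulrC; exact: dot_sqr_le.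
by apply: measurable_sum => i; apply: measurable_funM => //; exact: measurable_coord.
Qed.

Let bm_dispersion i : bm (fun x => (S *m x) i 0 * (e + sqn x)^-1).
Proof.
have c0 : 0 <= 4 * (1 + 3 * (mu ^+ 2)^-1) ^+ 2 by rewrite mulr_ge0// sqr_ge0.
apply: (ratio c0) => [|x]; last first.
  exact: le_trans (coord_sqr_le_sqn _ i) (sqn_dispersion_le mu x).
rewrite (_ : (fun _ => _) = (fun x : 'cV[R]_3 => \sum_j S i j * x j 0)); last first.
  by apply/funext => x; rewrite mxE.
by apply: measurable_sum => j; apply: measurable_funM => //; exact: measurable_coord.
Qed.

Lemma bounded_measurable_log_barrier : bm (fun x => log_barrier e (sqn x)).
Proof.
split; last first.
  exists e^-1 => x; rewrite ger0_norm ?log_barrier_ge0 ?sqn_ge0//.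
  by rewrite log_barrier_le ?sqn_ge0.
apply: measurable_funB; apply: measurableT_comp => //.
  by apply: measurable_funD => //; exact: measurable_sqn.
by apply: measurable_funD => //; exact: measurable_sqn.
Qed.

Lemma bounded_measurable_barrier_drift : bm (barrier_drift b e).
Proof.
apply: bounded_measurableM; first exact: bounded_measurable_cst.
by apply: bounded_measurableM; [exact: inv_shift|exact: bm_dot].
Qed.

Lemma bounded_measurable_barrier_lin h i : bm (fun x => barrier_lin mu b e k h x i).
Proof.
apply: bounded_measurableD; apply: bounded_measurableM; try exact: bounded_measurable_cst.
  apply: bounded_measurableM; first exact: inv_shift.
  apply: bounded_measurableD; first exact: bm_dispersion.
  by apply: bounded_measurableM; [exact: bounded_measurable_cst|exact: inv_shift].
by apply: bounded_measurableM; [exact: bm_dot|exact: bm_dispersion].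
Qed.

Lemma bounded_measurable_barrier_quad i j : bm (fun x => barrier_quad mu e k x i j).
Proof.
apply: bounded_measurableD; apply: bounded_measurableM; try exact: bounded_measurable_cst.
  by apply: bounded_measurableM; exact: inv_shift.
by apply: bounded_measurableM; exact: bm_dispersion.
Qed.

End barrier_measurable.

(** * The barrier along a solution and nonattainability of 0 *)

Lemma closure_cone_sqn_le (R : realType) (p mu : R) : 1 <= p -> 0 < mu ->
  exists2 a : R, 0 < a & forall x i, closure (cone p mu) x ->
    a * sqn x <= x i 0 ^+ 2.
Proof.
move=> p1 mu0; set eps := (mu ^+ 2)^-1.
have eps0 : 0 < eps by rewrite invr_gt0 exprn_gt0.
have c0 : 0 < 3 * (1 + eps) ^+ 2 by rewrite mulr_gt0// exprn_gt0// addr_gt0.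
exists (eps ^+ 2 / (3 * (1 + eps) ^+ 2)) => [|x i clx].
  by rewrite divr_gt0// exprn_gt0.
rewrite mulrAC ler_pdivrMr// /sqn mulr_sumr.
have -> : x i 0 ^+ 2 * (3 * (1 + eps) ^+ 2) = \sum_(j < 3) (x i 0 * (1 + eps)) ^+ 2.
  by rewrite !big_ord_recl big_ord0; ring.
apply: ler_sum => j _; rewrite -exprMn lerXn2r ?nnegrE//.
- by rewrite mulr_ge0 ?(ltW eps0)//; exact: closure_cone_coord_ge0 clx.
- by rewrite mulr_ge0 ?addr_ge0 ?(ltW eps0)//; exact: closure_cone_coord_ge0 clx.
- by rewrite [leRHS]mulrC; exact: (closure_cone_coord_ge p1 mu0).
Qed.

(* [filtration X W gamma lam t] unfolds to [<<s history X W gamma lam t>>]. *)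
Definition history (R : realType) d (T : measurableType d)
    (X W gamma : R -> T -> 'cV[R]_3) (lam : T -> cumulative R R) (t : R) :
    set (set T) :=
  \bigcup_(s in `[0, t])
    (sigma3 (X s) `|` sigma3 (W s) `|` sigma3 (gamma s) `|`
     preimage_set_system setT (fun w => lam w s : R) (measurable : set (set R))).

Section barrier_process.
Variables (R : realType) (p mu : R) (b : 'cV[R]_3).
Hypotheses (p1 : 1 <= p) (mu0 : 0 < mu).
Hypothesis mu_large : (1 + 3 * (mu ^+ 2)^-1) ^+ 2 < 2.
Variables (d : measure_display) (T : measurableType d).
Variables (P : probability T R) (X W gamma : R -> T -> 'cV[R]_3).
Variable lam : T -> cumulative R R.
Hypotheses (cX : continuous_process X) (BW : brownian_motion P W).
Hypothesis mlam : forall t, 0 <= t -> measurable_fun setT (fun w => lam w t : R).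
Hypothesis rgamma : forall t, 0 <= t -> rv3 (gamma t).
Hypothesis mgamma : forall w, measurable_fun (`[0, +oo[ : set R)
  (fun t => gamma t w : borel3 R).
Hypothesis indep : forall t, 0 <= t ->
  independent_systems P (future_increments W t) (filtration X W gamma lam t).
Hypothesis eqE : {ae P, forall w, equation_E p mu b
  (X ^~ w) (W ^~ w) (gamma ^~ w) (lam w)}.

Lemma filtration_measurable t : filtration X W gamma lam t `<=` measurable.
Proof.
apply: smallest_sub; first exact: sigma_algebra_measurable.
move=> A [s]; rewrite /= in_itv/= => /andP[s0 _].
move=> [[[]|]|] [B mB <-]; [exact: cX.1| |exact: rgamma|exact: mlam].
by case: BW => -[rW _] _ _ _; exact: rW.
Qed.

Lemma filtration_le s t A : s <= t ->
  filtration X W gamma lam s A -> filtration X W gamma lam t A.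
Proof.
move=> st; apply: sub_sigma_algebra2 => B [u us UB]; exists u => //.
by move: us; rewrite /= !in_itv/= => /andP[-> /le_trans]; apply.
Qed.

(* The barrier along [X], frozen at its value on the sphere outside of [A]. *)
Definition stopped_barrier (e t : R) (A : set T) (w : T) : R :=
  \1_A w * log_barrier e (sqn (X t w)) + \1_(~` A) w * log_barrier e e.

Lemma bounded_measurable_comp_X t (phi : 'cV[R]_3 -> R) : 0 <= t ->
  bounded_measurable (open : set (set 'cV[R]_3)) phi ->
  bounded_measurable (history X W gamma lam t) (fun w => phi (X t w)).
Proof.
move=> t0 [mphi [M phiM]]; split; last by exists M.
move=> _ B mB; rewrite setTI.
have := mphi measurableT B mB; rewrite setTI => mphiB.
have := @filtration_X _ _ _ X W gamma lam t t _ _ mphiB.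
by rewrite t0 lexx => /(_ isT).
Qed.

Lemma bounded_measurable_stopped_barrier e t A : 0 < e < 1 -> 0 <= t ->
  filtration X W gamma lam t A ->
  bounded_measurable (history X W gamma lam t) (stopped_barrier e t A).
Proof.
move=> e01 t0 FA; apply: bounded_measurableD; apply: bounded_measurableM.
- exact: bounded_measurable_indic.
- exact: bounded_measurable_comp_X t0 (bounded_measurable_log_barrier e01).
- by apply: bounded_measurable_indic; exact: sigma_algebraC.
- exact: bounded_measurable_cst.
Qed.

Lemma stopped_barrier_mean e t A : 0 < e < 1 -> 0 <= t ->
  filtration X W gamma lam t A ->
  has_mean P (stopped_barrier e t A) (\int[P]_w stopped_barrier e t A w)%R.
Proof.
move=> e01 t0 FA.
apply: (@bounded_measurable_mean _ _ _ P (history X W gamma lam t)).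
  exact: filtration_measurable.
exact: bounded_measurable_stopped_barrier.
Qed.

Lemma event_sqn_gt e t : 0 <= t -> filtration X W gamma lam t [set w | e < sqn (X t w)].
Proof.
move=> t0; apply: (@filtration_X _ _ _ X W gamma lam t t [set x | e < sqn x]).
  by rewrite t0 lexx.
rewrite (_ : [set x | _] = (@sqn R : borel3 R -> R) @^-1` `]e, +oo[%classic).
  rewrite -[X in measurable X]setTI.
  by apply: measurable_sqn => //; exact: measurable_itv.
by apply/seteqP; split=> x /=; rewrite in_itv/= andbT.
Qed.

(** The order of the quantifiers matters: [C] is uniform in [e], while [L] may depend on [e] because
    [h ^+ 2] makes it harmless on fine grids. *)
Lemma stopped_barrier_step : exists2 C : R, 0 <= C & forall e : R, 0 < e < 1 ->
  exists2 L : R, 0 <= L & forall t h A, 0 <= t -> 0 < h <= 1 ->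
    filtration X W gamma lam t A -> A `<=` [set w | e < sqn (X t w)] ->
  (\int[P]_w stopped_barrier e (t + h) (A `&` [set w | e < sqn (X (t + h)%R w)]) w <=
   \int[P]_w stopped_barrier e t A w + C * h + L * h ^+ 2)%R.
Proof.
have m0 := gauss_moment2_gt0 R.
have [C C0 drift] := barrier_drift_le b m0 mu_large.
have [a a0 cone_a] := closure_cone_sqn_le p1 mu0.
exists C => // e e01; set k := (2 - (1 + 3 * (mu ^+ 2)^-1) ^+ 2) / 32 in drift.
have k01 : 0 < k <= 2^-1.
  have := sqr_ge0 (1 + 3 * (mu ^+ 2)^-1); move: mu_large; rewrite /k.
  by move: (_ ^+ 2) => q q2 q0; apply/andP; split; lra.
have [K K0 expand] := barrier_expansion mu b e01 k01 a0.
pose m4 := gauss_moment R 4.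
exists (K + K * (3 * `|m4|)) => [|t h A t0 /andP[h0 h1] FA Ae].
  by rewrite addr_ge0 ?mulr_ge0.
have th0 : 0 <= t + h by rewrite addr_ge0 // ltW.
set A' := A `&` _.
have FA' : filtration X W gamma lam (t + h) A'.
  apply: (@measurableI _ (g_sigma_algebraType (history X W gamma lam (t + h)))).
    by apply: filtration_le FA; rewrite lerDl ltW.
  exact: event_sqn_gt.
pose xi w := W (t + h) w - W t w.
have [[rW cW] W0 incW _] := BW.
have tth : t < t + h by rewrite ltrDl.
have rxi : rv3 xi.
  apply/measurable_fun_borel3P => i.
  rewrite (_ : (fun _ => _) = (fun w => W (t + h) w i 0 - W t w i 0)); last first.
    by apply/funext => w; rewrite !mxE.
  apply: measurable_funB; apply: (measurable_fun_borel3P setT _).1; exact: rW.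
have indep_xi : independent_systems P <<s history X W gamma lam t >> (sigma3 xi).
  move=> B1 B2 FB1 xB2; rewrite setIC muleC; apply: (indep t0) => //.
  apply: sub_sigma_algebra; exists h => //.
  by rewrite /= in_itv/= andbT ltW.
have sh0 : 0 < Num.sqrt h by rewrite sqrtr_gt0.
have law_xi B : (forall i, measurable (B i)) -> P [set w | forall i, B i (xi w i 0)] =
    \big[*%E/1%E]_(i < 3) normal_prob 0 (Num.sqrt h) (B i).
  by move=> mB; rewrite (incW _ _ t0 tth _ mB) addrAC subrr add0r.
pose bm (F : T -> R) := bounded_measurable (history X W gamma lam t) F.
have b1 : bm (\1_A : T -> R) by exact: bounded_measurable_indic.
have bX phi := @bounded_measurable_comp_X t phi t0.
pose drf w := barrier_drift b e (X t w).
pose F0 w := stopped_barrier e t A w + (h * (\1_A w * drf w) + K * h ^+ 2).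
pose F1 i w := \1_A w * barrier_lin mu b e k h (X t w) i.
pose F2 i j w := \1_A w * barrier_quad mu e k (X t w) i j.
have bF0 : bm F0.
  apply: bounded_measurableD; first exact: bounded_measurable_stopped_barrier.
  apply: bounded_measurableD; last exact: bounded_measurable_cst.
  apply: bounded_measurableM; first exact: bounded_measurable_cst.
  by apply: bounded_measurableM => //; apply: bX; exact: bounded_measurable_barrier_drift.
have bF1 i : bm (F1 i).
  apply: bounded_measurableM => //; apply: (bX (fun x => barrier_lin mu b e k h x i)).
  exact: bounded_measurable_barrier_lin.
have bF2 i j : bm (F2 i j).
  apply: bounded_measurableM => //; apply: (bX (fun x => barrier_quad mu e k x i j)).
  exact: bounded_measurable_barrier_quad.
have mF : <<s history X W gamma lam t >> `<=` measurable := @filtration_measurable t.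
have mean F : bm F -> has_mean P F (\int[P]_w F w)%R by exact: bounded_measurable_mean.
have hQ := mean_gaussian_quartic mF rxi indep_xi sh0 law_xi K bF0 bF1 bF2.
have le_ae : {ae P, forall w, stopped_barrier e (t + h) A' w <= F0 w +
    \sum_i F1 i w * xi w i 0 + \sum_i \sum_j F2 i j w * (xi w i 0 * xi w j 0) +
    K * \sum_i xi w i 0 ^+ 4}.
  apply: filterS2 W0 eqE => w W0w eqw; rewrite /F0 /F1 /F2.
  have X40 : 0 <= K * \sum_i xi w i 0 ^+ 4.
    by rewrite mulr_ge0// sumr_ge0// => i _; rewrite exprn_even_ge0.
  have Kh : 0 <= K * h ^+ 2 by rewrite mulr_ge0// sqr_ge0.
  have indC (B : set T) : \1_(~` B) w = 1 - \1_B w :> R.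
    by rewrite !indicE in_setC; case: (w \in B); rewrite ?subr0 ?subrr.
  have ind' : \1_A' w = \1_A w * (e < sqn (X (t + h) w))%R%:R :> R.
    rewrite !indicE in_setI -natrM mulnb; congr (nat_of_bool (_ && _))%:R.
    by apply/idP/idP => [/set_mem//|?]; exact: mem_set.
  have [Aw|nAw] := boolP (w \in A); last first.
    have A0 : \1_A w = 0 :> R by rewrite indicE (negbTE nAw).
    rewrite /stopped_barrier !indC ind' A0 !mul0r mulr0.
    rewrite big1 => [|i _]; last by rewrite !mul0r.
    rewrite big1 => [|i _]; last by rewrite big1// => j _; rewrite !mul0r.
    by rewrite !add0r !addr0 subr0 -addrA lerDl addr_ge0.
  have A1 : \1_A w = 1 :> R by rewrite indicE Aw.
  have pair := equation_E_reflection_pair p1 mu0 eqw W0w (cX.2 w) (cW w) (mgamma w).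
  have [_ cone_X _ _] := eqw.
  have clX := cone_X _ t0; have clX' := cone_X _ th0.
  have push i : (X t w + (h *: b + dispersion mu *m xi w)) i 0 <= X (t + h) w i 0.
    have [_ _ _ inc _] := pair; have := inc i t (t + h) t0 (ltW tth).
    have := driver_increment (X 0 w) b (W (t + h) w) (W t w) (dispersion mu) t (t + h) i.
    rewrite (_ : t + h - t = h) -/(xi w); last by rewrite addrAC subrr add0r.
    have -> : (X t w + (h *: b + dispersion mu *m xi w)) i 0 =
        X t w i 0 + (h * b i 0 + (dispersion mu *m xi w) i 0).
      by move: (dispersion mu *m xi w) => v; rewrite !mxE.
    have key (x1 x2 q1 q2 c : R) : q2 - q1 = c -> x1 - q1 <= x2 - q2 -> x1 + c <= x2.
      by move=> *; lra.
    exact: key.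
  have h01 : 0 < h <= 1 by rewrite h0 h1.
  have eX : e < sqn (X t w) by apply: Ae; exact: set_mem Aw.
  have := expand h (X t w) (xi w) (X (t + h) w) h01
    (fun i => closure_cone_coord_ge0 p1 mu0 i clX) (fun i => cone_a _ i clX) (ltW eX)
    (fun i => closure_cone_coord_ge0 p1 mu0 i clX') push.
  have -> : stopped_barrier e t A w = log_barrier e (sqn (X t w)).
    by rewrite /stopped_barrier indC A1 subrr mul0r addr0 mul1r.
  rewrite A1 mul1r -/(drf w); under [in X in _ -> X]eq_bigr do rewrite mul1r.
  under [X in _ -> _ <= _ + X + _]eq_bigr do under eq_bigr do rewrite mul1r.
  have : stopped_barrier e (t + h) A' w <= log_barrier e (sqn (X (t + h) w)).
    rewrite /stopped_barrier indC ind' A1 mul1r; case: ltP => [_|re].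
      by rewrite mul1r subrr mul0r addr0.
    by rewrite mul0r subr0 mul1r add0r log_barrier_anti ?sqn_ge0.
  move: (stopped_barrier _ _ _ _) (log_barrier _ _) (log_barrier _ _) (K * _) (K * _).
  move: (\sum_i _) (\sum_i _) (h * _) => *; lra.
have le1 := has_mean_le (stopped_barrier_mean e01 th0 FA') hQ le_ae.
have hS := has_meanD (mean _ bF0)
  (has_mean_sum (fun i => has_meanZ (h * gauss_moment R 2)
     (mean _ (bF2 i i)))).
have hC := has_meanD (stopped_barrier_mean e01 t0 FA) (has_mean_cst P (C * h + K * h ^+ 2)).
have le2 : {ae P, forall w, F0 w + \sum_i h * gauss_moment R 2 * F2 i i w <=
    stopped_barrier e t A w + (C * h + K * h ^+ 2)}.
  apply: aeW => w; rewrite /F0 /F2 -addrA lerD2l addrAC lerD2r.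
  have -> : \sum_i h * gauss_moment R 2 * (\1_A w * barrier_quad mu e k (X t w) i i) =
      h * (\1_A w * (gauss_moment R 2 * \sum_i barrier_quad mu e k (X t w) i i)).
    by rewrite !mulr_sumr; apply: eq_bigr => i _; ring.
  rewrite -mulrDr [leRHS]mulrC ler_wpM2l ?(ltW h0)// -mulrDr indicE.
  case: (w \in A); last by rewrite mul0r.
  by rewrite mul1r; exact: drift.
have := has_mean_le hS hC le2; move: le1; rewrite -/m4.
have sE : Num.sqrt h ^+ 2 = h by rewrite sqr_sqrtr// ltW.
rewrite (_ : Num.sqrt h ^+ 4 = h ^+ 2); last by rewrite -[4%N]/(2 * 2)%N exprM sE.
rewrite sE -!mulr_suml -!mulr_sumr [_ * (h * _)]mulrC.
have : K * (3 * (h ^+ 2 * m4)) <= K * (3 * `|m4|) * h ^+ 2.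
  rewrite (_ : _ * h ^+ 2 = K * (3 * (h ^+ 2 * `|m4|))); last by ring.
  rewrite ler_wpM2l// ler_wpM2l// ler_wpM2l ?sqr_ge0//.
  exact: ler_norm.
rewrite [(K + _) * _]mulrDl; move: (Rintegral _ _ _) (Rintegral _ _ _) (Rintegral _ _ _).
move: (_ * \sum_i _) (K * _) (K * _) (_ * h ^+ 2) (C * h) => *; lra.
Qed.

Fixpoint above (e h : R) (n : nat) : set T :=
  if n is m.+1 then above e h m `&` [set w | e < sqn (X (m%:R * h + h) w)]
  else [set w | e < sqn (X 0 w)].

Lemma aboveP e h n w :
  above e h n w <-> forall j, (j <= n)%N -> e < sqn (X (j%:R * h) w).
Proof.
elim: n => [|n IH] /=.
  split=> [H j|/(_ 0%N isT)]; last by rewrite mul0r.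
  by rewrite leqn0 => /eqP ->; rewrite mul0r.
have E : n%:R * h + h = n.+1%:R * h by rewrite -natr1 mulrDl mul1r.
rewrite E; split=> [[/IH H1 H2] j|H]; last first.
  by split; [apply/IH => j jn; apply: H; exact: leqW|exact: H].
by rewrite leq_eqVlt => /predU1P[->|] //; rewrite ltnS => /H1.
Qed.

Lemma filtration_above e h n : 0 <= h -> filtration X W gamma lam (n%:R * h) (above e h n).
Proof.
move=> h0; elim: n => [|n IH] /=; first by rewrite mul0r; exact: event_sqn_gt.
have nh : 0 <= n%:R * h by rewrite mulr_ge0.
have E : n%:R * h + h = n.+1%:R * h by rewrite -natr1 mulrDl mul1r.
apply: (@measurableI _ (g_sigma_algebraType (history X W gamma lam (n.+1%:R * h)))).
  by apply: filtration_le IH; rewrite -E lerDl.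
by rewrite E; apply: event_sqn_gt; rewrite -E addr_ge0.
Qed.

Lemma above_measurable e h n : 0 <= h -> measurable (above e h n).
Proof. by move=> h0; apply: filtration_measurable; exact: filtration_above. Qed.

(** Markov's inequality: outside [above] the nonnegative stopped barrier equals its value at [e],
    and its mean grows by at most [C * h + L * h ^+ 2] per cell. *)
Lemma prob_not_above_le x : starts_at P X x ->
  exists2 C : R, 0 <= C & forall e : R, 0 < e < 1 -> e < sqn x ->
  exists2 L : R, 0 <= L & forall h n, 0 < h <= 1 ->
    (P (~` above e h n) <=
     ((log_barrier e (sqn x) + n%:R * h * (C + L * h)) / log_barrier e e)%:E)%E.
Proof.
move=> Xx; have [C C0 step] := stopped_barrier_step.
exists C => // e /[dup] e01 /andP[e0 e1] ex; have [L L0 {}step] := step e e01.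
exists L => // h n /andP[h0 h1].
have v0 : 0 < log_barrier e e.
  rewrite subr_gt0 ltr_ln ?posrE ?addr_gt0//.
  by rewrite ltrD2r.
pose mean k := (\int[P]_w stopped_barrier e (k%:R * h) (above e h k) w)%R.
have kh0 k : 0 <= k%:R * h by rewrite mulr_ge0// ltW.
have meanP k : has_mean P (stopped_barrier e (k%:R * h) (above e h k)) (mean k).
  by apply: stopped_barrier_mean => //; apply: filtration_above; exact: ltW.
have mean_le k : mean k <= log_barrier e (sqn x) + k%:R * h * (C + L * h).
  elim: k => [|k IH].
    rewrite mul0r mul0r addr0.
    apply: (has_mean_le (meanP 0%N) (has_mean_cst P _)).
    apply: filterS Xx => w Xw; rewrite /stopped_barrier /= mul0r Xw !indicE.
    rewrite in_setC mem_set/= ?Xw//.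
    by rewrite mul1r mul0r addr0.
  have E : k%:R * h + h = k.+1%:R * h by rewrite -natr1 mulrDl mul1r.
  have h01 : 0 < h <= 1 by rewrite h0.
  have := step (k%:R * h) h (above e h k) (kh0 k) h01 (@filtration_above e h k (ltW h0)).
  have sub : above e h k `<=` [set w | e < sqn (X (k%:R * h) w)].
    by move=> w /aboveP; apply.
  move=> /(_ sub); rewrite -/(mean k) => H.
  have -> : mean k.+1 = (\int[P]_w stopped_barrier e (k%:R * h + h)
      (above e h k `&` [set w | (e < sqn (X (k%:R * h + h)%R w))%R]) w)%R.
    by rewrite /mean /= E.
  apply: (le_trans H); rewrite -E !mulrDl.
  move: IH; rewrite mulrDr; move: (log_barrier _ _) (k%:R * h) (mean k) => *; nra.
have m1 : measurable (~` above e h n) by apply: measurableC; apply: above_measurable; exact: ltW.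
have := has_mean_le (has_meanZ (log_barrier e e) (has_mean_indic P m1)) (meanP n).
have ae1 : {ae P, forall w, log_barrier e e * \1_(~` above e h n) w <=
    stopped_barrier e (n%:R * h) (above e h n) w}.
  apply: aeW => w; rewrite /stopped_barrier [leLHS]mulrC lerDr mulr_ge0//.
  by rewrite log_barrier_ge0 ?sqn_ge0.
move=> /(_ ae1) H; rewrite -[leLHS]fineK; last exact: fin_num_measure.
rewrite lee_fin ler_pdivlMr// mulrC; exact: le_trans H (mean_le n).
Qed.

(* Hitting 0 is approximated by events on dyadic grids, which are measurable:
   eventually, the path sampled on the grid of mesh [2^-1 ^+ m] in [[0, N]] meets
   the ball of squared radius [e]. *)
Definition grid_near0 (e : R) (N : nat) : set T :=
  \bigcup_k \bigcap_(m in [set m | (k <= m)%N])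
    ~` above e (2^-1 ^+ m) (N * 2 ^ m).

Lemma measurable_grid_near0 e N : measurable (grid_near0 e N).
Proof.
apply: bigcup_measurable => k _; apply: bigcap_measurable => [|m _].
  by exists k => /=.
by apply: measurableC; apply: above_measurable; rewrite exprn_ge0.
Qed.

(** The events increase with [k], and each is contained in the event of a single mesh. The summand
    [1] absorbs [N * L * h] once the mesh is fine. *)
Lemma prob_grid_near0_le x : starts_at P X x ->
  exists2 C : R, 0 <= C & forall e : R, 0 < e < 1 -> e < sqn x -> forall N,
    (P (grid_near0 e N) <=
     ((log_barrier e (sqn x) + N%:R * C + 1) / log_barrier e e)%:E)%E.
Proof.
move=> Xx; have [C C0 prob] := prob_not_above_le Xx.
exists C => // e /[dup] e01 /andP[e0 e1] ex N; have [L L0 {}prob] := prob e e01 ex.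
pose G k := \bigcap_(m in [set m | (k <= m)%N]) ~` above e (2^-1 ^+ m) (N * 2 ^ m).
have mG k : measurable (G k).
  apply: bigcap_measurable => [|m _]; first by exists k => /=.
  by apply: measurableC; apply: above_measurable; rewrite exprn_ge0.
have ndG : nondecreasing_seq G.
  by move=> k l kl; apply/subsetPset => w Gw m /= lm; apply: Gw; exact: leq_trans lm.
have v0 : 0 < log_barrier e e.
  by rewrite subr_gt0 ltr_ln ?posrE ?addr_gt0// ltrD2r.
apply: cvge_le (nondecreasing_cvg_mu mG (measurable_grid_near0 e N) ndG).
have NL : 0 < N%:R * L + 1 by rewrite ltr_wpDl// mulr_ge0.
have h01 : 0 <= (2^-1 : R) < 1 by rewrite invr_ge0 ler0n/= invf_lt1// ltr1n.
have NL' : 0 < (N%:R * L + 1)^-1 by rewrite invr_gt0.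
apply: filterS (near_expr_lt h01 NL') => k hk; set h : R := 2^-1 ^+ k in hk.
have h0 : 0 < h by rewrite exprn_gt0// invr_gt0.
have h1 : h <= 1 by rewrite exprn_ile1//; case/andP: h01 => ? /ltW.
apply: (@le_trans _ _ (P (~` above e h (N * 2 ^ k)))).
  apply: le_measure; rewrite ?inE//; last by move=> w; apply => /=.
  by apply: measurableC; apply: above_measurable; exact: ltW.
have h01' : 0 < h <= 1 by rewrite h0.
apply: (le_trans (prob h _ h01')); rewrite lee_fin ler_wpM2r ?invr_ge0 ?(ltW v0)//.
have -> : (N * 2 ^ k)%:R * h = N%:R.
  by rewrite natrM natrX /h exprVn mulfK// expf_neq0.
have : N%:R * L * h <= 1.
  have NLi : (N%:R * L + 1) * h <= 1 by rewrite mulrC -ler_pdivlMr// div1r ltW.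
  by move: NLi; rewrite mulrDl mul1r; move: (_ * h) => *; lra.
by rewrite mulrDr mulrA; move: (N%:R * L * h) (N%:R * C) (log_barrier _ _) => *; lra.
Qed.

(** The numerator stays below [ln (1 + r) - ln r + c], while the denominator is at least
    [- ln (2 * e)], hence at least [M] when [e <= expR (- M) / 2]. *)
Lemma exists_small_ratio (r c eta : R) : 0 < r -> 0 <= c -> 0 < eta ->
  exists e : R, [/\ 0 < e < 1, e < r & (log_barrier e r + c) / log_barrier e e <= eta].
Proof.
move=> r0 c0 eta0; pose M := (ln (1 + r) - ln r + c) / eta.
pose e := Num.min (2^-1 : R) (Num.min (r / 2) (expR (- M) / 2)).
have e0 : 0 < e by rewrite !lt_min invr_gt0 ltr0n/= !divr_gt0 ?expR_gt0.
have [e1 er eM] : [/\ e <= 2^-1, e <= r / 2 & e <= expR (- M) / 2].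
  by split; rewrite /e !ge_min lexx ?orbT.
have e1' : 0 < e < 1 by rewrite e0 (le_lt_trans e1)// invf_lt1// ltr1n.
exists e; split=> //.
  by rewrite (le_lt_trans er)// ltr_pdivrMr// ltr_pMr// ltr1n.
have er0 : 0 < e + r by rewrite addr_gt0.
have Vr : log_barrier e r <= ln (1 + r) - ln r.
  by rewrite lerD2l lerN2 ler_ln ?posrE// lerDr ltW.
have Ve : M <= log_barrier e e.
  have ee0 : 0 < e + e by rewrite addr_gt0.
  have h1 : 0 <= ln (1 + e) by rewrite ln_ge0// lerDl ltW.
  have h2 : ln (e + e) <= - M.
    rewrite -[leRHS]expRK ler_ln ?posrE ?expR_gt0//.
    by rewrite [leRHS]splitr lerD.
  by rewrite /log_barrier; move: h1 h2; move: (ln _) (ln _) => *; lra.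
have v0 : 0 < log_barrier e e.
  by rewrite subr_gt0 ltr_ln ?posrE ?addr_gt0// ltrD2r; case/andP: e1'.
rewrite ler_pdivrMr// (@le_trans _ _ (eta * M))//; last by rewrite ler_wpM2l// ltW.
by rewrite /M mulrCA divff ?gt_eqF// mulr1 lerD2r.
Qed.

Lemma sqn_eq0 (x : 'cV[R]_3) : sqn x = 0 -> x = 0.
Proof. by move=> x0; apply: enorm_eq0; rewrite /enorm -/(sqn x) x0 sqrtr0. Qed.

Let continuous_sqn_X w : continuous (fun t : R => sqn (X (Num.max 0 t) w)).
Proof.
rewrite (_ : (fun _ => _) = (fun t : R => enorm (X (Num.max 0 t) w) * enorm (X (Num.max 0 t) w))).
  have ce := continuous_enorm (continuous_max0 (cX.2 w)).
  by move=> t; apply: cvgM; exact: ce.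
by apply/funext => t; rewrite -expr2 sqr_sqrtr// sqn_ge0.
Qed.

Lemma hit_grid_near0 e N t w : 0 < e -> 0 <= t <= N%:R -> X t w = 0 ->
  grid_near0 e N w.
Proof.
move=> e0 /andP[t0 tN] Xt; pose f s := sqn (X (Num.max 0 s) w).
have ft : f t = 0.
  by rewrite /f max_r// Xt /sqn big1// => i _; rewrite mxE expr0n.
have : \forall s \near t, f s < e.
  have lte : nbhs (f t) [set y | y < e].
    by apply: open_nbhs_nbhs; split; [exact: open_lt|rewrite /= ft].
  exact: (@continuous_sqn_X w t _ lte).
move=> /nbhs_ballP[r /= r0 rf].
have h01 : 0 <= (2^-1 : R) < 1 by rewrite invr_ge0 ler0n/= invf_lt1// ltr1n.
have [k _ kr] := near_expr_lt h01 r0.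
exists k => // m /= km /aboveP H.
have /andP[jt tj] := dyadic_approx m t0; set j := Num.truncn _ in jt tj.
have hm0 : 0 < (2^-1 : R) ^+ m by rewrite exprn_gt0// invr_gt0.
have jN : (j <= N * 2 ^ m)%N.
  rewrite -(ler_nat R) natrM natrX -(ler_pM2r hm0) (le_trans jt)// (le_trans tN)//.
  by rewrite exprVn mulfK// expf_neq0.
have := H j jN; rewrite ltNge => /negP; apply.
have jh0 : 0 <= j%:R * 2^-1 ^+ m :> R by rewrite mulr_ge0// ltW.
rewrite -[j%:R * _](max_r jh0) ltW//; apply: rf.
rewrite /ball/= ger0_norm ?subr_ge0// ltrBlDl (lt_le_trans tj)//.
rewrite -natr1 mulrDl mul1r lerD2l ltW//; exact: kr.
Qed.

(** A continuous path attains its minimal square norm on the interval; were it positive, a radius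
    below it would keep every grid sample outside the ball. *)
Lemma grid_near0_hit N w : (forall n : nat, grid_near0 n.+2%:R^-1 N w) ->
  exists2 t, 0 <= t <= N%:R & X t w = 0.
Proof.
move=> near0; pose f s := sqn (X (Num.max 0 s) w).
have [||t] := @EVT_min R f 0 N%:R; first by [].
  by apply: continuous_subspaceT; exact: continuous_sqn_X.
rewrite in_itv/= => tN minf; exists t => //; have /andP[t0 _] := tN.
apply: sqn_eq0; rewrite -[t](max_r t0) -/(f t); apply/eqP.
rewrite eq_le sqn_ge0 andbT leNgt; apply/negP => ft0.
pose n := Num.truncn (f t)^-1.
have nf : n.+2%:R^-1 < f t.
  rewrite -[ltRHS]invrK ltf_pV2 ?posrE ?invr_gt0//.
  by rewrite (lt_trans (truncnS_gt _))// ltr_nat.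
have [k _ /(_ k (leqnn k))] := near0 n; apply; apply/aboveP => j jN.
have hk0 : 0 < (2^-1 : R) ^+ k by rewrite exprn_gt0// invr_gt0.
have jh0 : 0 <= j%:R * 2^-1 ^+ k :> R by rewrite mulr_ge0// ltW.
rewrite (lt_le_trans nf)// -[j%:R * _](max_r jh0); apply: minf.
rewrite in_itv/= jh0/= -[N%:R](mulfK (_ : 2 ^+ k != 0)) ?expf_neq0//.
by rewrite -exprVn ler_pM2r// -natrX -natrM ler_nat.
Qed.

Lemma hit0_lty_bigcup : [set w | (hit0 X w < +oo)%E] =
  \bigcup_N \bigcap_n grid_near0 n.+2%:R^-1 N.
Proof.
apply/seteqP; split=> w.
  move=> /ereal_inf_lt[_ [t [t0 Xt] <-] _].
  exists (Num.truncn t).+1 => // n _; apply: (hit_grid_near0 _ _ Xt).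
    by rewrite invr_gt0.
  by rewrite t0 ltW// truncnS_gt.
move=> [N _ /(_ _ I) near0]; have [t /andP[t0 _] Xt] := grid_near0_hit near0.
apply: (@le_lt_trans _ _ t%:E); last exact: ltry.
by apply: ereal_inf_lbound; exists t.
Qed.

Lemma hit0_null x : starts_at P X x -> x != 0 ->
  P [set w | (hit0 X w < +oo)%E] = 0%E.
Proof.
move=> Xx x0; have r0 : 0 < sqn x.
  rewrite lt_neqAle sqn_ge0 andbT; apply/eqP => /esym/sqn_eq0 x00.
  by rewrite x00 eqxx in x0.
have [C C0 prob] := prob_grid_near0_le Xx.
have mN N : measurable (\bigcap_n grid_near0 n.+2%:R^-1 N).
  by apply: bigcapT_measurable => n; exact: measurable_grid_near0.
rewrite hit0_lty_bigcup; apply: measure_negligible; first exact: bigcupT_measurable.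
apply: negligible_bigcup => N; exists (\bigcap_n grid_near0 n.+2%:R^-1 N); split => //.
apply/eqP; rewrite eq_le measure_ge0 andbT; apply/lee_addgt0Pr => eta eta0.
have c0 : 0 <= N%:R * C + 1 by rewrite addr_ge0// mulr_ge0.
have [e [e01 er small]] := exists_small_ratio r0 c0 eta0.
rewrite add0e (@le_trans _ _ (P (grid_near0 e N)))//.
  apply: le_measure; rewrite ?inE//; first exact: measurable_grid_near0.
  (* The radius [e] need not be of the form [n.+2%:R^-1], so the inclusion passes through an actual
     zero of the path. *)
  move=> w /(_ _ I) near0; have [t tN Xt] := grid_near0_hit near0.
  by apply: hit_grid_near0 tN Xt; case/andP: e01.
by rewrite (le_trans (prob e e01 er N))// lee_fin -addrA.
Qed.

End barrier_process.

(** * The threshold on [mu], and the theorem *)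

Lemma threshold_lt2 (R : realType) (mu : R) : 0 < mu ->
  Num.sqrt (3 / (Num.sqrt 2 - 1)) < mu -> (1 + 3 * (mu ^+ 2)^-1) ^+ 2 < 2.
Proof.
move=> mu0; set s := Num.sqrt 2; have s2 : s ^+ 2 = 2 by rewrite sqr_sqrtr.
have s1 : 0 < s - 1.
  by rewrite subr_gt0 -sqrtr1 ltr_sqrt// ltr1n.
have r0 : 0 <= 3 / (s - 1) by rewrite divr_ge0// ltW.
move=> smu; have : Num.sqrt (3 / (s - 1)) ^+ 2 < mu ^+ 2.
  by rewrite ltrXn2r ?nnegrE ?sqrtr_ge0// ltW.
rewrite sqr_sqrtr// ltr_pdivrMr// => H.
have m0 : 0 < mu ^+ 2 by rewrite exprn_gt0.
rewrite -s2 ltrXn2r ?nnegrE ?sqrtr_ge0//.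
  by rewrite addr_ge0// divr_ge0// ltW.
by rewrite -ltrBrDl ltr_pdivrMr// mulrC.
Qed.

Theorem theorem2p3 (R : realType) (alpha mu : R) (b : 'cV[R]_3) :
  2 <= alpha -> 0 < mu ->
  (Num.sqrt (3 / (Num.sqrt 2 - 1)) < mu ->
     uniqueness_in_distribution alpha mu b /\
     (forall (d : measure_display) (T : measurableType d)
        (P : probability T R) (X : R -> T -> 'cV[R]_3) (x : 'cV[R]_3),
        solution alpha mu b P X -> closure (cone alpha mu) x -> x != 0 ->
        starts_at P X x ->
        P [set w | (hit0 X w < +oo)%E] = 0%E)) /\
  (forall (d : measure_display) (T : measurableType d)
     (P : probability T R) (X : R -> T -> 'cV[R]_3),
     solution alpha mu b P X -> starts_at P X 0 ->
     {ae P, forall w, (hit_sphere X delta w) @[delta --> 0^'+] --> 0%E}).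
Proof.
move=> a2 mu0; have a1 : 1 <= alpha by rewrite (le_trans _ a2)// ler1n.
split=> [smu|d T P X sol X0]; last exact: (solution_hit_sphere a1 mu0 sol X0).
split; first exact: solution_unique_in_distribution.
move=> d T P X x [cX [W [gamma [lam [BW [mlam _] [rgamma mgamma] indep eqE]]]]] _ x0 Xx.
exact: (hit0_null a1 mu0 (threshold_lt2 mu0 smu) cX BW mlam rgamma mgamma indep eqE Xx x0).
Qed.
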